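(* Let $\mathbb{H}$ be the Heisenberg group, let $\Gamma$ be a discrete subset of $\mathbb{H}$ of the form $\Gamma=\Gamma_1\Gamma_0=\{xz: x\in\Gamma_1,\ z\in\Gamma_0\}$, where $\Gamma_1$ is a discrete subset of $\mathbb{H}$ and $\Gamma_0=\{(0,0,l): l\in\mathbb{Z}\}$, and let $\mathcal{V}\subset L^2(\mathbb{H})$ be a countable set. If $\{T_\sigma(L_k\phi): k\in\Gamma_1,\ \phi\in\mathcal{V}\}$ is a frame for its spanned vector space for almost every $\sigma\in\Pi=[0,1]$, then $\{L_\gamma\phi:\gamma\in\Gamma,\ \phi\in\mathcal{V}\}$ is also a frame for its spanned vector space.
   Context: Heisenberg group: $\mathbb{H}=\mathbb{R}^3$ with product $(p_1,q_1,t_1)(p_2,q_2,t_2)=(p_1+p_2,\,q_1+q_2,\,t_1+t_2+\tfrac12(p_1q_2-q_1p_2))$ and Haar measure equal to Lebesgue measure. Left translation: $L_\gamma\phi(w)=\phi(\gamma^{-1}w)$, $w\in\mathbb{H}$. Schrödinger representations: for $\lambda\in\mathbb{R}\setminus\{0\}$, $\rho_\lambda(p,q,t)$ is the unitary operator on $L^2(\mathbb{R})$ given by $\rho_\lambda(p,q,t)f(x)=e^{i\lambda t}e^{i\lambda(px+\frac12 pq)}f(x+q)$. Fourier transform: for $\varphi\in L^2(\mathbb{H})$ and $\lambda\in\mathbb{R}\setminus\{0\}$, $\widehat{\varphi}(\lambda)=\int_{\mathbb{H}}\varphi(x)\rho_\lambda(x)\,dx$, a Hilbert–Schmidt operator on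 $L^2(\mathbb{R})$; the Plancherel theorem is used in the form $\int_{\mathbb{H}}|\varphi(x)|^2dx=\int_{\mathbb{R}\setminus\{0\}}\|\widehat\varphi(\lambda)\|_{H.S.}^2\,|\lambda|\,d\lambda$, with $\|\cdot\|_{H.S.}$ the Hilbert–Schmidt norm. The space of Hilbert–Schmidt operators on $L^2(\mathbb{R})$ is written $L^2(\mathbb{R})\otimes L^2(\mathbb{R})$. Let $\Pi=[0,1]$ and let $\mathfrak{L}=\ell^2(\mathbb{Z},L^2(\mathbb{R})\otimes L^2(\mathbb{R}))$ be the Hilbert space of square-summable sequences of Hilbert–Schmidt operators. For $\sigma\in\Pi$, $T_\sigma:L^2(\mathbb{H})\to\mathfrak{L}$ is given by $T_\sigma f(j)=|\sigma+j|^{1/2}\widehat f(\sigma+j)$, $j\in\mathbb{Z}$. A family $\{f_i\}_{i\in I}$ ($I$ countable) in a Hilbert space $W$ is a frame for $W$ if there exist constants $0<A\le B<\infty$ such that $A\|f\|^2\le\sum_{i\in I}|\langle f,f_i\rangle|^2\le B\|f\|^2$ for all $f\in W$. The spanned vector space of a family is its closed linear span.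
   Formalization: The frame bounds of the fibres are required to be the same for almost every σ, and the Fourier transform at λ is taken against ρ_{2πλ} (as the stated Plancherel formula and the integer center require); without either change the claim is false. *)

(* Defs.v *)
From HB Require Import structures.
From mathcomp Require Import all_boot all_order all_algebra.
From mathcomp Require Import all_classical all_reals all_analysis.
From mathcomp Require Import complex.

Set Implicit Arguments.
Unset Strict Implicit.
Unset Printing Implicit Defensive.

Import Order.TTheory GRing.Theory Num.Theory.
Import numFieldNormedType.Exports.

Local Open Scope classical_set_scope.
Local Open Scope ring_scope.

Section ComplexAnalysis.
Context {R : realType}.

Definition sqmod (z : R[i]) : R := complex.Re z ^+ 2 + complex.Im z ^+ 2.

(* exp (i t) *)
Definition cis (t : R) : R[i] := Complex (cos t) (sin t).

Definition cmeasurable d (T : measurableType d) (D : set T) (f : T -> R[i]) :=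
  measurable_fun D (fun x => complex.Re (f x)) /\
  measurable_fun D (fun x => complex.Im (f x)).

Definition cintegral d (T : measurableType d) (mu : {measure set T -> \bar R})
    (f : T -> R[i]) : R[i] :=
  Complex (\int[mu]_x complex.Re (f x)) (\int[mu]_x complex.Im (f x)).

Definition cintegrable d (T : measurableType d)
    (mu : {measure set T -> \bar R}) (f : T -> R[i]) :=
  cmeasurable setT f /\ (\int[mu]_x (Num.sqrt (sqmod (f x)))%:E < +oo)%E.

(* Unconditional sums over an arbitrary index type; meaningful for absolutely
   summable families. *)
Definition rsum (T : choiceType) (a : T -> R) : R :=
  fine (\esum_(i in setT) (a^\+ i)%:E) - fine (\esum_(i in setT) (a^\- i)%:E).

Definition csum (T : choiceType) (a : T -> R[i]) : R[i] :=
  Complex (rsum (fun i => complex.Re (a i))) (rsum (fun i => complex.Im (a i))).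

End ComplexAnalysis.

(* A Hilbert space presented by representatives: the elements are the members of
   [vectors], a subspace of the complex vector space [ambient] on which [inner]
   is a positive semidefinite hermitian form (linear in its first argument), and
   two elements u, v are the same when sqnorm (u - v) = 0. Outside [vectors] the
   value of [inner] is irrelevant. *)
Record hspace (R : realType) := HSpace {
  ambient :> lmodType R[i];
  vectors : set ambient;
  inner : ambient -> ambient -> R[i] }.

Arguments vectors {R} h.
Arguments inner {R h} u v.

Section HilbertSpaces.
Context {R : realType}.

Definition sqnorm (H : hspace R) (u : H) : R := complex.Re (inner u u).

Definition in_span (W : lmodType R[i]) (J : Type) (I : set J) (f : J -> W)
    (s : W) :=
  exists (n : nat) (i : 'I_n -> J) (c : 'I_n -> R[i]),
    (forall k, I (i k)) /\ s = \sum_(k < n) c k *: f (i k).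

Definition closed_span (H : hspace R) (J : Type) (I : set J) (f : J -> H) :
    set H :=
  [set u | vectors H u /\
     forall eps : R, 0 < eps -> exists2 s, in_span I f s & sqnorm (u - s) < eps].

(* The family (f i), i in I, is a frame with bounds A and B for its closed
   linear span. *)
Definition span_frame_bounds (H : hspace R) (J : choiceType) (I : set J)
    (f : J -> H) (A B : R) :=
  [/\ 0 < A, A <= B, forall i, I i -> vectors H (f i) &
      forall u, closed_span I f u ->
        ((A * sqnorm u)%:E <= \esum_(i in I) (sqmod (inner u (f i)))%:E)%E /\
        (\esum_(i in I) (sqmod (inner u (f i)))%:E <= (B * sqnorm u)%:E)%E].

Definition span_frame (H : hspace R) (J : choiceType) (I : set J) (f : J -> H) :=
  exists A B : R, span_frame_bounds I f A B.

Definition orthonormal_basis (H : hspace R) (e : nat -> H) :=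
  [/\ forall n, vectors H (e n),
      forall m n, inner (e m) (e n) = (m == n)%:R &
      vectors H `<=` closed_span setT e].

Definition bounded_operator (H : hspace R) (A : H -> H) :=
  [/\ forall u, vectors H u -> vectors H (A u),
      forall (a : R[i]) (u v : H), vectors H u -> vectors H v ->
        sqnorm (A (a *: u + v) - (a *: A u + A v)) = 0 &
      exists M : R, forall u, vectors H u -> sqnorm (A u) <= M * sqnorm u].

(* The integral, in the weak sense, of an operator-valued function. *)
Definition weak_integral d (T : measurableType d)
    (mu : {measure set T -> \bar R}) (H : hspace R) (K : T -> H -> H)
    (A : H -> H) :=
  bounded_operator A /\
  forall u v, vectors H u -> vectors H v ->
    inner (A u) v = cintegral mu (fun x => inner (K x u) v).

Definition L2 d (T : measurableType d) (mu : {measure set T -> \bar R}) :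
    hspace R :=
  @HSpace R (T -> R[i])
    [set f | cmeasurable setT f /\ (\int[mu]_x (sqmod (f x))%:E < +oo)%E]
    (fun f g => cintegral mu (fun x => f x * (g x)^*%C)).

(* The Hilbert-Schmidt norm and inner product are computed in a given
   orthonormal basis e; neither depends on that choice. *)
Definition hs_sqnorm (H : hspace R) (e : nat -> H) (A : H -> H) : \bar R :=
  (\esum_(n in setT) (sqnorm (A (e n)))%:E)%E.

Definition HS (H : hspace R) (e : nat -> H) : hspace R :=
  @HSpace R (H -> H)
    [set A | bounded_operator A /\ (hs_sqnorm e A < +oo)%E]
    (fun A B => csum (fun n => inner (A (e n)) (B (e n)))).

Definition ell2 (I : choiceType) (H : hspace R) : hspace R :=
  @HSpace R (I -> H)
    [set F | (forall j, vectors H (F j)) /\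
             (\esum_(j in setT) (sqnorm (F j))%:E < +oo)%E]
    (fun F G => csum (fun j => inner (F j) (G j))).

End HilbertSpaces.

(* The Heisenberg group, with elements (p, q, t). *)
Notation heis R := (R * R * R)%type.

Section Heisenberg.
Context {R : realType}.
Local Notation leb := (@lebesgue_measure R).

Definition hmul (x y : heis R) : heis R :=
  let: (p1, q1, t1) := x in let: (p2, q2, t2) := y in
  (p1 + p2, q1 + q2, t1 + t2 + 2^-1 * (p1 * q2 - q1 * p2)).

Definition hinv (x : heis R) : heis R := let: (p, q, t) := x in (- p, - q, - t).

Definition haar : {measure set (measurableTypeR R * measurableTypeR R *
    measurableTypeR R) -> \bar R} := (leb \x leb \x leb)%E.

Definition L2heis : hspace R := L2 haar.

Definition L2real : hspace R := L2 leb.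

Definition translate (g : heis R) (phi : L2heis) : L2heis :=
  fun w : heis R => phi (hmul (hinv g) w).

Definition schrodinger (lambda : R) (g : heis R) (f : L2real) : L2real :=
  let: (p, q, t) := g in
  fun x : R => cis (lambda * t) * cis (lambda * (p * x + 2^-1 * (p * q))) *
               f (x + q).

Definition discrete_set (S : set (heis R)) := S `<=` isolated S.

Definition integer_center : set (heis R) :=
  [set (0, 0, l%:~R) | l in [set: int]].

(* F is the Fourier transform on L2 of the Heisenberg group: the operator-valued
   integral of phi against the Schrodinger representations when phi is both
   integrable and square integrable, extended to all square-integrable phi by
   continuity from L2 to the Hilbert-Schmidt fields that are square integrable
   for |lambda| dlambda. As F phi is only determined for almost every lambda, F
   stands for an arbitrary choice of representatives.

   The frequency variable is the ordinary one, not the angular one: lambda pairs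
   with schrodinger (2 pi lambda). This is the normalization for which the
   Plancherel formula
     int |phi|^2 = int ||F phi lambda||_HS^2 |lambda| dlambda
   has constant 1, and for which [0, 1] is a period for the characters of the
   integer center. *)
Record fourier_transform (e : nat -> L2real) (F : L2heis -> R -> HS e) : Prop :=
  FourierTransform {
    fourier_HS : forall (phi : L2heis) (lambda : R), vectors L2heis phi -> lambda != 0 ->
      vectors (HS e) (F phi lambda);
    fourier_measurable : forall phi u v, vectors L2heis phi ->
      vectors L2real u -> vectors L2real v ->
      @cmeasurable R _ (measurableTypeR R) [set~ (0 : R)]
        (fun lambda => @inner R L2real (F phi lambda u) v);
    fourier_integral : forall phi, vectors L2heis phi -> cintegrable haar phi ->
      {ae leb, forall lambda : R, lambda != 0 ->
        weak_integral haar
          (fun x u => phi x *: schrodinger (2 * pi * lambda) x u)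
          (F phi lambda)};
    fourier_square_integrable : forall phi, vectors L2heis phi ->
      (\int[leb]_(lambda in [set~ (0%R : R)])
         (hs_sqnorm e (F phi lambda) * `|lambda|%:E) < +oo)%E;
    fourier_continuous : forall (phi_ : nat -> L2heis) (phi : L2heis),
      (forall n, vectors L2heis (phi_ n)) -> vectors L2heis phi ->
      sqnorm (phi_ n - phi) @[n --> \oo] --> (0 : R) ->
      (\int[leb]_(lambda in [set~ (0%R : R)])
         (hs_sqnorm e (F (phi_ n) lambda - F phi lambda)%R * `|lambda|%:E))%E
        @[n --> \oo] --> (0 : \bar R)%E }.

Definition fiber (e : nat -> L2real) (F : L2heis -> R -> HS e) (sigma : R)
    (phi : L2heis) : ell2 int (HS e) :=
  fun j : int => (Num.sqrt `|sigma + j%:~R|)%:C%C *: F phi (sigma + j%:~R).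

End Heisenberg.

Arguments L2heis R : clear implicits.
Arguments L2real R : clear implicits.
Arguments integer_center R : clear implicits.

(* Main.v *)
Require Import Defs.
From HB Require Import structures.
From mathcomp Require Import all_boot all_order all_algebra.
From mathcomp Require Import all_classical all_reals all_analysis.
From mathcomp Require Import complex finmap measurable_realfun ring lra.

(** Every square-integrable function on the Heisenberg group is a limit of bounded functions
    supported in boxes, and on these the Fourier transform at [lambda] is given by an
    explicit kernel, so that the Plancherel formula follows from the one on the line; the
    latter comes from Parseval's identity for Fourier series. Together with the unfolding
    of the line over the integers this makes [T_sigma] an isometry from [L2] of the group into
    the direct integral over [0, 1], under which translation by the central element [(0, 0, l)]
    becomes multiplication by [exp (2 pi i sigma l)]. Hence, for fixed [k] and [phi],
    the sum over [l] of [|<f, L_(k (0, 0, l)) phi>|^2] is, again by Parseval,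
    the integral over [sigma] of [|<T_sigma f, T_sigma (L_k phi)>|^2], and the frame inequalities
    on the fibres can be integrated, since [T_sigma f] lies in the span on almost every fibre
    when [f] lies in the span on the group. This bounds sums over [Gamma1 x Z], whereas the
    map from [Gamma1 x Z] to [Gamma] need not be injective; but if [phi0] in [V] is not null, the
    upper frame bound [B] limits the cardinality of its fibres to [B / |phi0|^2]. *)

Set Implicit Arguments.
Unset Strict Implicit.
Unset Printing Implicit Defensive.

Import Order.TTheory GRing.Theory Num.Theory.
Import numFieldNormedType.Exports.

Local Open Scope classical_set_scope.
Local Open Scope ring_scope.

(** Vectors are representatives: an identity between them reads [sqnorm (u - v) = 0], and the fibre
    map is linear and equivariant only outside null sets that depend on the vectors involved. Every
    argument on fibres must get by with countably many of these sets, which is why closed spans pass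
    to the fibres through a single sequence of approximants. [fourier_transform] states neither
    linearity nor equivariance nor Plancherel; all three reach general functions through its
    continuity clause. Parseval on [0, 1] rests on Chernoff's argument for x (1 - x). The squared
    coefficients of a step function are differences of the terms of that Fourier series at two
    points, so its summation gives equality in Bessel's inequality for steps; indicators and simple
    functions follow. For two vectors, the inner product of their fibres is in general only
    integrable in sigma. The upper frame bound makes it square integrable, which Parseval in l
    requires. That [A] and [B] are the same on almost all fibres lets the inequalities be
    integrated. Counting points of [Gamma] up to M times leaves [B] intact and turns [A] into A /
    M. *)

Section SquaredModulus.
Context {R : realType}.
Implicit Types z w : R[i].

Lemma complex_eqP z w :
  complex.Re z = complex.Re w -> complex.Im z = complex.Im w -> z = w.
Proof. by case: z w => [a b] [c d] /= -> ->. Qed.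

Lemma ReD z w : complex.Re (z + w) = complex.Re z + complex.Re w.
Proof. by case: z w => [a b] [c d]. Qed.

Lemma ImD z w : complex.Im (z + w) = complex.Im z + complex.Im w.
Proof. by case: z w => [a b] [c d]. Qed.

Lemma ReN z : complex.Re (- z) = - complex.Re z.
Proof. by case: z. Qed.

Lemma ImN z : complex.Im (- z) = - complex.Im z.
Proof. by case: z. Qed.

Lemma ReM z w : complex.Re (z * w) =
  complex.Re z * complex.Re w - complex.Im z * complex.Im w.
Proof. by case: z w => [a b] [c d]. Qed.

Lemma ImM z w : complex.Im (z * w) =
  complex.Re z * complex.Im w + complex.Im z * complex.Re w.
Proof. by case: z w => [a b] [c d]. Qed.

Lemma ReJ z : complex.Re z^*%C = complex.Re z.
Proof. by case: z. Qed.

Lemma ImJ z : complex.Im z^*%C = - complex.Im z.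
Proof. by case: z. Qed.

Definition ReImE := (ReD, ImD, ReN, ImN, ReM, ImM, ReJ, ImJ).

Lemma conjD z w : (z + w)^*%C = z^*%C + w^*%C.
Proof. by rewrite rmorphD. Qed.

Lemma conjM z w : (z * w)^*%C = z^*%C * w^*%C.
Proof. by rewrite rmorphM. Qed.

Lemma sqmod_ge0 z : 0 <= sqmod z.
Proof. by rewrite addr_ge0 ?sqr_ge0. Qed.

Lemma sqmod0 : sqmod (0 : R[i]) = 0.
Proof. by rewrite /sqmod /= !expr0n /= addr0. Qed.

Lemma sqmod_eq0 z : sqmod z = 0 -> z = 0.
Proof.
move/eqP; rewrite /sqmod paddr_eq0 ?sqr_ge0 // !sqrf_eq0 => /andP[/eqP a /eqP b].
exact: complex_eqP.
Qed.

Lemma sqmodM z w : sqmod (z * w) = sqmod z * sqmod w.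
Proof. by rewrite /sqmod !ReImE; ring. Qed.

Lemma sqmodN z : sqmod (- z) = sqmod z.
Proof. by rewrite /sqmod !ReImE !sqrrN. Qed.

Lemma sqmodJ z : sqmod z^*%C = sqmod z.
Proof. by rewrite /sqmod !ReImE !sqrrN. Qed.

Lemma sqmodJE z : z * z^*%C = Complex (sqmod z) 0.
Proof. by apply: complex_eqP; rewrite !ReImE /sqmod /=; ring. Qed.

Lemma sqmod_real (a : R) : sqmod a%:C%C = a ^+ 2.
Proof. by rewrite /sqmod /= expr0n /= addr0. Qed.

Lemma sqmodD_le z w : sqmod (z + w) <= 2 * (sqmod z + sqmod w).
Proof.
have h (a b : R) : (a + b) ^+ 2 <= 2 * (a ^+ 2 + b ^+ 2).
  by have := sqr_ge0 (a - b); nra.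
by have := h (complex.Re z) (complex.Re w);
   have := h (complex.Im z) (complex.Im w); rewrite /sqmod !ReImE; lra.
Qed.

Lemma sqr_Re_le z : complex.Re z ^+ 2 <= sqmod z.
Proof. by rewrite lerDl sqr_ge0. Qed.

Lemma sqr_Im_le z : complex.Im z ^+ 2 <= sqmod z.
Proof. by rewrite lerDr sqr_ge0. Qed.

Lemma sqmod_cis (t : R) : sqmod (cis t) = 1.
Proof. exact: cos2Dsin2. Qed.

Lemma cisD (s t : R) : cis (s + t) = cis s * cis t.
Proof.
by apply: complex_eqP; rewrite ReImE /= ?cosD ?sinD //; rewrite addrC mulrC.
Qed.

Lemma cis0 : cis (0 : R) = 1.
Proof. by apply: complex_eqP; rewrite /= ?cos0 ?sin0. Qed.

Lemma cisJ (t : R) : (cis t)^*%C = cis (- t).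
Proof. by apply: complex_eqP; rewrite /= ?cosN ?sinN. Qed.

Lemma cis_2pi_nat (n : nat) : cis (2 * pi * n%:R) = 1 :> R[i].
Proof.
elim: n => [|n IH]; first by rewrite mulr0 cis0.
rewrite [n.+1%:R]mulrSr mulrDr cisD IH mul1r mulr1.
by apply: complex_eqP; rewrite /= mulr_natl ?cos2pi ?sin2pi.
Qed.

Lemma cis_2pi_int (n : int) : cis (2 * pi * n%:~R) = 1 :> R[i].
Proof.
case: n => n; first by rewrite -pmulrn cis_2pi_nat.
by rewrite NegzE mulrNz mulrN -cisJ -pmulrn cis_2pi_nat rmorph1.
Qed.

End SquaredModulus.

(** * Hilbert spaces presented by representatives *)

Section Prehilbert.
Context {R : realType}.

(** [hspace] is bare data. These are the axioms of a semidefinite inner product, established below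
    for [ell2], [HS] and [L2]; equality of vectors is left to [sqnorm]. *)
Record prehilb (H : hspace R) : Prop := Prehilb {
  vectors0 : vectors H 0;
  vectorsP : forall a u v, vectors H u -> vectors H v -> vectors H (a *: u + v);
  innerP : forall a u v w, vectors H u -> vectors H v -> vectors H w ->
    inner (a *: u + v) w = a * inner u w + inner v w;
  innerC : forall u v, vectors H u -> vectors H v ->
    inner v u = (inner u v)^*%C;
  sqnorm_ge0 : forall u, vectors H u -> 0 <= sqnorm u }.

Context (H : hspace R) (pH : prehilb H).
Implicit Types (u v w : H) (a : R[i]).
Local Notation vec := (vectors H).
Let v0 := vectors0 pH.
Let vP := vectorsP pH.

Lemma vectorsZ a u : vec u -> vec (a *: u).
Proof. by move=> hu; rewrite -[a *: u]addr0; exact: vP. Qed.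

Lemma vectorsD u v : vec u -> vec v -> vec (u + v).
Proof. by move=> hu hv; rewrite -[u]scale1r; exact: vP. Qed.

Lemma vectorsN u : vec u -> vec (- u).
Proof. by rewrite -scaleN1r; exact: vectorsZ. Qed.

Lemma vectorsB u v : vec u -> vec v -> vec (u - v).
Proof. by move=> hu /vectorsN; exact: vectorsD. Qed.

Lemma vectors_sum (J : Type) (s : seq J) (f : J -> H) :
  (forall j, vec (f j)) -> vec (\sum_(j <- s) f j).
Proof.
move=> hf; elim: s => [|j s IH]; rewrite ?big_nil ?big_cons //.
exact: vectorsD.
Qed.

Lemma inner0l u : vec u -> inner (0 : H) u = 0.
Proof.
move=> hu; have := innerP pH 1 v0 v0 hu.
by rewrite scaler0 addr0 mul1r => /(congr1 (fun z => z - inner 0 u)); rewrite subrr addrK.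
Qed.

Lemma innerZl a u v : vec u -> vec v -> inner (a *: u) v = a * inner u v.
Proof. by move=> hu hv; rewrite -[a *: u]addr0 (innerP pH) // inner0l // addr0. Qed.

Lemma innerDl u v w : vec u -> vec v -> vec w ->
  inner (u + v) w = inner u w + inner v w.
Proof. by move=> hu hv hw; rewrite -{1}[u]scale1r (innerP pH) // mul1r. Qed.

Lemma innerNl u v : vec u -> vec v -> inner (- u) v = - inner u v.
Proof. by move=> hu hv; rewrite -scaleN1r innerZl // mulN1r. Qed.

Lemma innerBl u v w : vec u -> vec v -> vec w ->
  inner (u - v) w = inner u w - inner v w.
Proof. by move=> hu hv hw; rewrite innerDl // ?innerNl //; exact: vectorsN. Qed.

Lemma innerZr a u v : vec u -> vec v -> inner v (a *: u) = a^*%C * inner v u.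
Proof.
move=> hu hv; rewrite (innerC pH (vectorsZ a hu)) // innerZl //.
by rewrite conjM -(innerC pH).
Qed.

Lemma innerDr u v w : vec u -> vec v -> vec w ->
  inner w (u + v) = inner w u + inner w v.
Proof.
move=> hu hv hw; rewrite (innerC pH (vectorsD hu hv)) // innerDl //.
by rewrite conjD -!(innerC pH).
Qed.

Lemma innerNr u v : vec u -> vec v -> inner v (- u) = - inner v u.
Proof.
by move=> hu hv; rewrite -scaleN1r innerZr // rmorphN rmorph1 mulN1r.
Qed.

Lemma Im_inner_self u : vec u -> complex.Im (inner u u) = 0.
Proof.
move=> hu; have := congr1 (@complex.Im R) (innerC pH hu hu).
by rewrite ImJ; lra.
Qed.

Lemma inner_self u : vec u -> inner u u = Complex (sqnorm u) 0.
Proof. by move=> hu; apply: complex_eqP => //=; exact: Im_inner_self. Qed.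

Lemma sqnormP a u v : vec u -> vec v -> sqnorm (a *: u + v) =
  sqmod a * sqnorm u + sqnorm v + 2 * complex.Re (a * inner u v).
Proof.
move=> hu hv; have hau := vectorsZ a hu; rewrite {1}/sqnorm.
rewrite innerDl ?innerDr ?innerZl ?innerZr //; last exact: vectorsD.
rewrite (inner_self hu) (inner_self hv) (innerC pH hu hv) /sqmod !ReImE /=.
by ring.
Qed.

Lemma sqnormZ a u : vec u -> sqnorm (a *: u) = sqmod a * sqnorm u.
Proof.
move=> hu; rewrite {1}/sqnorm innerZl ?innerZr ?inner_self //.
  by rewrite /sqmod !ReImE /=; ring.
exact: vectorsZ.
Qed.

Lemma sqnorm0 : sqnorm (0 : H) = 0.
Proof. by rewrite /sqnorm inner0l. Qed.

Lemma sqnormN u : vec u -> sqnorm (- u) = sqnorm u.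
Proof. by move=> hu; rewrite -scaleN1r sqnormZ // sqmodN /sqmod /=; ring. Qed.

Lemma sqnormD u v : vec u -> vec v ->
  sqnorm (u + v) = sqnorm u + sqnorm v + 2 * complex.Re (inner u v).
Proof.
by move=> hu hv; rewrite -{1}[u]scale1r sqnormP // !mul1r /sqmod /=; ring.
Qed.

Lemma sqnormB u v : vec u -> vec v ->
  sqnorm (u - v) = sqnorm u + sqnorm v - 2 * complex.Re (inner u v).
Proof.
move=> hu hv; rewrite sqnormD ?sqnormN ?innerNr //; last exact: vectorsN.
by rewrite !ReImE; ring.
Qed.

Lemma sqnormBC u v : vec u -> vec v -> sqnorm (u - v) = sqnorm (v - u).
Proof. by move=> hu hv; rewrite -opprB sqnormN //; exact: vectorsB. Qed.

Lemma sqnormD_le u v : vec u -> vec v ->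
  sqnorm (u + v) <= 2 * (sqnorm u + sqnorm v).
Proof.
move=> hu hv; have := sqnorm_ge0 pH (vectorsB hu hv).
by rewrite sqnormB // sqnormD //; lra.
Qed.

(** Positivity of the norm of [- t * z^* *: u + v] gives a polynomial inequality in the real number
    [t]. The form is only semidefinite, so A = 0 is a genuine case; otherwise the minimiser 1 / A
    serves. *)
Lemma CauchySchwarz u v : vec u -> vec v ->
  sqmod (inner u v) <= sqnorm u * sqnorm v.
Proof.
move=> hu hv; set z := inner u v; set A := sqnorm u; set B := sqnorm v.
have A0 : 0 <= A := sqnorm_ge0 pH hu.
have B0 : 0 <= B := sqnorm_ge0 pH hv.
have key (t : R) : 0 <= t ^+ 2 * sqmod z * A + B - 2 * t * sqmod z.
  have := sqnorm_ge0 pH (vP ((- t)%:C%C * z^*%C) hu hv).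
  rewrite sqnormP // -/z -/A -/B sqmodM sqmodJ sqmod_real -[_ * z]mulrA.
  by rewrite (mulrC z^*%C) sqmodJE ReM /= sqrrN; lra.
have z0 := sqmod_ge0 z.
have [A00|A1] := eqVneq A 0.
  rewrite A00 mul0r leNgt; apply/negP => zp.
  (* For A = 0 the polynomial is affine in [t], and this value of [t] makes it equal to -1. *)
  have := key ((B + 1) / (2 * sqmod z)); rewrite A00 mulr0 add0r.
  have -> : 2 * ((B + 1) / (2 * sqmod z)) * sqmod z = B + 1 by field; rewrite gt_eqF.
  by lra.
have Ap : 0 < A by rewrite lt_neqAle eq_sym A1.
have := key A^-1.
have -> : A^-1 ^+ 2 * sqmod z * A + B - 2 * A^-1 * sqmod z = (A * B - sqmod z) / A.
  by field.
by rewrite pmulr_lge0 ?invr_gt0 // subr_ge0.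
Qed.

Lemma inner_null u v : vec u -> vec v -> sqnorm u = 0 -> inner u v = 0.
Proof.
move=> hu hv u0; apply: sqmod_eq0; apply/eqP; rewrite eq_le sqmod_ge0 andbT.
by rewrite (le_trans (CauchySchwarz hu hv)) // u0 mul0r.
Qed.

Lemma inner_nullr u v : vec u -> vec v -> sqnorm v = 0 -> inner u v = 0.
Proof. by move=> hu hv v00; rewrite (innerC pH) // inner_null // rmorph0. Qed.

(** A null vector is orthogonal to everything by Cauchy-Schwarz, so [inner] does not see the choice
    of representative. *)
Lemma inner_congr u u' v : vec u -> vec u' -> vec v -> sqnorm (u - u') = 0 ->
  inner u v = inner u' v.
Proof.
move=> hu hu' hv h; apply/eqP; rewrite -subr_eq0 -innerBl // inner_null //.
exact: vectorsB.
Qed.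

Lemma inner_congr2 u u' v v' : vec u -> vec u' -> vec v -> vec v' ->
  sqnorm (u - u') = 0 -> sqnorm (v - v') = 0 -> inner u v = inner u' v'.
Proof.
move=> hu hu' hv hv' h h'; rewrite (inner_congr hu hu' hv h).
by rewrite (innerC pH hv) // (inner_congr hv hv' hu' h') -(innerC pH).
Qed.

Lemma sqnorm_congr u u' : vec u -> vec u' -> sqnorm (u - u') = 0 ->
  sqnorm u = sqnorm u'.
Proof. by move=> hu hu' h; rewrite /sqnorm (inner_congr2 hu hu' hu hu'). Qed.

Lemma sqnorm_null_add u v : vec u -> vec v -> sqnorm u = 0 -> sqnorm v = 0 ->
  sqnorm (u + v) = 0.
Proof.
move=> hu hv h h'; have := sqnormD_le hu hv.
by have := sqnorm_ge0 pH (vectorsD hu hv); rewrite h h'; lra.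
Qed.

(** Polarization by norms alone, here and in the next lemma: measurability and integrals known for
    squared norms carry over to inner products in this way. *)
Lemma ReinnerE u v : vec u -> vec v ->
  complex.Re (inner u v) = (sqnorm (u + v) - sqnorm u - sqnorm v) / 2.
Proof. by move=> hu hv; rewrite sqnormD //; field. Qed.

Lemma IminnerE u v : vec u -> vec v ->
  complex.Im (inner u v) = (sqnorm (u + 'i%C *: v) - sqnorm u - sqnorm v) / 2.
Proof.
move=> hu hv; rewrite sqnormD // ?sqnormZ ?innerZr //; last exact: vectorsZ.
by rewrite /sqmod !ReImE /=; field.
Qed.

Lemma in_span_vec (J : Type) (I : set J) (f : J -> H) s :
  (forall j, I j -> vec (f j)) -> in_span I f s -> vec s.
Proof.
move=> hf [n [i [c [hi ->]]]]; apply: vectors_sum => k.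
by apply: vectorsZ; apply: hf.
Qed.

End Prehilbert.

(** * Orthonormal families: Bessel's inequality and Parseval's identity *)

Section EsumSeq.
Context {R : realType}.

Lemma esum_seq_le (T : choiceType) (a : T -> R) (b : \bar R) :
  (forall j, 0 <= a j) ->
  (forall s : seq T, uniq s -> ((\sum_(j <- s) a j)%:E <= b)%E) ->
  (\esum_(j in setT) (a j)%:E <= b)%E.
Proof.
move=> a0 h; apply: ub_ereal_sup => _ [X [fX _] <-].
rewrite fsbig_finite //= sumEFin; apply: h; exact: fset_uniq.
Qed.

Lemma seq_le_esum (T : choiceType) (a : T -> R) (s : seq T) :
  (forall j, 0 <= a j) -> uniq s ->
  ((\sum_(j <- s) a j)%:E <= \esum_(j in setT) (a j)%:E)%E.
Proof.
move=> a0 us; apply: ereal_sup_ubound; exists [set` s] => //.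
by rewrite -fsbig_seq // sumEFin.
Qed.

End EsumSeq.

Section Orthonormal.
Context {R : realType} (H : hspace R) (pH : prehilb H).
Context (J : choiceType) (f : J -> H).
Hypothesis vf : forall j, vectors H (f j).
Hypothesis of1 : forall i j, inner (f i) (f j) = (i == j)%:R.
Implicit Types (s : seq J) (v : H).
Local Notation vec := (vectors H).

Lemma vec_comb s (c : J -> R[i]) : vec (\sum_(j <- s) c j *: f j).
Proof. by apply: vectors_sum => // j; apply: vectorsZ. Qed.

Lemma inner_comb s (c : J -> R[i]) j : uniq s -> j \notin s ->
  inner (f j) (\sum_(i <- s) c i *: f i) = 0.
Proof.
elim: s => [|i s IH] /=; first by rewrite big_nil (innerC pH (vectors0 pH)) // inner0l // rmorph0.
move=> /andP[iNs us]; rewrite inE negb_or => /andP[ji js].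
rewrite big_cons innerDr ?innerZr //; first last.
- exact: vec_comb.
- exact: vectorsZ.
by rewrite of1 (negbTE ji) mulr0 add0r IH.
Qed.

(** Induction on [s] completes the square one term at a time. The coefficients are arbitrary:
    [inner v (f j)] gives Bessel, and those of an approximant give Parseval, since the last sum is
    nonnegative. *)
Lemma sqnorm_sub_comb s (c : J -> R[i]) v : vec v -> uniq s ->
  sqnorm (v - \sum_(j <- s) c j *: f j) =
  sqnorm v - \sum_(j <- s) sqmod (inner v (f j)) +
  \sum_(j <- s) sqmod (inner v (f j) - c j).
Proof.
move=> hv; elim: s => [|i s IH] /=; first by rewrite !big_nil !subr0 addr0.
move=> /andP[iNs us]; rewrite !big_cons.
have hw := vec_comb s c; set w := \sum_(j <- s) c j *: f j in hw *.
have hvw : vec (v - w) by apply: vectorsB.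
rewrite [_ + w]addrC opprD addrA sqnormB ?IH //; last exact: vectorsZ.
rewrite sqnormZ // innerZr // innerBl //.
rewrite [inner w _](innerC pH (vf i)) // inner_comb // rmorph0 subr0.
rewrite {2}/sqnorm of1 eqxx /sqmod !ReImE /=.
by ring.
Qed.

Lemma bessel s v : vec v -> uniq s ->
  \sum_(j <- s) sqmod (inner v (f j)) <= sqnorm v.
Proof.
move=> hv us; have := sqnorm_sub_comb (fun j => inner v (f j)) hv us.
have := sqnorm_ge0 pH (vectorsB pH hv (vec_comb s (fun j => inner v (f j)))).
move=> h e; rewrite e in h.
rewrite [X in _ + X]big1 in h; first by rewrite -subr_ge0; move: h; rewrite addr0.
by move=> j _; rewrite subrr sqmod0.
Qed.

Lemma bessel_esum v : vec v ->
  (\esum_(j in setT) (sqmod (inner v (f j)))%:E <= (sqnorm v)%:E)%E.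
Proof.
move=> hv; apply: esum_seq_le => [j|s us]; first exact: sqmod_ge0.
by rewrite lee_fin bessel.
Qed.

Lemma parseval v : closed_span setT f v ->
  (\esum_(j in setT) (sqmod (inner v (f j)))%:E = (sqnorm v)%:E)%E.
Proof.
move=> [hv hc]; apply/eqP; rewrite eq_le bessel_esum //=.
apply/lee_addgt0Pr => eps eps0; have [s [n [i [c [_ ->]]]] lts] := hc _ eps0.
(* An index may occur several times in the approximant; its coefficients are added up so that the
   identity for duplicate-free lists applies. *)
pose t := undup (codom i).
pose d j := \sum_(k < n | i k == j) c k.
have sE : \sum_(k < n) c k *: f (i k) = \sum_(j <- t) d j *: f j.
  under [RHS]eq_bigr do rewrite /d scaler_suml.
  rewrite (exchange_big_dep xpredT) //=; apply: eq_bigr => k _.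
  rewrite (big_rem (i k)) /=; last by rewrite mem_undup codom_f.
  rewrite eqxx big1_seq ?addr0 // => j /andP[/eqP <-].
  by rewrite mem_rem_uniq ?undup_uniq // inE eqxx.
move: lts; rewrite sE sqnorm_sub_comb ?undup_uniq // => lts.
have := @seq_le_esum R _ (fun j => sqmod (inner v (f j))) t (fun j => sqmod_ge0 _) (undup_uniq _).
move=> h; apply: le_trans (leeD2r _ h).
rewrite -EFinD lee_fin.
have : 0 <= \sum_(j <- t) sqmod (inner v (f j) - d j).
  by apply: sumr_ge0 => j _; exact: sqmod_ge0.
lra.
Qed.

End Orthonormal.

(** * Unconditional sums, square-summable sequences and Hilbert-Schmidt operators *)

Section UnconditionalSums.
Context {R : realType} (T : choiceType).
Implicit Types (a b : T -> R) (z w : T -> R[i]).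

Definition rsummable a := (\esum_(i in setT) `|a i|%:E < +oo)%E.

Definition csummable z := rsummable (fun i => complex.Re (z i)) /\
  rsummable (fun i => complex.Im (z i)).

Lemma rsummable_le a b : (forall i, `|a i| <= b i) ->
  (\esum_(i in setT) (b i)%:E < +oo)%E -> rsummable a.
Proof.
by move=> h; apply: le_lt_trans; apply: le_esum => i _; rewrite lee_fin.
Qed.

Lemma summableP_ge0 a : (forall i, 0 <= a i) -> rsummable a ->
  exists r : R, (\esum_(i in setT) (a i)%:E)%E = r%:E /\ 0 <= r.
Proof.
move=> a0 ha; have s0 : (0 <= \esum_(i in setT) (a i)%:E)%E.
  by apply: esum_ge0 => i _; rewrite lee_fin.
have : (\esum_(i in setT) (a i)%:E \is a fin_num)%E.
  rewrite ge0_fin_numE //; apply: le_lt_trans ha.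
  by apply: le_esum => i _; rewrite lee_fin ler_norm.
move=> /fineK <-; exists (fine (\esum_(i in setT) (a i)%:E)%E).
by split=> //; exact: fine_ge0.
Qed.

Lemma posBnegE a i : a i = a^\+ i - a^\- i.
Proof. exact: (congr1 (fun g => g i) (esym (funrposBneg a))). Qed.

Lemma rsummable_pos a : rsummable a -> rsummable a^\+.
Proof.
move=> h; apply: rsummable_le h => i.
rewrite /funrpos ger0_norm ?le_max ?lexx ?orbT //.
by rewrite ge_max ler_norm normr_ge0.
Qed.

Lemma rsummable_neg a : rsummable a -> rsummable a^\-.
Proof.
move=> h; apply: rsummable_le h => i.
rewrite /funrneg ger0_norm ?le_max ?lexx ?orbT //.
by rewrite ge_max normr_ge0 andbT -normrN ler_norm.
Qed.

(** [rsum] is defined by positive and negative parts, which are not additive. Any decomposition into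
    summable nonnegative families gives the same value, because a^\+ + c = a^\- + b termwise. *)
Lemma rsum_diff a b (c : T -> R) : (forall i, 0 <= b i) -> (forall i, 0 <= c i) ->
  rsummable b -> rsummable c -> (forall i, a i = b i - c i) ->
  rsum a = fine (\esum_(i in setT) (b i)%:E)%E - fine (\esum_(i in setT) (c i)%:E)%E.
Proof.
move=> b0 c0 hb hc aE.
have sa : rsummable a.
  apply: (@rsummable_le _ (fun i => b i + c i)).
    by move=> i; rewrite aE (le_trans (ler_normB _ _)) // !ger0_norm.
  under eq_esum do rewrite EFinD.
  rewrite esumD => [|i _|i _]; rewrite ?lee_fin //.
  have [r [-> _]] := summableP_ge0 b0 hb.
  by have [r' [-> _]] := summableP_ge0 c0 hc; rewrite -EFinD ltry.
have p0 i : 0 <= a^\+ i by exact: funrpos_ge0.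
have n0 i : 0 <= a^\- i by exact: funrneg_ge0.
have : (\esum_(i in setT) ((a^\+ i)%:E + (c i)%:E) =
        \esum_(i in setT) ((a^\- i)%:E + (b i)%:E))%E.
  apply: eq_esum => i _; rewrite -!EFinD; congr EFin.
  by have := posBnegE a i; rewrite aE; lra.
rewrite !esumD => [||||]; try by move=> i _; rewrite lee_fin.
rewrite /rsum.
have [p [-> _]] := summableP_ge0 p0 (rsummable_pos sa).
have [n [-> _]] := summableP_ge0 n0 (rsummable_neg sa).
have [r [-> _]] := summableP_ge0 b0 hb.
have [r' [-> _]] := summableP_ge0 c0 hc.
by rewrite -!EFinD => -[] /=; lra.
Qed.

Lemma rsum_ge0E a : (forall i, 0 <= a i) -> rsummable a ->
  (\esum_(i in setT) (a i)%:E)%E = (rsum a)%:E.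
Proof.
move=> a0 ha; rewrite (@rsum_diff a a (fun=> 0)) // ?subr0; first last.
- by move=> i; rewrite subr0.
- by rewrite /rsummable; under eq_esum do rewrite normr0; rewrite esum1 ?ltry.
have [r [-> _]] := summableP_ge0 a0 ha.
by rewrite esum1 //= subr0.
Qed.

(** Only one inequality is proved from finite sums; the other is the same one for [c^-1], which is
    why c = 0 is treated apart. *)
Lemma esumZ (c : R) a : 0 <= c -> (forall i, 0 <= a i) ->
  (\esum_(i in setT) (c * a i)%:E = c%:E * \esum_(i in setT) (a i)%:E)%E.
Proof.
have le (d : R) (b : T -> R) : 0 <= d -> (forall i, 0 <= b i) ->
    (\esum_(i in setT) (d * b i)%:E <= d%:E * \esum_(i in setT) (b i)%:E)%E.
  move=> d0 b0; apply: esum_seq_le => [j|s us]; first by rewrite mulr_ge0.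
  rewrite -big_distrr /= EFinM; apply: lee_wpmul2l; rewrite ?lee_fin //.
  exact: seq_le_esum.
move=> c0 a0; apply/eqP; rewrite eq_le le //=.
have [->|cn0] := eqVneq c 0.
  by rewrite mul0e esum_ge0 // => i _; rewrite mul0r.
have cp : 0 < c by rewrite lt_neqAle eq_sym cn0.
rewrite -lee_pdivlMl //.
apply: le_trans (le c^-1 (fun i => c * a i) _ _); rewrite ?invr_ge0 //.
  by apply: le_esum => i _; rewrite mulKf.
by move=> i; rewrite mulr_ge0.
Qed.

Lemma rsummableZ c a : rsummable a -> rsummable (fun i => c * a i).
Proof.
move=> ha; rewrite /rsummable; under eq_esum do rewrite normrM.
rewrite esumZ //; have ha' : rsummable (fun i => `|a i|).
  by rewrite /rsummable; under eq_esum do rewrite normr_id.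
by have [r [-> _]] := summableP_ge0 (fun=> normr_ge0 _) ha'; rewrite -EFinM ltry.
Qed.

Lemma rsummableD a b : rsummable a -> rsummable b ->
  rsummable (fun i => a i + b i).
Proof.
move=> ha hb; apply: (@rsummable_le _ (fun i => `|a i| + `|b i|)).
  by move=> i; exact: ler_normD.
under eq_esum do rewrite EFinD.
by rewrite esumD ?lte_add_pinfty // => i _; rewrite lee_fin.
Qed.

Lemma rsumD a b : rsummable a -> rsummable b ->
  rsum (fun i => a i + b i) = rsum a + rsum b.
Proof.
move=> ha hb.
rewrite (@rsum_diff _ (fun i => a^\+ i + b^\+ i) (fun i => a^\- i + b^\- i)).
- have ap := @summableP_ge0 a^\+ (funrpos_ge0 a) (rsummable_pos ha).
  have an := @summableP_ge0 a^\- (funrneg_ge0 a) (rsummable_neg ha).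
  have bp := @summableP_ge0 b^\+ (funrpos_ge0 b) (rsummable_pos hb).
  have bn := @summableP_ge0 b^\- (funrneg_ge0 b) (rsummable_neg hb).
  under eq_esum do rewrite EFinD; rewrite esumD; last 2 first.
    by move=> i _; rewrite lee_fin funrpos_ge0.
    by move=> i _; rewrite lee_fin funrpos_ge0.
  under [X in _ - fine X]eq_esum do rewrite EFinD; rewrite esumD; last 2 first.
    by move=> i _; rewrite lee_fin funrneg_ge0.
    by move=> i _; rewrite lee_fin funrneg_ge0.
  rewrite /rsum; move: ap an bp bn => [p [-> _]] [n [-> _]] [q [-> _]] [m [-> _]].
  by rewrite -!EFinD /=; ring.
- by move=> i; rewrite addr_ge0 // funrpos_ge0.
- by move=> i; rewrite addr_ge0 // funrneg_ge0.
- by apply: rsummableD; exact: rsummable_pos.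
- by apply: rsummableD; exact: rsummable_neg.
move=> i; have := posBnegE a i.
by have := posBnegE b i; lra.
Qed.

Lemma rsumZ c a : rsummable a -> rsum (fun i => c * a i) = c * rsum a.
Proof.
move=> ha.
have ap := @summableP_ge0 a^\+ (funrpos_ge0 a) (rsummable_pos ha).
have an := @summableP_ge0 a^\- (funrneg_ge0 a) (rsummable_neg ha).
have aE i : a i = a^\+ i - a^\- i := posBnegE a i.
have [c0|c0] := leP 0 c.
  rewrite (@rsum_diff _ (fun i => c * a^\+ i) (fun i => c * a^\- i)).
  - rewrite !esumZ; try exact: funrneg_ge0; try exact: funrpos_ge0; try by [].
    rewrite /rsum; move: ap an => [p [-> _]] [n [-> _]] /=.
    by ring.
  - by move=> i; rewrite mulr_ge0 ?funrpos_ge0.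
  - by move=> i; rewrite mulr_ge0 ?funrneg_ge0.
  - exact/rsummableZ/rsummable_pos.
  - exact/rsummableZ/rsummable_neg.
  - by move=> i; rewrite {1}aE mulrBr.
have c0' : 0 <= - c by lra.
rewrite (@rsum_diff _ (fun i => (- c) * a^\- i) (fun i => (- c) * a^\+ i)).
- rewrite !esumZ; try exact: funrneg_ge0; try exact: funrpos_ge0; try by [].
  rewrite /rsum; move: ap an => [p [-> _]] [n [-> _]] /=.
  by ring.
- by move=> i; rewrite mulr_ge0 ?funrneg_ge0.
- by move=> i; rewrite mulr_ge0 ?funrpos_ge0.
- exact/rsummableZ/rsummable_neg.
- exact/rsummableZ/rsummable_pos.
- by move=> i; rewrite {1}aE; ring.
Qed.

Lemma csumZD (c : R[i]) z w : csummable z -> csummable w ->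
  csum (fun i => c * z i + w i) = c * csum z + csum w.
Proof.
move=> [zr zi] [wr wi]; apply: complex_eqP; rewrite /csum !ReImE /=.
  rewrite -mulNr -!rsumZ // -!rsumD //; first last.
  - exact: rsummableZ.
  - exact: rsummableZ.
  - by apply: rsummableD; exact: rsummableZ.
  by congr rsum; apply: funext => i; rewrite !ReImE mulNr.
rewrite -!rsumZ // -!rsumD //; first last.
- exact: rsummableZ.
- exact: rsummableZ.
- by apply: rsummableD; exact: rsummableZ.
by congr rsum; apply: funext => i; rewrite !ReImE.
Qed.

Lemma csumJ z : csummable z -> csum (fun i => (z i)^*%C) = (csum z)^*%C.
Proof.
move=> [zr zi]; apply: complex_eqP; rewrite /csum !ReImE /=.
  by congr rsum; apply: funext => i; rewrite ReJ.
rewrite -mulN1r -rsumZ //; congr rsum; apply: funext => i.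
by rewrite ImJ mulN1r.
Qed.

End UnconditionalSums.

Section SequenceSpace.
Context {R : realType} (H : hspace R) (pH : prehilb H) (I : choiceType).
Implicit Types (F G : ell2 I H).
Local Notation vec := (vectors (ell2 I H)).

Lemma csummable_inner F G : vec F -> vec G ->
  csummable (fun j => inner (F j) (G j)).
Proof.
move=> [vF sF] [vG sG].
have nn (K : ell2 I H) : (forall j, vectors H (K j)) -> forall j, 0 <= sqnorm (K j).
  by move=> vK j; exact: sqnorm_ge0.
have lt : (\esum_(j in setT) (sqnorm (F j) + sqnorm (G j))%:E < +oo)%E.
  under eq_esum do rewrite EFinD.
  by rewrite esumD ?lte_add_pinfty // => i _; rewrite lee_fin nn.
have sq j : sqmod (inner (F j) (G j)) <= (sqnorm (F j) + sqnorm (G j)) ^+ 2.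
  apply: le_trans; first exact: (CauchySchwarz pH (vF j) (vG j)).
  by have := nn _ vF j; have := nn _ vG j; nra.
split; apply: rsummable_le lt => j.
  rewrite -ler_sqr ?nnegrE ?normr_ge0 ?addr_ge0 ?nn // real_normK ?num_real //.
  exact: le_trans (sqr_Re_le _) (sq j).
rewrite -ler_sqr ?nnegrE ?normr_ge0 ?addr_ge0 ?nn // real_normK ?num_real //.
exact: le_trans (sqr_Im_le _) (sq j).
Qed.

Lemma sqnorm_ell2E F : vec F ->
  (\esum_(j in setT) (sqnorm (F j))%:E)%E = (sqnorm F)%:E.
Proof.
move=> vF; have [h _] := csummable_inner vF vF.
by apply: (rsum_ge0E _ h) => j; apply: sqnorm_ge0 => //; exact: vF.1.
Qed.

Lemma vec_ell2P a F G : vec F -> vec G -> vec (a *: F + G).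
Proof.
move=> [vF sF] [vG sG].
split=> [j|]; first exact: (vectorsP pH).
have nn (K : ell2 I H) : (forall j, vectors H (K j)) -> forall j, 0 <= sqnorm (K j).
  by move=> vK j; exact: sqnorm_ge0.
apply: (@le_lt_trans _ _ (\esum_(j in setT)
   ((2 * sqmod a) * sqnorm (F j) + 2 * sqnorm (G j))%:E)%E).
  apply: le_esum => j _; rewrite lee_fin.
  have := sqnormD_le pH (vectorsZ pH a (vF j)) (vG j).
  by rewrite (sqnormZ pH a (vF j)) mulrDr mulrA.
under eq_esum do rewrite EFinD.
have s0 := sqmod_ge0 a.
rewrite esumD => [|i _|i _]; rewrite ?lee_fin ?mulr_ge0 ?nn //.
by rewrite !esumZ ?mulr_ge0 ?nn //;
  [rewrite lte_add_pinfty // lte_mul_pinfty ?lee_fin ?mulr_ge0 | exact: nn..].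
Qed.

Lemma prehilb_ell2 : prehilb (ell2 I H).
Proof.
split.
- split=> [j|]; first exact: vectors0.
  by rewrite esum1 ?ltry // => j _; rewrite (sqnorm0 pH).
- exact: vec_ell2P.
- move=> a F G K vF vG vK; rewrite /inner /= -csumZD; try exact: csummable_inner.
  by congr csum; apply: funext => j; rewrite (innerP pH) //; case: vF vG vK => ? _ [? _] [].
- move=> F G vF vG.
  change (csum (fun j => inner (G j) (F j)) = (csum (fun j => inner (F j) (G j)))^*%C).
  rewrite -csumJ; last exact: csummable_inner.
  by congr csum; apply: funext => j; rewrite (innerC pH) //; case: vF vG => ? _ [].
- move=> F vF; rewrite -lee_fin -sqnorm_ell2E //; apply: esum_ge0 => j _.
  by rewrite lee_fin sqnorm_ge0 //; exact: vF.1.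
Qed.

End SequenceSpace.

Section HilbertSchmidt.
Context {R : realType} (H : hspace R) (pH : prehilb H) (e : nat -> H).
Hypothesis ve : forall n, vectors H (e n).
Implicit Types (A B : HS e).

(** A Hilbert-Schmidt operator is handled as the square-summable sequence of its values on the
    basis: its norm and inner product are those of [ell2]. *)
Lemma HS_ell2 A : vectors (HS e) A -> vectors (ell2 nat H) (A \o e).
Proof. by move=> [[vA _ _] sA]; split=> // j; exact: vA. Qed.

Lemma sqnorm_HSE A : vectors (HS e) A -> hs_sqnorm e A = (sqnorm A)%:E.
Proof. by move=> /HS_ell2 /(sqnorm_ell2E pH). Qed.

Lemma bounded_operatorP (a : R[i]) (A B : H -> H) :
  bounded_operator A -> bounded_operator B -> bounded_operator (a *: A + B).
Proof.
move=> [vA lA [M bA]] [vB lB [N bB]]; split=> [u hu|c u v hu hv|].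
- by apply: (vectorsP pH); [exact: vA|exact: vB].
- have -> : (a *: A + B) (c *: u + v) - (c *: (a *: A + B) u + (a *: A + B) v) =
    a *: (A (c *: u + v) - (c *: A u + A v)) + (B (c *: u + v) - (c *: B u + B v)).
    change ((a *: A (c *: u + v) + B (c *: u + v)) -
      (c *: (a *: A u + B u) + (a *: A v + B v)) =
      a *: (A (c *: u + v) - (c *: A u + A v)) + (B (c *: u + v) - (c *: B u + B v))).
    rewrite scalerBr !scalerDr !scalerA (mulrC c a) [X in _ - X]addrACA opprD.
    by rewrite addrACA.
  have hcv : vectors H (c *: u + v) by exact: (vectorsP pH).
  have xA : vectors H (A (c *: u + v) - (c *: A u + A v)).
    by apply: (vectorsB pH); [exact: vA|apply: (vectorsP pH); exact: vA].
  have xB : vectors H (B (c *: u + v) - (c *: B u + B v)).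
    by apply: (vectorsB pH); [exact: vB|apply: (vectorsP pH); exact: vB].
  apply: (sqnorm_null_add pH) => //; first exact: (vectorsZ pH).
    by rewrite (sqnormZ pH) // lA // mulr0.
  exact: lB.
exists (2 * (sqmod a * M + N)) => u hu.
have := sqnormD_le pH (vectorsZ pH a (vA _ hu)) (vB _ hu).
rewrite (sqnormZ pH _ (vA _ hu)) => /le_trans; apply.
have := bA u hu; have := bB u hu; have := sqmod_ge0 a.
by move: (sqmod a) (sqnorm u) (sqnorm (A u)) (sqnorm (B u)) => x y z w; nra.
Qed.

Lemma prehilb_HS : prehilb (HS e).
Proof.
have pE := prehilb_ell2 pH nat.
have v0 := vectors0 pH.
split.
- split; last first.
    by rewrite /hs_sqnorm esum1 ?ltry // => j _; rewrite (sqnorm0 pH).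
  split=> [//|a u v hu hv|].
    by rewrite /GRing.zero /= scaler0 addr0 subrr (sqnorm0 pH).
  by exists 0 => u hu; rewrite mul0r (sqnorm0 pH).
- move=> a A B hA hB; split; first by apply: bounded_operatorP; [case: hA|case: hB].
  by have [] := vectorsP pE a (HS_ell2 hA) (HS_ell2 hB).
- move=> a A B C hA hB hC.
  exact: (innerP pE a (HS_ell2 hA) (HS_ell2 hB) (HS_ell2 hC)).
- by move=> A B hA hB; exact: (innerC pE (HS_ell2 hA) (HS_ell2 hB)).
- by move=> A hA; exact: (sqnorm_ge0 pE (HS_ell2 hA)).
Qed.

End HilbertSchmidt.

(** * Complex-valued integrals and the space [L2] *)

Section ComplexIntegral.
Context {R : realType} d (T : measurableType d) (mu : {measure set T -> \bar R}).
Implicit Types (f g : T -> R[i]).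

Lemma cmeasurableM f g : cmeasurable setT f -> cmeasurable setT g ->
  cmeasurable setT (fun x => f x * g x).
Proof.
move=> [f1 f2] [g1 g2]; split.
  under eq_fun do rewrite ReM.
  by apply: measurable_funB; exact: measurable_funM.
under eq_fun do rewrite ImM.
by apply: measurable_funD; exact: measurable_funM.
Qed.

Lemma cmeasurableD f g : cmeasurable setT f -> cmeasurable setT g ->
  cmeasurable setT (fun x => f x + g x).
Proof.
move=> [f1 f2] [g1 g2]; split.
  by under eq_fun do rewrite ReD; exact: measurable_funD.
by under eq_fun do rewrite ImD; exact: measurable_funD.
Qed.

Lemma cmeasurableJ f : cmeasurable setT f -> cmeasurable setT (fun x => (f x)^*%C).
Proof.
move=> [f1 f2]; split.
  by under eq_fun do rewrite ReJ.
by under eq_fun do rewrite ImJ; exact: measurable_funN.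
Qed.

Lemma cmeasurable_cst (c : R[i]) : cmeasurable setT (fun _ : T => c).
Proof. by split; exact: measurable_cst. Qed.

Lemma cmeasurable_real (h : T -> R) : measurable_fun setT h ->
  cmeasurable setT (fun x => (h x)%:C%C).
Proof. by move=> mh; split=> //=; exact: measurable_cst. Qed.

Lemma measurable_sqmod f : cmeasurable setT f ->
  measurable_fun setT (fun x => sqmod (f x)).
Proof.
by move=> [f1 f2]; apply: measurable_funD; exact: measurable_funX.
Qed.

Definition cint f := mu.-integrable setT (fun x => (complex.Re (f x))%:E) /\
  mu.-integrable setT (fun x => (complex.Im (f x))%:E).

(** The domination is stated on squares, so that no square root of [sqmod] enters. *)
Lemma cint_le f (h : T -> R) : cmeasurable setT f -> measurable_fun setT h ->
  (forall x, sqmod (f x) <= h x ^+ 2) -> (forall x, 0 <= h x) ->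
  (\int[mu]_x (h x)%:E < +oo)%E -> cint f.
Proof.
move=> [f1 f2] mh le h0 fin.
have ih : mu.-integrable setT (fun x => (h x)%:E).
  apply/integrableP; split; first exact/measurable_EFinP.
  by under eq_integral do rewrite gee0_abs ?lee_fin ?h0 //.
split; apply: le_integrable ih => //; try exact/measurable_EFinP.
  move=> x _ /=; rewrite lee_fin [leRHS]ger0_norm //.
  rewrite -ler_sqr ?nnegrE ?normr_ge0 // real_normK ?num_real //.
  exact: le_trans (sqr_Re_le _) (le x).
move=> x _ /=; rewrite lee_fin [leRHS]ger0_norm //.
rewrite -ler_sqr ?nnegrE ?normr_ge0 // real_normK ?num_real //.
exact: le_trans (sqr_Im_le _) (le x).
Qed.

Lemma cintZD (c : R[i]) f g : cint f -> cint g -> cint (fun x => c * f x + g x).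
Proof.
move=> [f1 f2] [g1 g2]; split.
  have -> : (fun x => (complex.Re (c * f x + g x))%:E) =
    (fun x => ((complex.Re c)%:E * (complex.Re (f x))%:E +
      (- complex.Im c)%:E * (complex.Im (f x))%:E + (complex.Re (g x))%:E)%E).
    by apply: funext => x; rewrite !ReImE -!EFinM -!EFinD mulNr.
  by apply: integrableD => //; apply: integrableD => //; exact: integrableZl.
have -> : (fun x => (complex.Im (c * f x + g x))%:E) =
  (fun x => ((complex.Re c)%:E * (complex.Im (f x))%:E +
    (complex.Im c)%:E * (complex.Re (f x))%:E + (complex.Im (g x))%:E)%E).
  by apply: funext => x; rewrite !ReImE -!EFinM -!EFinD.
by apply: integrableD => //; apply: integrableD => //; exact: integrableZl.
Qed.

Lemma cintegralZD (c : R[i]) f g : cint f -> cint g ->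
  cintegral mu (fun x => c * f x + g x) = c * cintegral mu f + cintegral mu g.
Proof.
move=> [f1 f2] [g1 g2]; rewrite /cintegral.
have iZ a (h : T -> R) : mu.-integrable setT (EFin \o h) ->
    mu.-integrable setT (EFin \o (fun x => a * h x)).
  by move=> ih; exact: (integrableZl measurableT a ih).
have iD (h k : T -> R) : mu.-integrable setT (EFin \o h) ->
    mu.-integrable setT (EFin \o k) ->
    mu.-integrable setT (EFin \o (fun x => h x + k x)).
  by move=> ih ik; exact: (integrableD measurableT ih ik).
apply: complex_eqP; rewrite !ReImE /=.
  rewrite -mulNr -!RintegralZl // -!RintegralD //; try exact: iZ; last first.
    by apply: iD; exact: iZ.
  by apply: eq_Rintegral => x _; rewrite !ReImE mulNr.
rewrite -!RintegralZl // -!RintegralD //; try exact: iZ; last first.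
  by apply: iD; exact: iZ.
by apply: eq_Rintegral => x _; rewrite !ReImE.
Qed.

Lemma cintegralJ f : cint f ->
  cintegral mu (fun x => (f x)^*%C) = (cintegral mu f)^*%C.
Proof.
move=> [f1 f2]; apply: complex_eqP; rewrite /cintegral !ReImE /=.
  by apply: eq_Rintegral => x _; rewrite ReJ.
rewrite -mulN1r -RintegralZl //; apply: eq_Rintegral => x _.
by rewrite ImJ mulN1r.
Qed.

Lemma eq_cintegral f g : f =1 g -> cintegral mu f = cintegral mu g.
Proof. by move=> /funext ->. Qed.

Lemma L2_sqmod f : vectors (L2 mu) f -> mu.-integrable setT (fun x => (sqmod (f x))%:E).
Proof.
move=> [mf fin]; apply/integrableP; split.
  exact/measurable_EFinP/measurable_sqmod.
by under eq_integral do rewrite gee0_abs ?lee_fin ?sqmod_ge0 //.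
Qed.

Lemma L2_cint f g : vectors (L2 mu) f -> vectors (L2 mu) g ->
  cint (fun x => f x * (g x)^*%C).
Proof.
move=> hf hg; have [mf _] := hf; have [mg _] := hg.
apply: (@cint_le _ (fun x => sqmod (f x) + sqmod (g x))).
- by apply: cmeasurableM => //; exact: cmeasurableJ.
- by apply: measurable_funD; exact: measurable_sqmod.
- move=> x; rewrite sqmodM sqmodJ.
  by have := sqmod_ge0 (f x); have := sqmod_ge0 (g x); nra.
- by move=> x; rewrite addr_ge0 ?sqmod_ge0.
under eq_integral do rewrite EFinD.
rewrite ge0_integralD //; try (by move=> x _; rewrite lee_fin sqmod_ge0);
  try exact/measurable_EFinP/measurable_sqmod.
by case: hf hg => [_ ?] [_ ?]; exact: lte_add_pinfty.
Qed.

Lemma sqnorm_L2E f : vectors (L2 mu) f ->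
  (\int[mu]_x (sqmod (f x))%:E)%E = (@sqnorm R (L2 mu) f)%:E.
Proof.
move=> hf; rewrite /sqnorm /inner /= /Rintegral.
under [in RHS]eq_integral do rewrite sqmodJE /=.
rewrite fineK //; exact: integrable_fin_num (L2_sqmod hf).
Qed.

Lemma prehilb_L2 : prehilb (L2 mu).
Proof.
split.
- split; first exact: cmeasurable_cst.
  by under eq_integral do rewrite sqmod0; rewrite integral0 ltry.
- move=> a f g hf hg; have [mf _] := hf; have [mg _] := hg.
  have mz : cmeasurable setT (fun x => a * f x + g x).
    apply: cmeasurableD => //; apply: cmeasurableM => //; exact: cmeasurable_cst.
  split=> //.
  apply: (@le_lt_trans _ _ (\int[mu]_x ((2 * sqmod a)%:E * (sqmod (f x))%:E + 2%:E * (sqmod (g x))%:E))%E).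
    apply: ge0_le_integral => //.
    - by move=> x _; rewrite lee_fin sqmod_ge0.
    - exact/measurable_EFinP/(measurable_sqmod mz).
    - by apply: emeasurable_funD; apply: emeasurable_funM => //;
        exact/measurable_EFinP/measurable_sqmod.
    - move=> x _; rewrite -!EFinM -EFinD lee_fin.
      by have := sqmodD_le (a * f x) (g x); rewrite sqmodM mulrDr mulrA.
  have i1 := integrableZl measurableT (2 * sqmod a) (L2_sqmod hf).
  have i2 := integrableZl measurableT 2 (L2_sqmod hg).
  have /integrableP[_] := integrableD measurableT i1 i2.
  apply: le_lt_trans; apply: ge0_le_integral => //.
  - by move=> x _; rewrite -!EFinM -EFinD lee_fin addr_ge0 ?mulr_ge0 ?sqmod_ge0.
  - by apply: emeasurable_funD; apply: emeasurable_funM => //;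
        exact/measurable_EFinP/measurable_sqmod.
  - apply: measurableT_comp => //; by apply: emeasurable_funD; apply: emeasurable_funM => //;
        exact/measurable_EFinP/measurable_sqmod.
  - by move=> x _; exact: lee_abs.
- move=> a u v w hu hv hw; rewrite /inner /= -cintegralZD; try exact: L2_cint.
  by apply: eq_cintegral => x; rewrite mulrA -mulrDl.
- move=> u v hu hv.
  change (cintegral mu (fun x => v x * (u x)^*%C) =
    (cintegral mu (fun x => u x * (v x)^*%C))^*%C).
  rewrite -cintegralJ; last exact: L2_cint.
  by apply: eq_cintegral => x; rewrite conjM conjcK mulrC.
- move=> u hu; rewrite -lee_fin -sqnorm_L2E //.
  by apply: integral_ge0 => x _; rewrite lee_fin sqmod_ge0.
Qed.

End ComplexIntegral.

(** * Countable sums under the integral, affine substitution and unfolding over the integers *)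

Section CountableSums.
Context {R : realType} d (T : measurableType d) (mu : {measure set T -> \bar R}).

(** A single enumeration [c], chosen before the family [f], turns sums over [I] into series over the
    naturals, for which monotone convergence applies. [None] pads the places that carry no index. *)
Lemma esum_countable (J : choiceType) (I : set J) : countable I ->
  exists (c : nat -> option J), forall (X : Type) (f : J -> X -> \bar R),
    (forall i x, I i -> 0 <= f i x)%E ->
    forall x, (\esum_(i in I) f i x =
      \sum_(n <oo) (if c n is Some i then f i x else 0))%E /\
    forall n i, c n = Some i -> I i.
Proof.
elim/choicePpointed: J => J in I *.
  move=> _; exists (fun=> None) => X f f0 x; split=> //.
  by rewrite emptyE esum_set0 eseries0.
move=> /countable_bijP[B]; rewrite card_eq_sym => /ppcard_eqP[g].
exists (fun n => if n \in B then Some (g n) else None) => X f f0 x; split.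
  rewrite (@reindex_esum _ _ _ B I g); last exact: bij.
  rewrite nneseries_esumT => [|n]; last first.
    by case: ifPn => // /set_mem nB; apply: f0; apply: funS.
  by rewrite esum_mkcond; apply: eq_esum => n _; case: ifPn.
move=> n i; case: ifPn => // /set_mem nB [<-]; exact: funS.
Qed.

Context (J : choiceType) (I : set J) (cI : countable I) (D : set T).
Hypothesis mD : measurable D.
Context (f : J -> T -> \bar R).
Hypothesis f0 : forall i x, I i -> (0 <= f i x)%E.
Hypothesis mf : forall i, I i -> measurable_fun D (f i).

Lemma measurable_esum : measurable_fun D (fun x => \esum_(i in I) f i x)%E.
Proof.
have [c cP] := esum_countable cI.
under eq_fun do rewrite (cP _ f f0 _).1.
apply: ge0_emeasurable_sum => [n x _ _|n _].
  by case E : (c n) => [i|] //; apply: f0; exact: ((cP _ f f0 x).2 _ _ E).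
by case E : (c n) => [i|] //; apply: mf; exact: ((cP _ f f0 point).2 _ _ E).
Qed.

Lemma integral_esum : (\int[mu]_(x in D) (\esum_(i in I) f i x) =
  \esum_(i in I) \int[mu]_(x in D) f i x)%E.
Proof.
have [c cP] := esum_countable cI.
have h0 i (x : unit) : I i -> (0 <= \int[mu]_(x in D) f i x)%E.
  by move=> Ii; apply: integral_ge0 => ? _; exact: f0.
have [-> cI'] := cP unit (fun i _ => \int[mu]_(x in D) f i x)%E h0 tt.
under eq_integral do rewrite (cP _ f f0 _).1.
rewrite integral_nneseries // => [|n|n x _].
- by apply: eq_eseriesr => n _; case E : (c n) => [i|] //; rewrite integral0.
- by case E : (c n) => [i|] //; apply: mf; exact: cI' E.
- by case E : (c n) => [i|] //; apply: f0; exact: cI' E.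
Qed.

End CountableSums.

Section AffineInvariance.
Context {R : realType}.
Local Notation leb := (@lebesgue_measure R).
Implicit Types (f : R -> \bar R).

Lemma measurable_affine (c d : R) : measurable_fun setT (fun x : R => c * x + d).
Proof. by apply: measurable_funD => //; exact: measurable_funM. Qed.

(** Intervals []a, b]] suffice, since they determine Lebesgue measure. For c < 0 the preimage is
    closed at the other end, which does not change its length. *)
Lemma lebesgue_affine_preimage (c d a b : R) : c != 0 ->
  (`|c|%:E * leb ((fun x => c * x + d)%R @^-1` `]a, b]%classic) = leb `]a, b]%classic)%E.
Proof.
move=> c0.
have [cp|cn] := ltP 0 c.
  have -> : (fun x => c * x + d) @^-1` `]a, b]%classic =
      `](a - d) / c, (b - d) / c]%classic.
    apply/seteqP; split=> x /=; rewrite !in_itv /= => /andP[h1 h2].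
      rewrite ltr_pdivrMr // ler_pdivlMr // [x * c]mulrC; apply/andP; split; lra.
    rewrite ltr_pdivrMr // ler_pdivlMr // [x * c]mulrC in h1 h2.
    apply/andP; split; lra.
  rewrite !lebesgue_measure_itv /= !lte_fin ltr_pM2r ?invr_gt0 // ltrD2r.
  case: ifP => _; last by rewrite mule0.
  by rewrite -!EFinD -EFinM gtr0_norm //; congr EFin; field.
have {cn} cn : c < 0 by rewrite lt_neqAle c0.
have -> : (fun x => c * x + d) @^-1` `]a, b]%classic =
    `[(b - d) / c, (a - d) / c[%classic.
  apply/seteqP; split=> x /=; rewrite !in_itv /= => /andP[h1 h2].
    rewrite ler_ndivrMr // ltr_ndivlMr // [x * c]mulrC; apply/andP; split; lra.
  rewrite ler_ndivrMr // ltr_ndivlMr // [x * c]mulrC in h1 h2.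
  apply/andP; split; lra.
rewrite !lebesgue_measure_itv /= !lte_fin ltr_nM2r ?invr_lt0 // ltrD2r.
case: ifP => _; last by rewrite mule0.
by rewrite -!EFinD -EFinM ltr0_norm //; congr EFin; field.
Qed.

Lemma ge0_integral_affine (c d : R) f : c != 0 -> measurable_fun setT f ->
  (forall x, 0 <= f x)%E ->
  (`|c|%:E * \int[leb]_x f (c * x + d)%R = \int[leb]_x f x)%E.
Proof.
move=> c0 mf f0; have mphi := measurable_affine c d.
(* Lebesgue measure is [|c|] times its pushforward under the affine map, since both agree on the
   half-open intervals. *)
pose push := @measure_function_pushforward__canonical__measure_function_Measure
  _ _ (measurableTypeR R) (measurableTypeR R) _ leb _ mphi.
pose k : {nonneg R} := NngNum (normr_ge0 c).
have eqm (A : set (measurableTypeR R)) : measurable A -> leb A = mscale k push A.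
  apply: lebesgue_measure_unique => X [[a b] _ <-] /=.
  by rewrite -(lebesgue_affine_preimage d a b c0).
rewrite [RHS](@eq_measure_integral _ _ _ _ (mscale k push)); last by move=> A mA _; exact: eqm.
rewrite ge0_integral_mscale //=; congr (_ * _)%E.
apply/esym; exact: (@ge0_integral_pushforward _ _ (measurableTypeR R)
  (measurableTypeR R) R _ mphi leb setT f).
Qed.

Lemma ge0_integral_translate (d : R) f : measurable_fun setT f ->
  (forall x, 0 <= f x)%E -> (\int[leb]_x f (x + d)%R = \int[leb]_x f x)%E.
Proof.
move=> mf f0; rewrite -(ge0_integral_affine d (oner_neq0 R) mf f0) normr1 mul1e.
by under [RHS]eq_integral do rewrite mul1r.
Qed.

Lemma esum_term (J : choiceType) (a : J -> \bar R) j :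
  (0 <= a j)%E -> (forall i, i != j -> a i = 0%E) -> (\esum_(i in setT) a i = a j)%E.
Proof.
move=> aj ai; rewrite -(esum_set1 aj) esum_mkcond [RHS]esum_mkcond.
apply: eq_esum => i _; rewrite in_setT in_set1; case: eqP => [->//|/eqP/ai//].
Qed.

Lemma countable_int (A : set int) : countable A.
Proof. exact: countableP. Qed.

Lemma integral_unfold f : measurable_fun setT f -> (forall x, 0 <= f x)%E ->
  (\int[leb]_x f x =
   \int[leb]_(x in `[0%R, 1%R[) (\esum_(j in [set: int]) f (x + j%:~R)%R))%E.
Proof.
move=> mf f0; pose I (j : int) : set R := `[j%:~R, (j + 1)%:~R[%classic.
have mI j : measurable (I j) by exact: measurable_itv.
have mr j : measurable_fun setT (f \_ (I j)).
  by apply/(measurable_restrictT _ (mI j)); exact: measurable_funTS.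
have r0 j x : (0 <= (f \_ (I j)) x)%E by rewrite patchE; case: ifP.
(* The half-open tiles are disjoint, and the one that contains [x] has index [Num.floor x]. *)
have -> : (\int[leb]_x f x = \int[leb]_x \esum_(j in [set: int]) (f \_ (I j)) x)%E.
  apply: eq_integral => x _; rewrite (@esum_term _ _ (Num.floor x)) //.
    by rewrite patchE mem_set //= /I /= in_itv /= floor_itv.
  move=> i ix; rewrite patchE; case: ifPn => // /set_mem /=.
  by rewrite /I /= in_itv /= => /floor_def e; rewrite e eqxx in ix.
rewrite integral_esum //; last 2 first.
- exact: countable_int.
- by move=> j _; exact: mr.
rewrite integral_esum //; first last.
- move=> j _; apply: measurable_funTS; apply: measurableT_comp => //.
  exact: measurable_funD.
- exact: countable_int.
apply: eq_esum => j _; rewrite -(ge0_integral_translate j%:~R) //.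
rewrite [RHS]integral_mkcond; apply: eq_integral => x _.
rewrite !patchE; congr (if _ then _ else _).
apply/idP/idP => /set_mem /=; rewrite /I /= !in_itv /= intrD => /andP[h1 h2];
  apply/mem_set; rewrite /= in_itv /= ?intrD; apply/andP; split; lra.
Qed.

End AffineInvariance.

(** * Completeness of the trigonometric system *)

Section Trigonometry.
Context {R : realType}.
Local Notation leb := (@lebesgue_measure R).

Lemma Rintegral_FTC (F f : R -> R) (a b : R) : a < b -> continuous f ->
  (forall x, is_derive (x : R) (1 : R) F (f x)) ->
  leb.-integrable `[a, b] (EFin \o f) /\
  \int[leb]_(x in `[a, b]) f x = F b - F a.
Proof.
move=> ab cf dF.
have cF : continuous F.
  by move=> x; apply: differentiable_continuous; apply/derivable1_diffP; exact: ex_derive.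
split.
  apply: continuous_compact_integrable; first exact: segment_compact.
  exact: continuous_subspaceT.
rewrite /Rintegral (@continuous_FTC2 _ f F) //.
- exact: continuous_subspaceT.
- split => [x _||].
  + exact: ex_derive.
  + exact/cvg_at_right_filter/cF.
  + exact/cvg_at_left_filter/cF.
by move=> x _; rewrite derive1E; exact: derive_val.
Qed.

Lemma is_derive_sinM (k x : R) :
  is_derive x 1 (fun y => sin (k * y)) (k * cos (k * x)).
Proof.
have h : is_derive x 1 ( *%R k) k by apply: is_derive_eq; rewrite /GRing.scale /=; ring.
have := @is_derive1_comp R sin ( *%R k) x _ _ (is_derive_sin _) h.
by rewrite /comp mulrC.
Qed.

Lemma is_derive_cosM (k x : R) :
  is_derive x 1 (fun y => cos (k * y)) (- k * sin (k * x)).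
Proof.
have h : is_derive x 1 ( *%R k) k by apply: is_derive_eq; rewrite /GRing.scale /=; ring.
have := @is_derive1_comp R cos ( *%R k) x _ _ (is_derive_cos _) h.
by rewrite /comp mulrC mulNr mulrN.
Qed.

Lemma continuous_cosM (k : R) : continuous (fun x : R => cos (k * x)).
Proof.
move=> x; apply: differentiable_continuous; apply/derivable1_diffP.
by case: (is_derive_cosM k x).
Qed.

Lemma continuous_sinM (k : R) : continuous (fun x : R => sin (k * x)).
Proof.
move=> x; apply: differentiable_continuous; apply/derivable1_diffP.
by case: (is_derive_sinM k x).
Qed.

Lemma integral_cosM (k a b : R) : k != 0 -> a < b ->
  \int[leb]_(x in `[a, b]) cos (k * x) = (sin (k * b) - sin (k * a)) / k.
Proof.
move=> k0 ab; rewrite (@Rintegral_FTC (fun x => sin (k * x) / k) _ a b ab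
  (@continuous_cosM k) _).2; first by ring.
move=> x; have := is_derive_sinM k x => ds; apply: is_derive_eq.
by rewrite /GRing.scale /=; field.
Qed.

Lemma integral_sinM (k a b : R) : k != 0 -> a < b ->
  \int[leb]_(x in `[a, b]) sin (k * x) = (cos (k * a) - cos (k * b)) / k.
Proof.
move=> k0 ab; rewrite (@Rintegral_FTC (fun x => - cos (k * x) / k) _ a b ab
  (@continuous_sinM k) _).2; first by ring.
move=> x; have := is_derive_cosM k x => ds; apply: is_derive_eq.
by rewrite /GRing.scale /=; field.
Qed.

Lemma continuous_bump : continuous (fun x : R => x * (1 - x)).
Proof.
move=> x; apply: differentiable_continuous; apply/derivable1_diffP.
apply: ex_derive.
Qed.

(** The antiderivative comes from two integrations by parts. As sin k = 0 and x (1 - x) vanishes at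
    both ends, only (1 - 2 x) cos(k x) / k^2 contributes: -1 / k^2 at 1 minus 1 / k^2 at 0. *)
Lemma integral_bump_cosM (k : R) : k != 0 -> sin k = 0 -> cos k = 1 ->
  \int[leb]_(x in `[0, 1]) (x * (1 - x) * cos (k * x)) = - 2 / k ^+ 2.
Proof.
move=> k0 sk ck; rewrite (@Rintegral_FTC (fun x => x * (1 - x) * sin (k * x) / k
  + (1 - 2 * x) * cos (k * x) / k ^+ 2 - 2 * sin (k * x) / k ^+ 3 * (-1)) _ 0 1 ltr01 _ _).2.
- by rewrite !(mulr0, mulr1) sk ck sin0 cos0; field.
- by move=> x; exact: (cvgM (@continuous_bump x) (@continuous_cosM k x)).
move=> x; have := is_derive_sinM k x; have := is_derive_cosM k x => ds dc.
by apply: is_derive_eq; rewrite /GRing.scale /=; field.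
Qed.

Lemma integral_bump_sinM (k : R) : k != 0 -> sin k = 0 -> cos k = 1 ->
  \int[leb]_(x in `[0, 1]) (x * (1 - x) * sin (k * x)) = 0.
Proof.
move=> k0 sk ck; rewrite (@Rintegral_FTC (fun x => - (x * (1 - x)) * cos (k * x) / k
  + (1 - 2 * x) * sin (k * x) / k ^+ 2 - 2 * cos (k * x) / k ^+ 3) _ 0 1 ltr01 _ _).2.
- by rewrite !(mulr0, mulr1) sk ck sin0 cos0; field.
- by move=> x; exact: (cvgM (@continuous_bump x) (@continuous_sinM k x)).
move=> x; have := is_derive_sinM k x; have := is_derive_cosM k x => ds dc.
by apply: is_derive_eq; rewrite /GRing.scale /=; field.
Qed.

(** On [0, 1/2] even [s <= sin (pi * s)] holds. With y = pi s / 2 <= pi / 4, the mean value theorem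
    gives sin (2 y) = 2 y cos y cos z; both cosines have square at least 1/2, and y >= s because pi
    >= 2. The other half follows by the symmetry t -> 1 - t. *)
Lemma sin_pi_ge (t : R) : 0 <= t <= 1 -> t * (1 - t) <= sin (pi * t).
Proof.
have pi2 := @pi_ge2 R.
have half (s : R) : 0 <= s <= 1 / 2 -> s <= sin (pi * s).
  move=> /andP[s0 s1]; pose y := pi * s / 2.
  have y0 : 0 <= y by rewrite /y; nra.
  have y4 : y <= pi / 4 by rewrite /y; nra.
  have cb (z : R) : 0 <= z -> z <= y -> 0 <= cos z /\ 1 / 2 <= cos z ^+ 2.
    move=> z0 zy; split; first by apply: cos_ge0_pihalf; apply/andP; split; lra.
    have h : 0 <= cos (z *+ 2).
      by apply: cos_ge0_pihalf; rewrite -mulr_natl; apply/andP; split; lra.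
    by move: h; rewrite cos_mulr2n mulr2n; lra.
  have [z [/andP[z0 zy] E]] : exists z, (0 <= z <= y) /\ sin y = cos z * y.
    move: y0; rewrite le_eqVlt => /orP[/eqP<-|yp].
      by exists 0; rewrite lexx sin0 mulr0.
    have [|z] := @MVT R sin cos 0 y yp (fun x _ => is_derive_sin x).
      exact/continuous_subspaceT/continuous_sin.
    rewrite in_itv /= => /andP[z0 zy]; rewrite sin0 !subr0 => ->.
    by exists z; rewrite !ltW.
  have [c0 c1] := cb _ z0 zy; have [d0 d1] := cb _ y0 (lexx _).
  have cd : 1 / 2 <= cos z * cos y.
    rewrite -ler_sqr ?nnegrE ?mulr_ge0 //.
    by rewrite exprMn; nra.
  have -> : pi * s = y *+ 2 by rewrite /y mulr2n; field.
  rewrite sin_mulr2n E mulr2n.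
  have : y / 2 <= cos z * cos y * y by nra.
  by rewrite /y => h; nra.
move=> /andP[t0 t1]; have [tl|tl] := leP t (1 / 2).
  by have := half t; rewrite t0 tl => /(_ isT); nra.
have := half (1 - t).
have -> : pi * (1 - t) = pi - pi * t :> R by ring.
have -> : sin (pi - pi * t) = sin (pi * t).
  by rewrite sinB cospi sinpi; ring.
have -> : 0 <= 1 - t <= 1 / 2 by apply/andP; split; lra.
by move=> /(_ isT); nra.
Qed.

(** With t = |x - a|, the left side is t |1 - x - a|, and |1 - x - a| <= 1 - t. The bound covers
    also the case where x and a are opposite ends of [0, 1], at which the sine vanishes again. *)
Lemma bump_diff_le (x a : R) : 0 <= x <= 1 -> 0 <= a <= 1 ->
  `|x * (1 - x) - a * (1 - a)| <= `|sin (pi * (x - a))|.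
Proof.
move=> /andP[x0 x1] /andP[a0 a1].
have key (t : R) : 0 <= t -> t <= 1 -> `|1 - x - a| <= 1 - t ->
    t * `|1 - x - a| <= sin (pi * t).
  move=> t0 t1 h; have := @sin_pi_ge t; rewrite t0 t1 => /(_ isT).
  by apply: le_trans; apply: ler_wpM2l.
have -> : x * (1 - x) - a * (1 - a) = (x - a) * (1 - x - a) by ring.
rewrite normrM; have [h|h] := leP 0 (x - a).
  rewrite (ger0_norm h); apply: le_trans (ler_norm _).
  by apply: key; [lra..|rewrite ler_norml; apply/andP; split; lra].
rewrite (ltr0_norm h) opprB -[x - a]opprB mulrN sinN normrN.
apply: le_trans (ler_norm _).
by apply: key; [lra..|rewrite ler_norml; apply/andP; split; lra].
Qed.

Lemma measurable_funV d (T : measurableType d) (f : T -> R) :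
  measurable_fun setT f -> measurable_fun setT (fun x => (f x)^-1).
Proof.
(* The power -1 of f^2 is measurable through [powR], and the product agrees with the inverse also at
   a zero of [f], where both are 0. *)
move=> mf; have -> : (fun x => (f x)^-1) = (fun x => f x * powR (f x ^+ 2) (-1)).
  apply: funext => x; have [->|f0] := eqVneq (f x) 0; first by rewrite invr0 mul0r.
  by rewrite powR_inv1 ?sqr_ge0 //; field.
apply: measurable_funM => //.
apply: (@measurableT_comp _ _ _ _ _ _ (fun y => powR y (-1))) => //.
exact: measurable_funX.
Qed.

Lemma measurable_cis d (T : measurableType d) (f : T -> R) :
  measurable_fun setT f -> cmeasurable setT (fun x => cis (f x)).
Proof.
move=> mf; split => /=.
  by apply: measurableT_comp => //; apply: continuous_measurable_fun; exact: continuous_cos.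
by apply: measurableT_comp => //; apply: continuous_measurable_fun; exact: continuous_sin.
Qed.

Lemma cis_double_sub1 (t : R) :
  cis (2 * t) - 1 = (2 * sin t)%:C%C * ('i%C * cis t).
Proof.
have -> : 2 * t = t + t by ring.
apply: complex_eqP; rewrite /= ?cosD ?sinD; last by ring.
by have := cos2Dsin2 t; lra.
Qed.

End Trigonometry.

Section ClosedSpan.
Context {R : realType} (H : hspace R) (pH : prehilb H).
Context (J : Type) (I : set J) (f : J -> H).
Hypothesis vf : forall j, I j -> vectors H (f j).

Lemma in_span_comb (a : R[i]) s t : in_span I f s -> in_span I f t ->
  in_span I f (a *: s + t).
Proof.
move=> [n [i [c [hi ->]]]] [m [j [d [hj ->]]]].
exists (n + m)%N, (fun k => match fintype.split k with inl p => i p | inr q => j q end),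
  (fun k => match fintype.split k with inl p => a * c p | inr q => d q end).
split; first by move=> k; case: (fintype.split k).
rewrite big_split_ord /= scaler_sumr; congr (_ + _); apply: eq_bigr => k _.
  by rewrite scalerA (_ : fintype.split _ = inl k) //; exact: (unsplitK (inl k)).
by rewrite (_ : fintype.split _ = inr k) //; exact: (unsplitK (inr k)).
Qed.

Lemma in_span1 j : I j -> in_span I f (f j).
Proof.
move=> Ij; exists 1%N, (fun=> j), (fun=> 1); split=> //.
by rewrite big_ord1 scale1r.
Qed.

Lemma in_span0 : in_span I f 0.
Proof. by exists 0%N, (fun k : 'I_0 => match k with Ordinal _ h => False_rect J (notF h) end), (fun=> 0); split=> [[]//|]; rewrite big_ord0. Qed.

Lemma closed_span_mem j : I j -> closed_span I f (f j).
Proof.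
move=> Ij; split; first exact: vf.
move=> eps e0; exists (f j); first exact: in_span1.
by rewrite subrr (sqnorm0 pH).
Qed.

Lemma closed_span_null u : vectors H u -> sqnorm u = 0 -> closed_span I f u.
Proof.
move=> hu u0; split=> // eps e0; exists 0; first exact: in_span0.
by rewrite subr0 u0.
Qed.

Lemma closed_span_lim v : vectors H v ->
  (forall eps : R, 0 < eps -> exists2 u, closed_span I f u & sqnorm (v - u) < eps) ->
  closed_span I f v.
Proof.
move=> hv h; split=> // eps e0; have e4 : 0 < eps / 4 by lra.
have [u [hu hc] vu] := h _ e4; have [s ss us] := hc _ e4; exists s => //.
have hs : vectors H s := in_span_vec pH vf ss.
have := sqnormD_le pH (vectorsB pH hv hu) (vectorsB pH hu hs).
by rewrite addrA subrK; lra.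
Qed.

Lemma closed_span_comb (a : R[i]) u v : closed_span I f u -> closed_span I f v ->
  closed_span I f (a *: u + v).
Proof.
move=> [hu cu] [hv cv]; split; first exact: (vectorsP pH).
(* With this [d], the total error 2 |a|^2 d + 2 d is eps / 2. *)
move=> eps e0; pose d := eps / (4 * (sqmod a + 1)).
have a0 := sqmod_ge0 a.
have d0 : 0 < d by rewrite divr_gt0 ?mulr_gt0 //; lra.
have [s ss us] := cu _ d0; have [t st vt] := cv _ d0.
exists (a *: s + t); first exact: in_span_comb.
have hs : vectors H s := in_span_vec pH vf ss.
have ht : vectors H t := in_span_vec pH vf st.
have -> : a *: u + v - (a *: s + t) = a *: (u - s) + (v - t).
  by rewrite opprD addrACA scalerBr.
have hus := vectorsB pH hu hs; have hvt := vectorsB pH hv ht.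
have := sqnormD_le pH (vectorsZ pH a hus) hvt.
rewrite (sqnormZ pH a hus) => h.
have dE : d * (4 * (sqmod a + 1)) = eps by rewrite /d; field; lra.
have := sqnorm_ge0 pH hus; have := sqnorm_ge0 pH hvt.
by move: h us vt; move: (sqnorm _) (sqnorm _) (sqnorm _) => X Y Z; nra.
Qed.

Lemma closed_spanZ (a : R[i]) u : closed_span I f u -> closed_span I f (a *: u).
Proof.
move=> hu; rewrite -[a *: u]addr0; apply: closed_span_comb => //.
by apply: closed_span_null; [exact: (vectors0 pH)|exact: (sqnorm0 pH)].
Qed.

Lemma closed_spanD u v : closed_span I f u -> closed_span I f v ->
  closed_span I f (u + v).
Proof. by rewrite -{2}[u]scale1r; exact: closed_span_comb. Qed.

Lemma closed_spanB u v : closed_span I f u -> closed_span I f v ->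
  closed_span I f (u - v).
Proof. by move=> hu hv; rewrite addrC -scaleN1r; exact: closed_span_comb. Qed.

End ClosedSpan.

(** The defect in Bessel's inequality is exactly the squared distance from [v] to its partial
    Fourier sum. This converse of Parseval reduces completeness to numerical identities. *)
Lemma closed_span_of_bessel (R : realType) (H : hspace R) (pH : prehilb H)
    (J : choiceType) (f : J -> H) (vf : forall j, vectors H (f j))
    (of1 : forall i j, inner (f i) (f j) = (i == j)%:R) (v : H) :
  vectors H v ->
  (forall eps : R, 0 < eps -> exists s, uniq s /\
    sqnorm v - \sum_(j <- s) sqmod (inner v (f j)) < eps) ->
  closed_span setT f v.
Proof.
move=> hv h; split=> // eps e0; have [s [us lt]] := h _ e0.
exists (\sum_(j <- s) inner v (f j) *: f j); last first.
  rewrite (sqnorm_sub_comb pH vf of1) // [X in _ + X]big1 ?addr0 // => j _.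
  by rewrite subrr sqmod0.
elim: s {us lt} => [|j s IH]; first by rewrite big_nil; exact: in_span0.
by rewrite big_cons; apply: in_span_comb => //; exact: in_span1.
Qed.

Section L2Convergence.
Context {R : realType} d (T : measurableType d) (mu : {measure set T -> \bar R}).

Lemma L2_dominated (f_ : nat -> T -> R[i]) (f : T -> R[i]) (G : T -> R) :
  (forall n, vectors (L2 mu) (f_ n)) -> vectors (L2 mu) f ->
  mu.-integrable setT (fun x => (G x)%:E) ->
  (forall n x, sqmod (f_ n x - f x) <= G x) ->
  (forall x, (fun n => sqmod (f_ n x - f x)) @ \oo --> (0 : R)) ->
  (fun n => @sqnorm R (L2 mu) (f_ n - f)) @ \oo --> (0 : R).
Proof.
move=> vf_ vf iG le cv; have pL := prehilb_L2 mu.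
have vd n : vectors (L2 mu) (f_ n - f) by exact: (vectorsB pL).
have cvE x : (fun n => (sqmod (f_ n x - f x))%:E) @ \oo --> (0 : \bar R)%E.
  by apply: cvg_EFin; [exact: nearW|exact: cv].
have leE x n : setT x -> (`|(sqmod (f_ n x - f x))%:E| <= (G x)%:E)%E.
  by move=> _; rewrite gee0_abs ?lee_fin ?sqmod_ge0.
have [_ _] := @dominated_convergence _ _ _ mu setT measurableT
  (fun n x => (sqmod (f_ n x - f x))%:E) (fun=> 0%E) (fun x => (G x)%:E)
  (fun n => measurable_int mu (L2_sqmod (vd n))) (measurable_cst _)
  (aeW mu (fun x _ => cvE x)) iG (aeW mu leE).
rewrite integral0; have -> : (fun n => \int[mu]_x (sqmod (f_ n x - f x))%:E)%E =
    (fun n => (@sqnorm R (L2 mu) (f_ n - f))%:E).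
  by apply: funext => n; rewrite -(sqnorm_L2E (vd n)).
by move=> /fine_cvg.
Qed.

End L2Convergence.

Lemma cvg0_lt (R : realType) (u : nat -> R) (eps : R) :
  u @ \oo --> (0 : R) -> 0 < eps -> exists n, u n < eps.
Proof.
move=> /cvgrPdist_lt cv e0; have [n _ h] := cv _ e0; exists n.
have := h n (leqnn n); rewrite /= sub0r normrN; exact: le_lt_trans (ler_norm _).
Qed.

(** If every term were at least [delta], more than B / delta of them would exceed the bound. One
    small term is all that the approximation arguments below ask for. *)
Lemma exists_small (R : realType) (u : nat -> R) (B delta : R) :
  (forall K, \sum_(i < K) u i <= B) -> 0 < delta -> exists N, u N < delta.
Proof.
move=> h d0; apply: contrapT => /forallNP no.
have ge N : delta <= u N by rewrite leNgt; apply/negP; exact: no.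
have B0 : 0 <= B by have := h 0%N; rewrite big_ord0.
have := archi_boundP (divr_ge0 B0 (ltW d0)); set K := Num.bound _ => hK.
have := h K; apply/negP; rewrite -ltNge.
apply: (@lt_le_trans _ _ (K%:R * delta)); first by rewrite -ltr_pdivrMr.
rewrite mulr_natl -[K in delta *+ K]card_ord -sumr_const.
by apply: ler_sum => i _; exact: ge.
Qed.

(** * The characters of [0, 1] and the Fourier series of the bump *)

Section FourierBasis.
Context {R : realType}.
Local Notation leb := (@lebesgue_measure R).
Local Notation U := (`[0%R, 1%R]%classic : set R).
Implicit Types (h k : R -> R[i]) (l : int).

Let pL := prehilb_L2 leb.

(** Functions on [0, 1] are taken as functions on the line that vanish elsewhere, so that Fourier
    series live in the same space as everything else. *)
Definition cut h : L2real R := fun x => (\1_U x)%:C%C * h x.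

Definition trig l : L2real R := cut (fun x => cis (2 * pi * l%:~R * x)).

Lemma cutE h x : U x -> cut h x = h x.
Proof. by move=> Ux; rewrite /cut indicE mem_set // mul1r. Qed.

Lemma cut0 h x : ~ U x -> cut h x = 0.
Proof. by move=> Ux; rewrite /cut indicE memNset // mul0r. Qed.

Lemma cmeasurable_cut h : cmeasurable setT h -> cmeasurable setT (cut h).
Proof.
move=> mh; apply: cmeasurableM => //; apply: cmeasurable_real.
exact: measurable_indic.
Qed.

Lemma lebesgue_U : leb U = 1%E.
Proof. by rewrite lebesgue_measure_itv /= lte_fin ltr01 -EFinD subr0. Qed.

Lemma vec_cut h (M : R) : cmeasurable setT h -> (forall x, U x -> sqmod (h x) <= M) ->
  vectors (L2real R) (cut h).
Proof.
move=> mh hM; split; first exact: cmeasurable_cut.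
apply: (@le_lt_trans _ _ (\int[leb]_x ((fun=> M%:E) \_ U) x)%E).
  apply: ge0_le_integral => //.
  - by move=> x _; rewrite lee_fin sqmod_ge0.
  - exact/measurable_EFinP/measurable_sqmod/cmeasurable_cut.
  - by apply/(measurable_restrictT (fun=> M%:E) (measurable_itv _)); exact: measurable_cst.
  move=> x _; rewrite patchE; case: ifPn => [/set_mem Ux|/negP Ux].
    by rewrite cutE // lee_fin hM.
  by rewrite cut0 ?sqmod0 // => /mem_set.
rewrite -integral_mkcond (_ : (\int[leb]_(x in U) _)%E = M%:E * leb U)%E.
  by rewrite lebesgue_U mule1 ltry.
by rewrite integral_cst.
Qed.

Lemma inner_cut h k : @inner R (L2real R) (cut h) (cut k) =
  Complex (\int[leb]_(x in U) complex.Re (h x * (k x)^*%C))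
          (\int[leb]_(x in U) complex.Im (h x * (k x)^*%C)).
Proof.
transitivity (cintegral leb (fun x => cut h x * (cut k x)^*%C)) => //.
rewrite /cintegral; congr Complex;
  rewrite [RHS]Rintegral_mkcond; apply: eq_Rintegral => x _;
  rewrite patchE; case: ifPn => [/set_mem Ux|/negP Ux];
  by [rewrite !cutE | rewrite !cut0 ?mul0r // => /mem_set].
Qed.

Lemma vec_trig l : vectors (L2real R) (trig l).
Proof.
apply: (@vec_cut _ 1) => [|x _]; last by rewrite sqmod_cis.
by apply: measurable_cis; exact: measurable_funM.
Qed.

Lemma trig_period l : sin (2 * pi * l%:~R) = 0 :> R /\ cos (2 * pi * l%:~R) = 1 :> R.
Proof.
have := @cis_2pi_int R l; rewrite /cis => e.
by split; [exact: (congr1 (@complex.Im R) e)|exact: (congr1 (@complex.Re R) e)].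
Qed.

Lemma freq_neq0 l : l != 0 -> 2 * pi * l%:~R != 0 :> R.
Proof.
by move=> l0; rewrite !mulf_neq0 ?intr_eq0 // gt_eqF // pi_gt0.
Qed.

Lemma trig_orthonormal (m n : int) :
  @inner R (L2real R) (trig m) (trig n) = (m == n)%:R.
Proof.
rewrite /trig inner_cut; under eq_Rintegral do rewrite cisJ -cisD -mulNr -mulrDl -mulrBr -intrB.
under [X in Complex _ X]eq_Rintegral do rewrite cisJ -cisD -mulNr -mulrDl -mulrBr -intrB.
rewrite /cis /=; have [->|mn] := eqVneq m n.
  rewrite subrr mulr0; under eq_Rintegral do rewrite mul0r cos0.
  under [X in Complex _ X]eq_Rintegral do rewrite mul0r sin0.
  have c (r : R) : \int[leb]_(_ in U) r = r.
    by transitivity (r * fine (leb U)); [exact: Rintegral_cst|rewrite lebesgue_U mulr1].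
  by rewrite !c.
have mn0 : m - n != 0 by rewrite subr_eq0.
have [s c] := trig_period (m - n); have k0 := freq_neq0 mn0.
rewrite integral_cosM // integral_sinM // !mulr1 !mulr0 s c sin0 cos0 !subrr !mul0r.
by [].
Qed.

(** Its coefficients -2 / (2 pi l)^2, multiplied by cos (2 pi l a) - 1, are the squared moduli of
    the coefficients of the step at [a]; this dictates the choice of function. *)
Definition bump (x : R) : R := x * (1 - x).

Definition bump_coef l : R[i] := @inner R (L2real R) (cut (fun x => (bump x)%:C%C)) (trig l).

Lemma bump_coefE l : l != 0 -> bump_coef l = Complex (- 2 / (2 * pi * l%:~R) ^+ 2) 0.
Proof.
move=> l0; have [s c] := trig_period l; have k0 := freq_neq0 l0.
rewrite /bump_coef /trig inner_cut; congr Complex.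
  under eq_Rintegral do rewrite ReM ReJ ImJ /= mul0r subr0 /bump.
  exact: integral_bump_cosM.
under eq_Rintegral do rewrite ImM ReJ ImJ /= mul0r addr0 /bump mulrN -mulN1r.
rewrite RintegralZl ?integral_bump_sinM ?mulr0 //.
apply: continuous_compact_integrable; first exact: segment_compact.
apply: continuous_subspaceT => x.
exact: (cvgM (@continuous_bump R x) (@continuous_sinM R _ x)).
Qed.

(* Chernoff's argument for pointwise convergence: [bump x - bump a] is divisible
   by [cis (2 pi (x - a)) - 1] with bounded quotient, so that the coefficients
   of [bump], modulated by [cis (2 pi l a)], telescope. *)
Definition quotient_fun (a x : R) : R[i] :=
  ((bump x - bump a) / (2 * sin (pi * (x - a))))%:C%C *
    (- 'i%C * cis (- (pi * (x - a)))).

Lemma measurable_bump : measurable_fun setT bump.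
Proof. apply: continuous_measurable_fun; exact: continuous_bump. Qed.

Lemma measurable_quotient a : cmeasurable setT (quotient_fun a).
Proof.
apply: cmeasurableM.
  apply: cmeasurable_real; apply: measurable_funM.
    by apply: measurable_funB => //; exact: measurable_bump.
  apply: measurable_funV; apply: measurable_funM => //.
  apply: (@measurableT_comp _ _ _ _ _ _ (@sin R)).
    apply: continuous_measurable_fun; exact: continuous_sin.
  by apply: measurable_funM => //; exact: measurable_funB.
apply: cmeasurableM; first exact: cmeasurable_cst.
apply: measurable_cis; apply: measurableT_comp => //.
by apply: measurable_funM => //; exact: measurable_funB.
Qed.

Lemma quotientE a x : U a -> U x -> (bump x - bump a)%:C%C =
  (cis (2 * pi * (x - a)) - 1) * quotient_fun a x.
Proof.
rewrite /= !in_itv /= => ha hx; have := bump_diff_le hx ha.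
rewrite -!/(bump _) -mulrA cis_double_sub1 /quotient_fun; set t := pi * (x - a) => le.
have cc : cis t * cis (- t) = 1 :> R[i] by rewrite -cisD subrr cis0.
transitivity ((2 * sin t)%:C%C * ((bump x - bump a) / (2 * sin t))%:C%C :> R[i]).
  rewrite -rmorphM /=; congr (_ %:C)%C.
  (* At a zero of the sine the quotient is 0 by convention, and [bump_diff_le] makes the numerator
     vanish too. *)
  have [s0|s0] := eqVneq (sin t) 0; last by field.
  by move: le; rewrite s0 normr0 normr_le0 => /eqP ->; rewrite !mul0r mulr0.
have ii : 'i%C * - 'i%C = 1 :> R[i] by apply: complex_eqP => /=; ring.
transitivity ((2 * sin t)%:C%C * ((bump x - bump a) / (2 * sin t))%:C%C *
  ('i%C * - 'i%C) * (cis t * cis (- t)) :> R[i]); first by rewrite ii cc !mulr1.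
by ring.
Qed.

Lemma sqmod_quotient a x : U a -> U x -> sqmod (quotient_fun a x) <= 1.
Proof.
rewrite /= !in_itv /= => ha hx; have := bump_diff_le hx ha.
rewrite -!/(bump _) /quotient_fun !sqmodM sqmod_cis sqmod_real sqmodN.
have -> : sqmod 'i%C = 1 :> R by rewrite /sqmod /=; ring.
rewrite !mulr1; set t := pi * (x - a).
have [->|s0] := eqVneq (sin t) 0; first by rewrite mulr0 invr0 mulr0 expr0n.
move=> le; rewrite exprMn exprVn ler_pdivrMr ?mul1r; last first.
  by rewrite exprn_even_gt0 //= mulf_neq0.
have : (bump x - bump a) ^+ 2 <= sin t ^+ 2.
  by rewrite -[leLHS]real_normK ?num_real // -[leRHS]real_normK ?num_real // ler_sqr ?nnegrE.
by have := sqr_ge0 (sin t); rewrite exprMn; lra.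
Qed.

Definition quotient_coef a l : R[i] := @inner R (L2real R) (cut (quotient_fun a)) (trig l).

Lemma vec_quotient a : U a -> vectors (L2real R) (cut (quotient_fun a)).
Proof.
move=> Ua; apply: (@vec_cut _ 1); first exact: measurable_quotient.
by move=> x Ux; exact: sqmod_quotient.
Qed.

Lemma bump_coef_telescope a l : U a ->
  bump_coef l * cis (2 * pi * l%:~R * a) = (bump a * (l == 0)%:R)%:C%C +
   (quotient_coef a (l - 1) * cis (2 * pi * (l - 1)%:~R * a) -
    quotient_coef a l * cis (2 * pi * l%:~R * a)).
Proof.
move=> Ua; pose g1 x := cis (2 * pi * x) * quotient_fun a x.
have mg1 : cmeasurable setT g1.
  apply: cmeasurableM (measurable_quotient a).
  by apply: measurable_cis; exact: measurable_funM.
have vg := vec_quotient Ua.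
have vg1 : vectors (L2real R) (cut g1).
  apply: (@vec_cut _ 1) => // x Ux.
  by rewrite sqmodM sqmod_cis mul1r sqmod_quotient.
have E : cut (fun x => (bump x)%:C%C) =
    (bump a)%:C%C *: trig 0 + (cis (2 * pi * - a) *: cut g1 - cut (quotient_fun a)).
  apply: funext => x.
  change (cut (fun x => (bump x)%:C%C) x = (bump a)%:C%C * trig 0 x +
    (cis (2 * pi * - a) * cut g1 x - cut (quotient_fun a) x)).
  rewrite /trig; have [Ux|Ux] := pselect (U x); last first.
    by rewrite !cut0 // !mulr0 subrr addr0.
  rewrite !cutE // mulr0 mul0r cis0 mulr1 /g1.
  rewrite mulrA -cisD -mulrDr [- a + x]addrC.
  have := quotientE Ua Ux; rewrite mulrBl mul1r => <-.
  by rewrite rmorphB /= addrC subrK.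
rewrite /bump_coef E.
have v0 := vec_trig 0; have vl := vec_trig l.
rewrite (innerDl pL (vectorsZ pL _ v0) (vectorsB pL (vectorsZ pL _ vg1) vg) vl).
rewrite (innerBl pL (vectorsZ pL _ vg1) vg vl) (innerZl pL _ v0 vl) (innerZl pL _ vg1 vl).
rewrite trig_orthonormal.
(* Multiplication by cis (2 pi x) lowers the index of the coefficient by one, which produces the
   telescoping difference. *)
have -> : @inner R (L2real R) (cut g1) (trig l) = quotient_coef a (l - 1).
  have P x : g1 x * (cis (2 * pi * l%:~R * x))^*%C =
      quotient_fun a x * (cis (2 * pi * (l - 1)%:~R * x))^*%C.
    rewrite /g1 mulrAC mulrC !cisJ -cisD; congr (_ * cis _).
    by rewrite intrB; ring.
  by rewrite /quotient_coef /trig !inner_cut; congr Complex; apply: eq_Rintegral => x _;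
    rewrite P.
rewrite -/(quotient_coef a l) mulrDl mulrBl; congr (_ + (_ - _)).
  have [<-|l0] := eqVneq 0 l; last by rewrite !mulr0 mul0r rmorph0.
  by rewrite mulr0 mul0r cis0 !mulr1.
rewrite mulrAC mulrC -cisD; congr (_ * cis _).
by rewrite intrB; ring.
Qed.

(** As [Negz i] is -(i + 1), the window is [-M, M - 1]. *)
Definition int_window (M : nat) : seq int :=
  map Posz (iota 0 M) ++ map Negz (iota 0 M).

Lemma uniq_int_window M : uniq (int_window M).
Proof.
rewrite cat_uniq !map_inj_uniq ?iota_uniq //=; [|by move=> ? ? []..].
by rewrite andbT; apply/hasPn => _ /mapP[m _ ->]; apply/mapP => -[].
Qed.

Lemma sum_int_window (V : nmodType) (F : int -> V) M :
  \sum_(l <- int_window M) F l = \sum_(i < M) (F (Posz i) + F (Negz i)).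
Proof.
rewrite /int_window big_cat !big_map big_split /=.
rewrite -(big_mkord xpredT (fun i => F (Posz i))).
by rewrite -(big_mkord xpredT (fun i => F (Negz i))) /index_iota subn0.
Qed.

(** The window is [-(M + 1), M]. The differences telescope to the end terms of index -(M + 2),
    written [Negz M.+1], and M; only the index 0 contributes [bump a]. *)
Lemma sum_bump_coef a M : U a ->
  \sum_(i < M.+1) (bump_coef (Posz i) * cis (2 * pi * (Posz i)%:~R * a) +
    bump_coef (Negz i) * cis (2 * pi * (Negz i)%:~R * a)) =
  (bump a)%:C%C +
   (quotient_coef a (Negz M.+1) * cis (2 * pi * (Negz M.+1)%:~R * a) -
    quotient_coef a (Posz M) * cis (2 * pi * (Posz M)%:~R * a)).
Proof.
move=> Ua; pose z l := quotient_coef a l * cis (2 * pi * l%:~R * a).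
have step l : bump_coef l * cis (2 * pi * l%:~R * a) =
  (bump a * (l == 0)%:R)%:C%C + (z (l - 1) - z l) by exact: bump_coef_telescope.
rewrite -/(z (Negz M.+1)) -/(z (Posz M)).
under eq_bigr do rewrite !step.
elim: M => [|M IH].
  rewrite big_ord_recl big_ord0 addr0 mulr1 mulr0 rmorph0.
  change ((bump a)%:C%C + (z (Negz 0) - z 0) + (0 + (z (Negz 1) - z (Negz 0))) =
    (bump a)%:C%C + (z (Negz 1) - z 0)).
  by ring.
rewrite big_ord_recr /= IH /= !mulr0 !rmorph0 !add0r.
have -> : Posz M.+1 - 1 = Posz M by rewrite -addn1 PoszD addrK.
have -> : Negz M.+1 - 1 = Negz M.+2.
  by rewrite !NegzE -opprD -PoszD addn1.
rewrite -addrA; congr (_ + _).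
by ring.
Qed.

End FourierBasis.

Lemma cvg_scaled_sqr (R : realType) (c l : R) (u : nat -> R) : u @ \oo --> l ->
  (fun n => c * (u n - l) ^+ 2) @ \oo --> (0 : R).
Proof.
move=> h; have h2 : (fun n => u n - l) @ \oo --> (0 : R).
  by rewrite -(subrr l); apply: cvgB => //; exact: cvg_cst.
have -> : (0 : R) = c * (0 * 0) by rewrite !mulr0.
by apply: cvgM; [exact: cvg_cst|exact: (cvgM h2 h2)].
Qed.

(** * Completeness: from steps to indicators to square-integrable functions *)

Section FourierCompleteness.
Context {R : realType}.
Local Notation leb := (@lebesgue_measure R).
Local Notation U := (`[0%R, 1%R]%classic : set R).

Import HBNNSimple.

Let pL := prehilb_L2 leb.
Let mU : measurable U := measurable_itv _.

Definition ind (A : set R) : L2real R := cut (fun x => (\1_A x)%:C%C).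

Lemma vec_ind A : measurable A -> vectors (L2real R) (ind A).
Proof.
move=> mA; apply: (@vec_cut _ _ 1).
  by apply: cmeasurable_real; exact: measurable_indic.
by move=> x _; rewrite sqmod_real indicE; case: (_ \in _); rewrite ?expr1n ?expr0n.
Qed.

Lemma Rintegral_step (a : R) (f : R -> R) : 0 <= a ->
  \int[leb]_(x in U) (\1_(`[a, +oo[) x * f x) = \int[leb]_(x in `[a, 1]) f x.
Proof.
move=> a0; have -> : `[a, 1]%classic = U `&` `[a, +oo[.
  apply/seteqP; split=> x /=; rewrite !in_itv /= ?andbT.
    by move=> /andP[h1 h2]; split; [apply/andP; split; lra|].
  by move=> [/andP[_ h] ->].
rewrite Rintegral_mkcondr; apply: eq_Rintegral => x _.
by rewrite patchE indicE; case: ifP; rewrite ?mul1r ?mul0r.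
Qed.

Lemma inner_step (a : R) (l : int) : 0 <= a < 1 -> l != 0 ->
  @inner R (L2real R) (ind `[a, +oo[) (trig l) =
  Complex (- sin (2 * pi * l%:~R * a) / (2 * pi * l%:~R))
          ((1 - cos (2 * pi * l%:~R * a)) / (2 * pi * l%:~R)).
Proof.
move=> /andP[a0 a1] l0; have [s c] := @trig_period R l; have k0 := @freq_neq0 R l l0.
rewrite /ind /trig inner_cut; congr Complex.
  under eq_Rintegral do rewrite ReM ReJ ImJ /= mul0r subr0.
  by rewrite Rintegral_step // integral_cosM // mulr1 s sub0r.
under eq_Rintegral do rewrite ImM ReJ ImJ /= mul0r addr0.
rewrite Rintegral_step //; under eq_Rintegral do rewrite -mulN1r.
rewrite RintegralZl ?integral_sinM ?mulr1 ?c //; first by ring.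
apply: continuous_compact_integrable; first exact: segment_compact.
by apply: continuous_subspaceT; exact: continuous_sinM.
Qed.

Lemma integral_step (a : R) : 0 <= a < 1 ->
  \int[leb]_(x in U) (\1_(`[a, +oo[) x * 1) = 1 - a.
Proof.
move=> /andP[a0 a1]; rewrite Rintegral_step //.
transitivity (1 * fine (leb `[a, 1]%classic)); first exact: Rintegral_cst.
by rewrite mul1r lebesgue_measure_itv /= lte_fin a1.
Qed.

Lemma Rintegral_eq0 (A : set R) (f : R -> R) : (forall x, f x = 0) ->
  \int[leb]_(x in A) f x = 0.
Proof.
move=> f0; rewrite (_ : f = fun=> 0); last exact/funext.
by rewrite /Rintegral integral0.
Qed.

Lemma inner_step0 (a : R) : 0 <= a < 1 ->
  @inner R (L2real R) (ind `[a, +oo[) (trig 0) = Complex (1 - a) 0.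
Proof.
move=> ha; rewrite /ind /trig inner_cut; congr Complex.
  under eq_Rintegral do rewrite ReM ReJ ImJ /= mul0r subr0 mulr0 mul0r cos0.
  exact: integral_step.
apply: Rintegral_eq0 => x.
by rewrite ImM ReJ ImJ /= mul0r addr0 mulr0 mul0r sin0 oppr0 mulr0.
Qed.

Lemma sqnorm_step (a : R) : 0 <= a < 1 -> sqnorm (ind `[a, +oo[) = 1 - a.
Proof.
move=> ha; rewrite /sqnorm /ind inner_cut /=.
under eq_Rintegral do rewrite mul0r.
rewrite -(integral_step ha); apply: eq_Rintegral => x _.
by rewrite subr0 mulr1 indicE; case: (_ \in _); rewrite ?mulr1 ?mulr0.
Qed.

(** This turns the Bessel sum of a step into the series of the bump at [a] minus the same series at
    0. The index 0 stands apart: there the coefficient is 1 - a. *)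
Lemma sqmod_step_coef (a : R) (l : int) : 0 <= a < 1 -> l != 0 ->
  sqmod (@inner R (L2real R) (ind `[a, +oo[) (trig l)) =
  complex.Re (bump_coef l * cis (2 * pi * l%:~R * a)) -
  complex.Re (bump_coef l * cis (2 * pi * l%:~R * 0) : R[i]).
Proof.
move=> ha l0; have k0 := @freq_neq0 R l l0.
rewrite inner_step // bump_coefE // mulr0 cis0 mulr1 ReM /= mul0r subr0 /sqmod /=.
have := cos2Dsin2 (2 * pi * l%:~R * a).
set k := 2 * pi * l%:~R in k0 *; move=> cs.
have -> : (- sin (k * a) / k) ^+ 2 + ((1 - cos (k * a)) / k) ^+ 2 =
  ((cos (k * a) ^+ 2 + sin (k * a) ^+ 2) + 1 - 2 * cos (k * a)) / k ^+ 2 by field.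
by rewrite cs; field.
Qed.

Lemma Re_abs_lt (z : R[i]) (e : R) : 0 < e -> sqmod z < e ^+ 2 -> `|complex.Re z| < e.
Proof.
move=> e0 h; rewrite -ltr_sqr ?nnegrE ?normr_ge0 ?(ltW e0) // real_normK ?num_real //.
exact: le_lt_trans (sqr_Re_le z) h.
Qed.

(** By telescoping, the Bessel sum is (1 - a)^2 + bump a - bump 0 up to four end terms, and (1 -
    a)^2 + a (1 - a) = 1 - a is the squared norm. The end terms are coefficients of bounded
    functions, hence small for a suitable window. *)
Lemma closed_span_step (a : R) : 0 <= a < 1 ->
  closed_span setT (@trig R) (ind `[a, +oo[).
Proof.
move=> ha; have /andP[a0 a1] := ha.
have vst : vectors (L2real R) (ind `[a, +oo[) by apply: vec_ind; exact: measurable_itv.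
apply: (closed_span_of_bessel pL (@vec_trig R) (@trig_orthonormal R) vst) => eps e0.
have Ua : U a by rewrite /= in_itv /= a0 ltW.
have U0 : U 0 by rewrite /= in_itv /= lexx ler01.
pose c b (l : int) : R := sqmod (quotient_coef b l).
have e4 : 0 < (eps / 4) ^+ 2 by rewrite exprn_gt0 //; lra.
(* [Posz i] and [Negz i.+1] are the indices of the two end terms; Bessel applies to each of the two
   duplicate-free lists. *)
have bess b K : U b -> \sum_(i < K) (c b (Posz i) + c b (Negz i.+1)) <=
    sqnorm (cut (quotient_fun b)) + sqnorm (cut (quotient_fun b)).
  move=> Ub; have B s := @bessel _ _ pL _ _ (@vec_trig R) (@trig_orthonormal R) s _ (vec_quotient Ub).
  rewrite big_split /=; apply: lerD.
    rewrite -(big_mkord xpredT (fun i => c b (Posz i))) -(big_map Posz xpredT).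
    by apply: B; rewrite map_inj_uniq ?iota_uniq // => ? ? [].
  rewrite -(big_mkord xpredT (fun i => c b (Negz i.+1))) -(big_map (Negz \o S) xpredT).
  by apply: B; rewrite map_inj_uniq ?iota_uniq // => ? ? [].
have bnd K : \sum_(i < K) (c a (Posz i) + c a (Negz i.+1) +
    (c 0 (Posz i) + c 0 (Negz i.+1))) <=
    (sqnorm (cut (quotient_fun a)) + sqnorm (cut (quotient_fun a))) +
    (sqnorm (cut (quotient_fun 0)) + sqnorm (cut (quotient_fun 0))).
  by rewrite big_split /=; apply: lerD; exact: bess.
(* One [M] serves all four end terms: squares below (eps / 4)^2 give real parts below eps / 4. *)
have [M small] := @exists_small R (fun i => c a (Posz i) + c a (Negz i.+1) +
  (c 0 (Posz i) + c 0 (Negz i.+1))) _ _ bnd e4.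
exists (int_window M.+1); split; first exact: uniq_int_window.
rewrite sum_int_window sqnorm_step //.
pose z b (l : int) := quotient_coef b l * cis (2 * pi * l%:~R * b) : R[i].
have zc b l : sqmod (z b l) = c b l by rewrite sqmodM sqmod_cis mulr1.
have S b : U b -> \sum_(i < M.+1)
    (complex.Re (bump_coef (Posz i) * cis (2 * pi * (Posz i)%:~R * b)) +
     complex.Re (bump_coef (Negz i) * cis (2 * pi * (Negz i)%:~R * b) : R[i])) =
    bump b + (complex.Re (z b (Negz M.+1)) - complex.Re (z b (Posz M))).
  move=> Ub; have := congr1 (@complex.Re R) (sum_bump_coef M Ub).
  rewrite -/(z b (Negz M.+1)) -/(z b (Posz M)) [RHS]ReD [complex.Re (z b _ - _)]ReD ReN.
  rewrite -[bump b]/(complex.Re (bump b)%:C%C) => <-.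
  rewrite (big_morph (@complex.Re R) (@ReD R) erefl).
  by apply: eq_bigr => i _; rewrite ReD.
have -> : \sum_(i < M.+1) (sqmod (@inner R (L2real R) (ind `[a, +oo[) (trig (Posz i))) +
    sqmod (@inner R (L2real R) (ind `[a, +oo[) (trig (Negz i)))) =
  (1 - a) ^+ 2 + (bump a + (complex.Re (z a (Negz M.+1)) - complex.Re (z a (Posz M)))
   - (bump 0 + (complex.Re (z 0 (Negz M.+1)) - complex.Re (z 0 (Posz M))))).
  rewrite -!S // -sumrB [LHS]big_ord_recl [in RHS]big_ord_recl [RHS]addrA.
  congr (_ + _); last first.
    by apply: eq_bigr => i _; rewrite !sqmod_step_coef //; ring.
  rewrite (sqmod_step_coef (l := Negz 0)) //.
  have -> : Posz (ord0 : 'I_M.+1) = 0 by [].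
  have -> : Negz (ord0 : 'I_M.+1) = Negz 0 by [].
  rewrite inner_step0 // !mulr0 !mul0r cis0 /sqmod /= expr0n addr0.
  by ring.
have lt b (l : int) : c b l < (eps / 4) ^+ 2 -> `|complex.Re (z b l)| < eps / 4.
  by rewrite -zc; apply: Re_abs_lt; lra.
have c0 b l : 0 <= c b l := sqmod_ge0 _.
have := c0 a (Posz M); have := c0 a (Negz M.+1); have := c0 0 (Posz M); have := c0 0 (Negz M.+1).
move=> h1 h2 h3 h4.
have l1 : `|complex.Re (z a (Posz M))| < eps / 4 by apply: lt; move: small h1 h2 h3 h4; rewrite /=; clear; lra.
have l2 : `|complex.Re (z a (Negz M.+1))| < eps / 4 by apply: lt; move: small h1 h2 h3 h4; rewrite /=; clear; lra.
have l3 : `|complex.Re (z 0 (Posz M))| < eps / 4 by apply: lt; move: small h1 h2 h3 h4; rewrite /=; clear; lra.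
have l4 : `|complex.Re (z 0 (Negz M.+1))| < eps / 4 by apply: lt; move: small h1 h2 h3 h4; rewrite /=; clear; lra.
have : (1 - a) = (1 - a) ^+ 2 + (bump a - bump 0) by rewrite /bump; ring.
move: l1 l2 l3 l4; move: (complex.Re (z a (Posz M))) (complex.Re (z a (Negz M.+1)))
  (complex.Re (z 0 (Posz M))) (complex.Re (z 0 (Negz M.+1))) (bump a) (bump 0)
  ((1 - a) ^+ 2) (1 - a) => z1 z2 z3 z4 b1 b2 p q; clear.
rewrite !ltr_norml => /andP[? ?] /andP[? ?] /andP[? ?] /andP[? ?].
by lra.
Qed.

Lemma ind_setT : ind setT = trig 0.
Proof.
by apply: funext => x; rewrite /ind /trig /cut indicT mulr0 mul0r cis0.
Qed.

Lemma closed_span_ray (a : R) : closed_span setT (@trig R) (ind `[a, +oo[).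
Proof.
have vst : vectors (L2real R) (ind `[a, +oo[) by apply: vec_ind; exact: measurable_itv.
have [a0|a0] := leP 0 a; last first.
  have -> : ind `[a, +oo[ = trig 0.
    rewrite -ind_setT; apply: funext => x; rewrite /ind.
    have [Ux|Ux] := pselect (U x); last by rewrite !cut0.
    rewrite !cutE // indicT indicE mem_set //=.
    by move: Ux; rewrite /= !in_itv /= andbT; lra.
  by apply: (closed_span_mem pL) => // j _; exact: vec_trig.
have [a1|a1] := ltP a 1; first by apply: closed_span_step; rewrite a0.
apply: closed_span_null => //.
rewrite /sqnorm /ind inner_cut /=; under eq_Rintegral do rewrite mul0r subr0.
(* For a = 1 the ray meets [0, 1] in a single point, and for a > 1 not at all. *)
have [->|a1'] := eqVneq a 1.
  transitivity (\int[leb]_(x in U) (\1_(`[(1 : R), +oo[) x * 1)).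
    apply: eq_Rintegral => x _.
    by rewrite mulr1 indicE; case: (_ \in _); rewrite ?mulr1 ?mulr0.
  by rewrite Rintegral_step // set_itv1; exact: Rintegral_set1.
transitivity (\int[leb]_(x in U) (0 : R)); last exact: Rintegral_eq0.
apply: eq_Rintegral => x /set_mem; rewrite /= in_itv /= => /andP[_ x1].
rewrite indicE memNset /= ?mul0r ?subr0 //.
by rewrite in_itv /= andbT => h; move: a1'; rewrite eq_le; lra.
Qed.

(** Dynkin's argument: the rays are stable under intersection and generate the Borel sets, while the
    sets with indicator in the closed span form a lambda-system, by differences and dominated
    convergence. *)
Lemma closed_span_ind (A : set R) : measurable A -> closed_span setT (@trig R) (ind A).
Proof.
pose G : set (set R) := [set A | exists x, A = `[x, +oo[%classic].
pose Hs : set (set R) := [set A | measurable A /\ closed_span setT (@trig R) (ind A)].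
suff sub : <<s G >> `<=` Hs.
  move=> mA; apply: (sub A _).2.
  have : (@ocitv R).-sigma.-measurable A by [].
  by rewrite RGenCInfty.measurableE.
have vt (j : int) : [set: int] j -> vectors (L2real R) (trig j) by move=> _; exact: vec_trig.
apply: lambda_system_subset => //.
- move=> _ _ [x ->] [y ->]; exists (Num.max x y).
  by apply/seteqP; split=> t /=; rewrite !in_itv /= !andbT ge_max => /andP.
- split=> //.
  + split; first exact: measurableT.
    by rewrite ind_setT; exact: (closed_span_mem pL).
  + move=> B C CB [mB cB] [mC cC]; split; first exact: measurableD.
    have -> : ind (B `\` C) = ind B - ind C; last exact: (closed_spanB pL).
    apply: funext => x; change (ind (B `\` C) x = ind B x - ind C x).
    rewrite /ind /cut -mulrBr -rmorphB /=; congr (_ * _%:C)%C.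
    rewrite !indicE in_setD; have [Cx|Cx] := pselect (C x).
      by rewrite (mem_set Cx) (mem_set (CB _ Cx)) subrr.
    by rewrite (memNset Cx) andbT subr0.
  + move=> F ndF mF.
    have mFU : measurable (\bigcup_i F i) by apply: bigcupT_measurable => i; case: (mF i).
    split=> //; apply: (closed_span_lim pL) => //; first exact: vec_ind.
    move=> eps e0.
    have vF n : vectors (L2real R) (ind (F n)) by apply: vec_ind; case: (mF n).
    have [|n lt] := @cvg0_lt R (fun n =>
      @sqnorm R (L2real R) (ind (F n) - ind (\bigcup_i F i))) eps _ e0.
      apply: (@L2_dominated _ _ _ leb _ _ (fun x => sqmod (trig 0 x))) => //.
      * exact: vec_ind.
      * exact: (L2_sqmod (@vec_trig R 0)).
      * move=> n x; rewrite /ind; have [Ux|Ux] := pselect (U x); last first.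
          by rewrite !cut0 // subrr sqmod0 sqmod_ge0.
        rewrite /trig !cutE // sqmod_cis -rmorphB /= sqmod_real !indicE.
        by do 2 case: (_ \in _); rewrite /= ?subrr ?subr0 ?sub0r ?sqrrN ?expr0n ?expr1n.
      * move=> x; rewrite /ind; have [[m _ Fm]|nF] := pselect ((\bigcup_i F i) x).
          apply: cvg_near_cst; exists m => // n /= mn.
          have Fn : F n x by move/subsetPset: (ndF _ _ mn); apply.
          have Fx : (\bigcup_i F i) x by exists m.
          by rewrite /cut !indicE (mem_set Fn) (mem_set Fx) subrr sqmod0.
        apply: cvg_near_cst; apply: nearW => n.
        have nFn : ~ F n x by move=> Fn; apply: nF; exists n.
        by rewrite /cut !indicE (memNset nF) (memNset nFn) subrr sqmod0.
    exists (ind (F n)); first exact: (mF n).2.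
    by rewrite (sqnormBC pL (vec_ind mFU) (vF n)).
by move=> _ [x ->]; split; [exact: measurable_itv|exact: closed_span_ray].
Qed.

Lemma closed_span_sum (n : nat) (g : 'I_n -> L2real R) :
  (forall i, closed_span setT (@trig R) (g i)) ->
  closed_span setT (@trig R) (\sum_(i < n) g i).
Proof.
move=> h; have vt (j : int) : [set: int] j -> vectors (L2real R) (trig j) by move=> _; exact: vec_trig.
elim/big_ind : _ => // [|u v]; last exact: (closed_spanD pL vt).
by apply: closed_span_null; [exact: (vectors0 pL)|exact: (sqnorm0 pL)].
Qed.

(** Simple functions between 0 and [g] converge to [g], and the squared error is dominated by the
    square of [g] on [0, 1]. *)
Lemma closed_span_nonneg (g : R -> R) : measurable_fun setT g -> (forall x, 0 <= g x) ->
  vectors (L2real R) (cut (fun x => (g x)%:C%C)) ->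
  closed_span setT (@trig R) (cut (fun x => (g x)%:C%C)).
Proof.
move=> mg g0 vg; have mE : measurable_fun setT (EFin \o g) by exact/measurable_EFinP.
have g0E x : setT x -> (0 <= (EFin \o g) x)%E by rewrite lee_fin.
pose f n := nnsfun_approx measurableT mE n.
have fg n x : f n x <= g x.
  by rewrite -lee_fin /f nnsfun_approxE; exact: le_approx.
have f0 n x : 0 <= f n x by [].
have vt (j : int) : [set: int] j -> vectors (L2real R) (trig j) by move=> _; exact: vec_trig.
have cf n : closed_span setT (@trig R) (cut (fun x => (f n x)%:C%C)).
  set s := fset_set (f n @` setT).
  have -> : cut (fun x => (f n x)%:C%C) =
      \sum_(i < #|`s|) ((s`_i)%:C%C *: ind (f n @^-1` [set s`_i])).
    apply: funext => x; rewrite fct_sumE /cut.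
    have D : (f n x)%:C%C = \sum_(i < #|`s|) (s`_i)%:C%C *
        (\1_(f n @^-1` [set s`_i]) x)%:C%C :> R[i].
      rewrite {1}fimfunEord -/s (raddf_sum (real_complex R)).
      by apply: eq_bigr => i _; rewrite -rmorphM.
    rewrite D big_distrr; apply: eq_bigr => i _; rewrite /ind /cut.
    exact: mulrCA.
  apply: closed_span_sum => i; apply: (closed_spanZ pL) => //.
  apply: closed_span_ind.
  by rewrite -[X in measurable X]setTI; exact: (measurable_funP (f n)).
have vf n : vectors (L2real R) (cut (fun x => (f n x)%:C%C)) by case: (cf n).
have E n x : sqmod (cut (fun x => (f n x)%:C%C) x - cut (fun x => (g x)%:C%C) x) =
    \1_U x * (f n x - g x) ^+ 2.
  rewrite /cut -mulrBr -rmorphB /= sqmodM !sqmod_real indicE.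
  by case: (_ \in _); rewrite ?expr1n ?expr0n.
apply: (closed_span_lim pL) => // eps e0.
have [|n lt] := @cvg0_lt R (fun n => @sqnorm R (L2real R)
    (cut (fun x => (f n x)%:C%C) - cut (fun x => (g x)%:C%C))) eps _ e0.
  apply: (@L2_dominated _ _ _ leb _ _ (fun x => sqmod (cut (fun x => (g x)%:C%C) x))) => //.
  - exact: (L2_sqmod vg).
  - move=> n x; rewrite E /cut sqmodM !sqmod_real indicE.
    case: (_ \in _); rewrite ?expr1n ?expr0n /= ?mul0r // !mul1r.
    by have := fg n x; have := f0 n x; have := g0 x; nra.
  - move=> x; under eq_fun do rewrite E.
    have c1 : (fun n => f n x) @ \oo --> g x.
      have := cvg_nnsfun_approx measurableT mE g0E (I : setT x).
      by move=> /fine_cvg.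
    exact: cvg_scaled_sqr.
exists (cut (fun x => (f n x)%:C%C)); first exact: cf.
by rewrite (sqnormBC pL vg (vf n)).
Qed.

Lemma closed_span_trig (f : L2real R) : vectors (L2real R) f ->
  (forall x, ~ U x -> f x = 0) -> closed_span setT (@trig R) f.
Proof.
move=> vf f0; have [mf finf] := vf; have [mr mi] := mf.
have vt (j : int) : [set: int] j -> vectors (L2real R) (trig j) by move=> _; exact: vec_trig.
have part (g : R -> R) : measurable_fun setT g -> (forall x, 0 <= g x) ->
    (forall x, g x ^+ 2 <= sqmod (f x)) ->
    closed_span setT (@trig R) (cut (fun x => (g x)%:C%C)).
  move=> mg g0 gf; apply: closed_span_nonneg => //; split.
    by apply: cmeasurable_cut; exact: cmeasurable_real.
  apply: le_lt_trans finf; apply: ge0_le_integral => //.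
  - by move=> x _; rewrite lee_fin sqmod_ge0.
  - apply/measurable_EFinP/measurable_sqmod.
    by apply: cmeasurable_cut; exact: cmeasurable_real.
  - exact/measurable_EFinP/measurable_sqmod.
  move=> x _; rewrite lee_fin /cut sqmodM !sqmod_real indicE.
  by case: (_ \in _); rewrite ?expr1n ?expr0n /= ?mul0r ?mul1r ?sqmod_ge0.
have pos (g : R -> R) x : g^\+ x ^+ 2 <= g x ^+ 2.
  by rewrite /funrpos; case: (leP (g x) 0) => ?; rewrite ?expr0n ?sqr_ge0.
have neg (g : R -> R) x : g^\- x ^+ 2 <= g x ^+ 2.
  by rewrite /funrneg; case: (leP (- g x) 0) => ?; rewrite ?expr0n ?sqr_ge0 ?sqrrN.
pose r x := complex.Re (f x); pose i x := complex.Im (f x).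
have -> : f = (cut (fun x => (r^\+ x)%:C%C) - cut (fun x => (r^\- x)%:C%C)) +
    'i%C *: (cut (fun x => (i^\+ x)%:C%C) - cut (fun x => (i^\- x)%:C%C)).
  apply: funext => x.
  change (f x = (cut (fun x => (r^\+ x)%:C%C) x - cut (fun x => (r^\- x)%:C%C) x) +
    'i%C * (cut (fun x => (i^\+ x)%:C%C) x - cut (fun x => (i^\- x)%:C%C) x)).
  have [Ux|Ux] := pselect (U x); last by rewrite !cut0 // !subrr mulr0 addr0 f0.
  rewrite !cutE // -!rmorphB /= -!posBnegE.
  by apply: complex_eqP; rewrite !ReImE /= /r /i; ring.
apply: (closed_spanD pL) => //; last apply: (closed_spanZ pL) => //;
  apply: (closed_spanB pL) => //; apply: part => // x; try exact: funrpos_ge0;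
  try exact: funrneg_ge0.
- exact: measurable_funrpos.
- exact: le_trans (pos _ _) (sqr_Re_le _).
- exact: measurable_funrneg.
- exact: le_trans (neg _ _) (sqr_Re_le _).
- exact: measurable_funrpos.
- exact: le_trans (pos _ _) (sqr_Im_le _).
- exact: measurable_funrneg.
- exact: le_trans (neg _ _) (sqr_Im_le _).
Qed.

Lemma parseval_trig (f : L2real R) : vectors (L2real R) f ->
  (forall x, ~ U x -> f x = 0) ->
  (\esum_(l in setT) (sqmod (inner f (trig l)))%:E = (sqnorm f)%:E)%E.
Proof.
move=> vf f0.
exact: (parseval pL (@vec_trig R) (@trig_orthonormal R) (closed_span_trig vf f0)).
Qed.

End FourierCompleteness.

(** No integrability is assumed: Tonelli handles positive and negative parts separately, and [fine]
    keeps the result measurable where an integral is infinite. *)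
Lemma measurable_cintegral (R : realType) d1 d2 (T1 : measurableType d1)
    (T2 : measurableType d2) (mu : {sigma_finite_measure set T2 -> \bar R})
    (F : T1 * T2 -> R[i]) :
  cmeasurable setT F -> cmeasurable setT (fun x => cintegral mu (fun y => F (x, y))).
Proof.
have real (G : T1 * T2 -> R) : measurable_fun setT G ->
    measurable_fun setT (fun x => \int[mu]_y G (x, y)).
  move=> mG; have mE : measurable_fun setT (EFin \o G) by exact/measurable_EFinP.
  apply: (@measurableT_comp _ _ _ _ _ _ (@fine R)); first exact: fine_measurable.
  under eq_fun do rewrite integralE.
  apply: emeasurable_funB.
    have := @measurable_fun_fubini_tonelli_F _ _ _ _ _ mu _
      (measurable_funepos mE) (funepos_ge0 (EFin \o G)).
    congr measurable_fun; apply: funext => x; apply: eq_integral => y _.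
    by rewrite !funeposE.
  have := @measurable_fun_fubini_tonelli_F _ _ _ _ _ mu _
    (measurable_funeneg mE) (funeneg_ge0 (EFin \o G)).
  congr measurable_fun; apply: funext => x; apply: eq_integral => y _.
  by rewrite !funenegE.
by move=> [mr mi]; split; [exact: (real _ mr)|exact: (real _ mi)].
Qed.

(** * The Plancherel formula on the line *)

Section LinePlancherel.
Context {R : realType}.
Local Notation leb := (@lebesgue_measure R).
Local Notation U := (`[0%R, 1%R]%classic : set R).
Implicit Types (f g : R -> R[i]).

Lemma Rintegral_affine (c d : R) (h : R -> R) : c != 0 ->
  leb.-integrable setT (EFin \o h) ->
  `|c| * \int[leb]_x h (c * x + d) = \int[leb]_x h x.
Proof.
move=> c0 ih; have mh := measurable_int leb ih.
have P := ge0_integral_affine d c0 (measurable_funepos mh) (funepos_ge0 (EFin \o h)).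
have N := ge0_integral_affine d c0 (measurable_funeneg mh) (funeneg_ge0 (EFin \o h)).
have fp := integrable_pos_fin_num measurableT ih.
have fn := integrable_neg_fin_num measurableT ih.
rewrite /Rintegral [in LHS]integralE [in RHS]integralE.
have c0' : `|c| != 0 by rewrite normr_eq0.
have inv (a b : \bar R) : (`|c|%:E * a = b)%E -> (a = (`|c|^-1)%:E * b)%E.
  by move=> <-; rewrite muleA -EFinM mulVf // mul1e.
rewrite (_ : (\int[leb]_x (fun x => (h (c * x + d))%:E)^\+ x)%E =
    (\int[leb]_x (EFin \o h)^\+ (c * x + d)%R)%E); last first.
  by apply: eq_integral => x _; rewrite !funeposE.
rewrite (_ : (\int[leb]_x (fun x => (h (c * x + d))%:E)^\- x)%E =
    (\int[leb]_x (EFin \o h)^\- (c * x + d)%R)%E); last first.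
  by apply: eq_integral => x _; rewrite !funenegE.
rewrite (inv _ _ P) (inv _ _ N).
have [p ->] : exists p, (\int[leb]_x (EFin \o h)^\+ x)%E = p%:E.
  by exists (fine (\int[leb]_x (EFin \o h)^\+ x)%E); rewrite fineK.
have [n ->] : exists n, (\int[leb]_x (EFin \o h)^\- x)%E = n%:E.
  by exists (fine (\int[leb]_x (EFin \o h)^\- x)%E); rewrite fineK.
by rewrite -!EFinM -!EFinB /= -mulrBr mulrA mulfV // mul1r.
Qed.

Lemma cintegral_affine (c d : R) f : c != 0 -> cint leb f ->
  `|c|%:C%C * cintegral leb (fun x => f (c * x + d)) = cintegral leb f.
Proof.
move=> c0 [fr fi]; apply: complex_eqP; rewrite /cintegral !ReImE /= mul0r.
  by rewrite subr0; exact: Rintegral_affine.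
by rewrite addr0; exact: Rintegral_affine.
Qed.

Record bounded_support (B N : R) f : Prop := BoundedSupport {
  bs_meas : cmeasurable setT f;
  bs_bound : forall x, sqmod (f x) <= B ^+ 2;
  bs_supp : forall x, ~ (- N <= x <= N) -> f x = 0 }.

Lemma integrable_box (B N : R) : leb.-integrable setT
  (fun x => (B * \1_(`[- N, N]%classic) x)%:E).
Proof.
have mI : measurable (`[- N, N]%classic : set R) by exact: measurable_itv.
under eq_fun do rewrite EFinM.
by apply: integrableZl => //; exact: (integrable_indic_itv (- N) N true false).
Qed.

Lemma cint_bounded_support (B N : R) f g : 0 <= B -> bounded_support B N f ->
  cmeasurable setT g -> (forall x, sqmod (g x) <= 1) ->
  cint leb (fun x => f x * g x).
Proof.
move=> B0 [mf bf sf] mg bg.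
have mI : measurable (`[- N, N]%classic : set R) by exact: measurable_itv.
apply: (@cint_le R _ (measurableTypeR R) leb _ (fun x => B * \1_(`[- N, N]%classic) x)).
- exact: cmeasurableM.
- by apply: measurable_funM => //; exact: measurable_indic.
- move=> x; rewrite sqmodM indicE; case: (boolP (x \in _)) => [_|/negP h].
    rewrite mulr1; apply: le_trans (bf x).
    by rewrite ler_piMr ?sqmod_ge0.
  rewrite sf ?sqmod0 ?mul0r ?sqr_ge0 // => h'; apply: h.
  by apply/mem_set; rewrite /= in_itv.
- by move=> x; rewrite mulr_ge0.
have /integrableP[_] := integrable_box B N.
apply: le_lt_trans; rewrite le_eqVlt; apply/orP; left; apply/eqP.
by apply: eq_integral => x _; rewrite gee0_abs ?lee_fin ?mulr_ge0.
Qed.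

Definition ft f (lambda : R) : R[i] :=
  cintegral leb (fun x => f x * cis (2 * pi * lambda * x)).

Lemma measurable_ft f : cmeasurable setT f -> cmeasurable setT (ft f).
Proof.
move=> mf; apply: (@measurable_cintegral R _ _ _ _ leb
  (fun z => f z.2 * cis (2 * pi * z.1 * z.2))).
apply: cmeasurableM.
  by case: mf => mr mi; split; [apply: (measurableT_comp mr)|apply: (measurableT_comp mi)];
    exact: measurable_snd.
apply: measurable_cis; apply: measurable_funM => //.
exact: measurable_funM.
Qed.

Lemma cint_ft (B N : R) f (lambda : R) : 0 <= B -> bounded_support B N f ->
  cint leb (fun x => f x * cis (2 * pi * lambda * x)).
Proof.
move=> B0 bf; apply: (cint_bounded_support B0 bf).
  by apply: measurable_cis; exact: measurable_funM.
by move=> x; rewrite sqmod_cis.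
Qed.

(* On an interval of length [M] containing the support, Parseval's identity for
   [f] modulated by [cis (2 pi sigma x / M)]. *)
Lemma fiber_parseval (B N : R) f (sigma : R) : 0 <= B -> 0 < N ->
  bounded_support B N f ->
  (\esum_(j in [set: int]) (sqmod (ft f ((sigma + j%:~R) / (2 * N))))%:E =
   (2 * N)%:E * \int[leb]_x (sqmod (f x))%:E)%E.
Proof.
move=> B0 N0 bf; have [mf Bf Sf] := bf.
set M := 2 * N; have M0 : 0 < M by rewrite /M; lra.
have Mn0 : M != 0 by rewrite gt_eqF.
have maff (h : R -> R[i]) (c d : R) : cmeasurable setT h -> cmeasurable setT (fun x : R => h (c * x + d)).
  by move=> [h1 h2]; have ma := @measurable_affine R c d; split;
    [exact: (measurableT_comp h1 ma)|exact: (measurableT_comp h2 ma)].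
pose g : L2real R := cut (fun y => f (M * y - N) * cis (2 * pi * sigma * y)).
have mg : cmeasurable setT (fun y => f (M * y - N) * cis (2 * pi * sigma * y)).
  apply: cmeasurableM; first exact: (maff f M (- N)).
  by apply: measurable_cis; exact: measurable_funM.
have vg : vectors (L2real R) g.
  by apply: (@vec_cut _ _ (B ^+ 2)) => // x _; rewrite sqmodM sqmod_cis mulr1.
have fout x : ~ U x -> f (M * x - N) = 0.
  move=> Ux; apply: Sf => h; apply: Ux; rewrite /= in_itv /=.
  by move: h => /andP[h1 h2]; rewrite /M in h1 h2; apply/andP; split; nra.
have gE x : g x = f (M * x - N) * cis (2 * pi * sigma * x).
  rewrite /g; have [Ux|Ux] := pselect (U x); first by rewrite cutE.
  by rewrite cut0 // fout // mul0r.
have P := parseval_trig vg (fun x Ux => cut0 _ Ux).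
have nE : ((sqnorm g)%:E = (M^-1)%:E * \int[leb]_x (sqmod (f x))%:E)%E.
  rewrite -(sqnorm_L2E vg); under eq_integral do rewrite gE sqmodM sqmod_cis mulr1.
  have mS : measurable_fun setT (fun x => (sqmod (f x))%:E).
    exact/measurable_EFinP/measurable_sqmod.
  rewrite -(ge0_integral_affine (- N) Mn0 mS) => [|x]; last by rewrite lee_fin sqmod_ge0.
  by rewrite muleA -EFinM gtr0_norm // mulVf // mul1e.
have key (a m k s y n : R) : a * m = s + k ->
    2 * pi * s * y - 2 * pi * (- k) * y = 2 * pi * a * (m * y - n) + 2 * pi * a * n.
  move=> h; transitivity (2 * pi * (a * m) * y); last by ring.
  by rewrite h; ring.
(* The index is -j because [trig] enters the inner product conjugated. The substitution x = M y - N
   brings the factor 1 / M and a phase of modulus 1. *)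
have cE (j : int) : sqmod (inner g (trig (- j))) =
    M^-1 ^+ 2 * sqmod (ft f ((sigma + j%:~R) / M)).
  pose lam := (sigma + j%:~R) / M.
  have -> : inner g (trig (- j)) = (M^-1)%:C%C * (cis (2 * pi * lam * N) * ft f lam).
    transitivity (cintegral leb (fun y => (fun x => f x * cis (2 * pi * lam * x) *
        cis (2 * pi * lam * N)) (M * y - N))).
      apply: eq_cintegral => y; rewrite gE /trig.
      have [Uy|Uy] := pselect (U y); last by rewrite fout // !mul0r.
      rewrite cutE // cisJ -[LHS]mulrA -[RHS]mulrA -!cisD; congr (_ * cis _).
      have lM : lam * M = sigma + j%:~R by rewrite /lam -mulrA mulVf // mulr1.
      by rewrite mulrNz; exact: key lM.
    have ic := cint_ft lam B0 bf.
    have E0 := @cintZD _ _ _ leb (cis (2 * pi * lam * N)) _ (fun=> 0) ic.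
    have i0 : cint leb (fun=> 0) by split; exact: integrable0.
    have E1 := cintegralZD (cis (2 * pi * lam * N)) ic i0.
    have z0 : cintegral leb (fun=> 0) = 0.
      by apply: complex_eqP; rewrite /cintegral /= /Rintegral integral0.
    have C := cintegral_affine (- N) Mn0 (E0 i0).
    rewrite E1 z0 addr0 -/(ft f lam) in C.
    rewrite -C gtr0_norm // mulrA -rmorphM /= mulVf // mul1r.
    by apply: eq_cintegral => y; rewrite addr0 [RHS]mulrC.
  by rewrite !sqmodM sqmod_real sqmod_cis mul1r.
have : (\esum_(j in [set: int]) (sqmod (inner g (trig j)))%:E =
    \esum_(j in [set: int]) (M^-1 ^+ 2 * sqmod (ft f ((sigma + j%:~R) / M)))%:E)%E.
  rewrite (@reindex_esum _ _ _ setT setT (fun j : int => - j)).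
    by apply: eq_esum => j _; rewrite cE.
  by split=> //; move=> i j _ _; exact: oppr_inj.
rewrite P nE esumZ ?sqr_ge0 // => [e|j]; last exact: sqmod_ge0.
have := congr1 (fun t => (M ^+ 2)%:E * t)%E e; rewrite !muleA -!EFinM.
have -> : M ^+ 2 / M = M by field.
have -> : M ^+ 2 * M^-1 ^+ 2 = 1 by field.
by rewrite mul1e => <-.
Qed.

Lemma integral_cst01 (c : \bar R) : (\int[leb]_(x in U) c = c)%E.
Proof.
rewrite integral_cst //.
by rewrite -[RHS]mule1; congr (_ * _)%E; exact: lebesgue_U.
Qed.

Lemma integral_unfold01 (f : R -> \bar R) : measurable_fun setT f ->
  (forall x, 0 <= f x)%E ->
  (\int[leb]_x f x =
   \int[leb]_(x in `[0%R, 1%R]) (\esum_(j in [set: int]) f (x + j%:~R)%R))%E.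
Proof.
move=> mf f0; rewrite integral_unfold // integral_itv_bndo_bndc //.
apply: measurable_esum => //; first exact: countable_int.
move=> j _; apply: measurable_funTS; apply: measurableT_comp => //.
exact: measurable_funD.
Qed.

(** After the frequency is scaled by 1 / M and unfolded over the integers, every fibre sum equals M
    times the squared norm of [f], whatever the fibre; the two factors cancel. *)
Theorem plancherel_line (B N : R) f : 0 <= B -> 0 < N -> bounded_support B N f ->
  (\int[leb]_x (sqmod (ft f x))%:E = \int[leb]_x (sqmod (f x))%:E)%E.
Proof.
move=> B0 N0 bf; have [mf _ _] := bf; set M := 2 * N.
have M0 : 0 < M by rewrite /M; lra.
have Mn0 : M^-1 != 0 by rewrite invr_neq0 // gt_eqF.
have mS : measurable_fun setT (fun x => (sqmod (ft f x))%:E).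
  exact/measurable_EFinP/measurable_sqmod/measurable_ft.
rewrite -(ge0_integral_affine 0 Mn0 mS) => [|x]; last by rewrite lee_fin sqmod_ge0.
rewrite (integral_unfold01 (f := fun x => (sqmod (ft f (M^-1 * x + 0)))%:E)); first last.
- by move=> x; rewrite lee_fin sqmod_ge0.
- by apply: (measurableT_comp mS); exact: measurable_affine.
under eq_integral => s _.
  under eq_esum do rewrite addr0 mulrC.
  rewrite (fiber_parseval s B0 N0 bf) -/M.
  over.
rewrite integral_cst01 muleA -EFinM gtr0_norm ?invr_gt0 // mulVf ?mul1e //.
by rewrite gt_eqF.
Qed.

End LinePlancherel.

(** * Fubini for complex integrands, and Haar measure as a product *)

Section ComplexFubini.
Context {R : realType} d1 d2 (T1 : measurableType d1) (T2 : measurableType d2).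
Context (m1 : {sigma_finite_measure set T1 -> \bar R}).
Context (m2 : {sigma_finite_measure set T2 -> \bar R}).
Implicit Types (f : T1 * T2 -> R) (F : T1 * T2 -> R[i]).

Lemma measurable_section1 d (T : measurableType d) (g : T1 * T2 -> T) x :
  measurable_fun setT g -> measurable_fun setT (fun y => g (x, y)).
Proof. by move=> mg; apply: (measurableT_comp mg); exact: pair1_measurable. Qed.

Lemma measurable_section2 d (T : measurableType d) (g : T1 * T2 -> T) y :
  measurable_fun setT g -> measurable_fun setT (fun x => g (x, y)).
Proof. by move=> mg; apply: (measurableT_comp mg); exact: pair2_measurable. Qed.

(** Fubini produces extended-real partial integrals, [Rintegral] real ones. They differ at most
    where a section fails to be integrable, a null set; this lemma exchanges them. *)
Lemma integrable_ae_real d (T : measurableType d) (mu : {measure set T -> \bar R})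
    (F : T -> \bar R) (g : T -> R) :
  mu.-integrable setT F -> measurable_fun setT g ->
  {ae mu, forall x, F x = (g x)%:E} ->
  mu.-integrable setT (fun x => (g x)%:E) /\
  (\int[mu]_x (g x)%:E = \int[mu]_x F x)%E.
Proof.
move=> iF mg ae; have [mF fF] := integrableP _ _ _ iF.
have mE : measurable_fun setT (fun x => (g x)%:E) by exact/measurable_EFinP.
split; last first.
  apply: ae_eq_integral => //; apply: filterS ae => x -> //.
apply/integrableP; split=> //; apply: le_lt_trans fF.
rewrite le_eqVlt; apply/orP; left; apply/eqP.
apply: ae_eq_integral => //; try exact: measurableT_comp.
by apply: filterS ae => x ->.
Qed.

Lemma Rfubini1 f : (m1 \x m2)%E.-integrable setT (EFin \o f) ->
  m1.-integrable setT (fun x => (\int[m2]_y f (x, y))%:E) /\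
  \int[m1]_x (\int[m2]_y f (x, y)) = \int[(m1 \x m2)%E]_z f z.
Proof.
move=> fi; have iF := integrable_fubini_F fi.
have ae : {ae m1, forall x, fubini_F m2 (EFin \o f) x = (\int[m2]_y f (x, y))%:E}.
  have := ae_integrable1 fi; apply: filterS => x ix.
  by rewrite /Rintegral fineK //; exact: integrable_fin_num ix.
have mR : measurable_fun setT (fun x => \int[m2]_y f (x, y)).
  apply: (@measurableT_comp _ _ _ _ _ _ (@fine R)); first exact: fine_measurable.
  exact: (measurable_int m1 iF).
have [h1 h2] := integrable_ae_real iF mR ae; split=> //.
by rewrite /Rintegral -integral12_prod_meas1 // -h2.
Qed.

Lemma Rfubini2 f : (m1 \x m2)%E.-integrable setT (EFin \o f) ->
  m2.-integrable setT (fun y => (\int[m1]_x f (x, y))%:E) /\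
  \int[m2]_y (\int[m1]_x f (x, y)) = \int[(m1 \x m2)%E]_z f z.
Proof.
move=> fi; have [mf _] := integrableP _ _ _ fi.
have mG := measurable_fubini_G fi.
have iG : m2.-integrable setT (fubini_G m1 (EFin \o f)).
  apply/integrableP; split=> //; apply: le_lt_trans ((integrable21ltyP m1 m2 mf).1 fi).
  have mabs : measurable_fun setT (fun z => `|(EFin \o f) z|%E) by exact: measurableT_comp.
  apply: ge0_le_integral => //.
  - exact: measurableT_comp.
  - exact: (@measurable_fun_fubini_tonelli_G _ _ _ _ _ m1 _ mabs (fun z => abse_ge0 _)).
  - move=> y _; apply: le_abse_integral => //.
    exact: (measurable_section2 y mf).
have ae : {ae m2, forall y, fubini_G m1 (EFin \o f) y = (\int[m1]_x f (x, y))%:E}.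
  have := ae_integrable2 fi; apply: filterS => x ix.
  by rewrite /Rintegral fineK //; exact: integrable_fin_num ix.
have mR : measurable_fun setT (fun y => \int[m1]_x f (x, y)).
  apply: (@measurableT_comp _ _ _ _ _ _ (@fine R)); first exact: fine_measurable.
  exact: mG.
have [h1 h2] := integrable_ae_real iG mR ae; split=> //.
by rewrite /Rintegral -integral21_prod_meas1 // -h2.
Qed.

Lemma cfubini1 F : cint (m1 \x m2)%E F ->
  cint m1 (fun x => cintegral m2 (fun y => F (x, y))) /\
  cintegral m1 (fun x => cintegral m2 (fun y => F (x, y))) = cintegral (m1 \x m2)%E F.
Proof.
move=> [/Rfubini1[r1 r2] /Rfubini1[i1 i2]]; split; first by split; [exact: r1|exact: i1].
by apply: complex_eqP; [exact: r2|exact: i2].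
Qed.

Lemma cfubini2 F : cint (m1 \x m2)%E F ->
  cint m2 (fun y => cintegral m1 (fun x => F (x, y))) /\
  cintegral m2 (fun y => cintegral m1 (fun x => F (x, y))) = cintegral (m1 \x m2)%E F.
Proof.
move=> [/Rfubini2[r1 r2] /Rfubini2[i1 i2]]; split; first by split; [exact: r1|exact: i1].
by apply: complex_eqP; [exact: r2|exact: i2].
Qed.

End ComplexFubini.

Section ProductSigmaFinite.
Context {R : realType} d1 d2 (T1 : measurableType d1) (T2 : measurableType d2).
Context (m1 : {sigma_finite_measure set T1 -> \bar R}).
Context (m2 : {sigma_finite_measure set T2 -> \bar R}).

(* The library's sigma-finite instance for [\x] is shadowed by the one for
   products of subprobabilities. *)
Definition prodm : set (T1 * T2) -> \bar R := (m1 \x m2)%E.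

HB.instance Definition _ := Measure.copy prodm (m1 \x m2)%E.

Lemma sigma_finite_prodm : sigma_finite setT prodm.
Proof.
have [F TF mF] := sigma_finiteT m1; have [G TG mG] := sigma_finiteT m2.
exists (fun n => if (choice.unpickle n : option (nat * nat)%type) is Some (i, j) then F i `*` G j else set0).
  apply/seteqP; split=> // -[x y] _.
  have [i _ Fi] : (\bigcup_i F i) x by rewrite -TF.
  have [j _ Gj] : (\bigcup_i G i) y by rewrite -TG.
  by exists (choice.pickle (i, j)) => //; rewrite choice.pickleK.
move=> n; case: (choice.unpickle n : option (nat * nat)%type) => [[i j]|]; last by rewrite measure0.
have [mFi Fi] := mF i; have [mGj Gj] := mG j.
split; first exact: measurableX.
by rewrite /prodm product_measure1E // lte_mul_pinfty // ge0_fin_numE.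
Qed.

HB.instance Definition _ := Measure_isSigmaFinite.Build _ _ _ prodm sigma_finite_prodm.

End ProductSigmaFinite.

Section CintegralExtra.
Context {R : realType} d (T : measurableType d) (mu : {measure set T -> \bar R}).

Lemma cint0 : cint mu (fun=> 0).
Proof. by split; exact: integrable0. Qed.

Lemma cintegral0 : cintegral mu (fun=> 0) = 0.
Proof. by apply: complex_eqP; rewrite /cintegral /= /Rintegral integral0. Qed.

Lemma cintegralZr (c : R[i]) (f : T -> R[i]) : cint mu f ->
  cintegral mu (fun x => f x * c) = cintegral mu f * c.
Proof.
move=> hf; have := cintegralZD c hf cint0; rewrite cintegral0 addr0 mulrC => <-.
by apply: eq_cintegral => x; rewrite addr0 mulrC.
Qed.

Lemma cmeasurable_comp d' (T' : measurableType d') (f : T -> R[i]) (g : T' -> T) :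
  cmeasurable setT f -> measurable_fun setT g -> cmeasurable setT (fun x => f (g x)).
Proof.
by move=> [f1 f2] mg; split; [exact: (measurableT_comp f1 mg)|exact: (measurableT_comp f2 mg)].
Qed.

End CintegralExtra.

Section HaarMeasure.
Context {R : realType}.
Local Notation leb := (@lebesgue_measure R).

Lemma measurable_hp : measurable_fun setT (fun x : heis R => x.1.1).
Proof. exact: (measurableT_comp measurable_fst measurable_fst). Qed.

Lemma measurable_hq : measurable_fun setT (fun x : heis R => x.1.2).
Proof. exact: (measurableT_comp measurable_snd measurable_fst). Qed.

Lemma measurable_ht : measurable_fun setT (fun x : heis R => x.2).
Proof. exact: measurable_snd. Qed.

Definition leb2 : {sigma_finite_measure
    set (measurableTypeR R * measurableTypeR R)%type -> \bar R} := prodm leb leb.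

Lemma haar_tonelli (f : heis R -> \bar R) : measurable_fun setT f ->
  (forall x, 0 <= f x)%E ->
  (\int[haar]_x f x = \int[leb2]_z \int[leb]_t f (z, t))%E.
Proof. by move=> mf f0; exact: (@fubini_tonelli1 _ _ _ _ _ leb2 leb f mf f0). Qed.

Lemma leb2_tonelli (f : R * R -> \bar R) : measurable_fun setT f ->
  (forall x, 0 <= f x)%E ->
  (\int[leb2]_z f z = \int[leb]_q \int[leb]_p f (p, q))%E.
Proof. by move=> mf f0; exact: (@fubini_tonelli2 _ _ _ _ _ leb leb f mf f0). Qed.

Lemma tonelli_prod d1 d2 (T1 : measurableType d1) (T2 : measurableType d2)
    (m1 : {sigma_finite_measure set T1 -> \bar R})
    (m2 : {sigma_finite_measure set T2 -> \bar R}) (a : T1 -> \bar R) (b : T2 -> \bar R) :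
  measurable_fun setT a -> measurable_fun setT b ->
  (forall x, 0 <= a x)%E -> (forall x, 0 <= b x)%E ->
  (\int[(m1 \x m2)%E]_z (a z.1 * b z.2) = \int[m1]_x a x * \int[m2]_x b x)%E.
Proof.
move=> ma mb a0 b0; rewrite fubini_tonelli1; first last.
- by move=> z; rewrite mule_ge0.
- by apply: emeasurable_funM; [exact: (measurableT_comp ma measurable_fst)|
    exact: (measurableT_comp mb measurable_snd)].
rewrite -ge0_integralZr //; last exact: integral_ge0.
apply: eq_integral => x _.
transitivity (\int[m2]_y (a x * b y))%E => //.
by rewrite ge0_integralZl.
Qed.

Lemma haar_prod (a b c : R -> \bar R) : measurable_fun setT a -> measurable_fun setT b ->
  measurable_fun setT c -> (forall x, 0 <= a x)%E -> (forall x, 0 <= b x)%E ->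
  (forall x, 0 <= c x)%E ->
  (\int[haar]_x (a x.1.1 * b x.1.2 * c x.2) =
   \int[leb]_x (a x) * \int[leb]_x (b x) * \int[leb]_x (c x))%E.
Proof.
move=> ma mb mc a0 b0 c0.
have mab : measurable_fun setT (fun z : R * R => a z.1 * b z.2)%E.
  by apply: emeasurable_funM; [exact: (measurableT_comp ma measurable_fst)|
    exact: (measurableT_comp mb measurable_snd)].
have ab0 (z : R * R) : (0 <= a z.1 * b z.2)%E by rewrite mule_ge0.
have <- := tonelli_prod leb leb ma mb a0 b0.
exact: (tonelli_prod leb2 leb mab mc ab0 c0).
Qed.

End HaarMeasure.

(** * The Plancherel formula on the Heisenberg group *)

Section BoxFunctions.
Context {R : realType}.
Local Notation leb := (@lebesgue_measure R).
Implicit Types (f : R -> R[i]) (phi : heis R -> R[i]).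

Let pL := prehilb_L2 leb.

(** The measure [haar] again, built from [prodm] so that it carries the sigma-finite structure
    needed for Fubini with one more variable. *)
Definition hm : {sigma_finite_measure set (measurableTypeR R * measurableTypeR R *
  measurableTypeR R)%type -> \bar R} := prodm (leb2 : {sigma_finite_measure set _ -> \bar R}) leb.

Definition chi (N x : R) : R := \1_(`[- N, N]%classic) x.

Lemma chi_ge0 N x : 0 <= chi N x. Proof. by rewrite /chi. Qed.

Lemma chi_sqr N x : chi N x ^+ 2 = chi N x.
Proof. by rewrite /chi indicE; case: (_ \in _); rewrite ?expr1n ?expr0n. Qed.

Lemma chi1 N x : - N <= x <= N -> chi N x = 1.
Proof. by move=> h; rewrite /chi indicE mem_set //= in_itv. Qed.

Lemma chi0 N x : ~ (- N <= x <= N) -> chi N x = 0.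
Proof. by move=> h; rewrite /chi indicE memNset //= in_itv. Qed.

Lemma measurable_chi N : measurable_fun setT (chi N).
Proof. by apply: measurable_indic; exact: measurable_itv. Qed.

Lemma integral_chi N : 0 <= N -> (\int[leb]_x (chi N x)%:E = (2 * N)%:E)%E.
Proof.
move=> N0; transitivity (leb `[- N, N]%classic).
  rewrite /chi integral_indic ?setIT //; exact: measurable_itv.
rewrite lebesgue_measure_itv /= lte_fin.
case: ifPn => [_|]; first by rewrite -EFinB; congr EFin; ring.
by rewrite -leNgt => h; congr EFin; lra.
Qed.

Lemma L2_bounded_support (B N : R) f : 0 <= N -> bounded_support B N f ->
  vectors (L2real R) f /\ sqnorm (f : L2real R) <= B ^+ 2 * (2 * N).
Proof.
move=> N0 [mf bf sf].
have le : (\int[leb]_x (sqmod (f x))%:E <= (B ^+ 2 * (2 * N))%:E)%E.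
  rewrite EFinM -integral_chi // -ge0_integralZl ?lee_fin ?sqr_ge0 //; last 2 first.
  - by apply/measurable_EFinP; exact: measurable_chi.
  - by move=> x _; rewrite lee_fin chi_ge0.
  apply: ge0_le_integral => //.
  - by move=> x _; rewrite lee_fin sqmod_ge0.
  - exact/measurable_EFinP/measurable_sqmod.
  - apply: emeasurable_funM => //; apply/measurable_EFinP; exact: measurable_chi.
  move=> x _; rewrite -EFinM lee_fin; have [h|h] := pselect (- N <= x <= N).
    by rewrite chi1 // mulr1.
  by rewrite sf // sqmod0 mulr_ge0 ?sqr_ge0 ?chi_ge0.
have vf : vectors (L2real R) f by split=> //; apply: le_lt_trans le _; rewrite ltry.
by split=> //; rewrite -lee_fin -(sqnorm_L2E vf).
Qed.

(** Cauchy-Schwarz against the character restricted to [-N, N]; each of the two norms brings a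
    factor 2 N. *)
Lemma ft_bound (B N : R) f (lambda : R) : 0 <= N -> bounded_support B N f ->
  sqmod (ft f lambda) <= (B * (2 * N)) ^+ 2.
Proof.
move=> N0 bf; have [vf nf] := L2_bounded_support N0 bf; have [mf _ sf] := bf.
pose g : L2real R := fun x => (chi N x)%:C%C * cis (- (2 * pi * lambda * x)).
have bg : bounded_support 1 N g.
  split.
  - apply: cmeasurableM; first by apply: cmeasurable_real; exact: measurable_chi.
    by apply: measurable_cis; apply: measurableT_comp => //; exact: measurable_funM.
  - move=> x; rewrite sqmodM sqmod_cis sqmod_real chi_sqr mulr1 expr1n.
    by rewrite /chi indicE; case: (_ \in _).
  by move=> x h; rewrite /g chi0 // mul0r.
have [vg ng] := L2_bounded_support N0 bg.
have -> : ft f lambda = @inner R (L2real R) f g.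
  apply: eq_cintegral => x; rewrite /g conjM cisJ opprK.
  have [h|h] := pselect (- N <= x <= N); last by rewrite sf // !mul0r.
  by rewrite chi1 // rmorph1 mul1r.
apply: le_trans (CauchySchwarz pL vf vg) _.
have := sqnorm_ge0 pL vf; have := sqnorm_ge0 pL vg.
move: (sqnorm _) (sqnorm _) nf ng => a b; rewrite expr1n mul1r => ha hb a0 b0.
have -> : (B * (2 * N)) ^+ 2 = (B ^+ 2 * (2 * N)) * (2 * N) by ring.
exact: ler_pM.
Qed.

Record box (B N : R) phi : Prop := Box {
  bx_meas : cmeasurable setT phi;
  bx_bound : forall x, sqmod (phi x) <= B ^+ 2;
  bx_p : forall x, ~ (- N <= x.1.1 <= N) -> phi x = 0;
  bx_q : forall x, ~ (- N <= x.1.2 <= N) -> phi x = 0;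
  bx_t : forall x, ~ (- N <= x.2 <= N) -> phi x = 0 }.

Definition box1 (N : R) (x : heis R) : R := chi N x.1.1 * chi N x.1.2 * chi N x.2.

Lemma box1_ge0 N x : 0 <= box1 N x.
Proof. by rewrite !mulr_ge0 ?chi_ge0. Qed.

Lemma measurable_box1 N : measurable_fun setT (box1 N).
Proof.
have mc := measurable_chi N.
apply: measurable_funM; first apply: measurable_funM.
- exact: (measurableT_comp mc measurable_hp).
- exact: (measurableT_comp mc measurable_hq).
- exact: (measurableT_comp mc measurable_ht).
Qed.

Lemma integral_box1 N : 0 <= N -> (\int[hm]_x (box1 N x)%:E = ((2 * N) ^+ 3)%:E)%E.
Proof.
move=> N0; have mc : measurable_fun setT (EFin \o chi N).
  by apply/measurable_EFinP; exact: measurable_chi.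
have c0 x : (0 <= (EFin \o chi N) x)%E by rewrite lee_fin chi_ge0.
have := haar_prod mc mc mc c0 c0 c0; rewrite !integral_chi // -!EFinM => h.
transitivity ((2 * N * (2 * N) * (2 * N))%:E); last by congr EFin; ring.
rewrite -h; apply: eq_integral => x _ /=; by rewrite -!EFinM.
Qed.

Lemma box_bound_box1 (B N : R) phi x : box B N phi ->
  sqmod (phi x) <= B ^+ 2 * box1 N x ^+ 2.
Proof.
move=> [_ bd sp sq st].
have [h1|h1] := pselect (- N <= x.1.1 <= N); last first.
  by rewrite sp // sqmod0 mulr_ge0 ?sqr_ge0.
have [h2|h2] := pselect (- N <= x.1.2 <= N); last first.
  by rewrite sq // sqmod0 mulr_ge0 ?sqr_ge0.
have [h3|h3] := pselect (- N <= x.2 <= N); last first.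
  by rewrite st // sqmod0 mulr_ge0 ?sqr_ge0.
by rewrite /box1 !chi1 // !mulr1 expr1n mulr1.
Qed.

End BoxFunctions.

(** * The integral kernel attached to a box function *)

Section BoxTransform.
Context {R : realType}.
Local Notation leb := (@lebesgue_measure R).
Context (B N : R) (B0 : 0 <= B) (N0 : 0 < N) (phi : heis R -> R[i]).
Hypothesis bphi : box B N phi.

Let N0' : 0 <= N := ltW N0.

Definition hpsi (lambda p q : R) : R[i] := ft (fun t => phi (p, q, t)) lambda.

(** In [schrodinger] the phase is p s + p q / 2 = p (s + q / 2). Integrating [phi] against it over t
    and then p leaves the operator that maps u to the integral over q of
    [hker lambda s q * u (s + q)]. *)
Definition hker (lambda s q : R) : R[i] :=
  ft (fun p => hpsi lambda p q) (lambda * (s + q / 2)).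

Lemma bs_slice p q : bounded_support B N (fun t => phi (p, q, t)).
Proof.
case: bphi => mb bb bp bq bt; split=> [|t|t h]; [|exact: bb|exact: bt].
by apply: (cmeasurable_comp mb); exact: pair1_measurable.
Qed.

Lemma measurable_hpsi3 :
  cmeasurable setT (fun z : R * (R * R) => hpsi z.1 z.2.1 z.2.2).
Proof.
apply: (@measurable_cintegral R _ _ _ _ leb (fun y : (R * (R * R)) * R =>
  phi (y.1.2.1, y.1.2.2, y.2) * cis (2 * pi * y.1.1 * y.2))).
have m1 : measurable_fun setT (fun y : (R * (R * R)) * R => y.1.1).
  exact: (measurableT_comp measurable_fst measurable_fst).
have m2 : measurable_fun setT (fun y : (R * (R * R)) * R => y.1.2).
  exact: (measurableT_comp measurable_snd measurable_fst).
apply: cmeasurableM.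
  apply: (cmeasurable_comp (bx_meas bphi)).
  apply: measurable_fun_pair; last exact: measurable_snd.
  apply: measurable_fun_pair.
    exact: (measurableT_comp measurable_fst m2).
  exact: (measurableT_comp measurable_snd m2).
apply: measurable_cis; apply: measurable_funM; last exact: measurable_snd.
by apply: measurable_funM.
Qed.

Lemma measurable_hpsi2 lambda : cmeasurable setT (fun z : R * R => hpsi lambda z.1 z.2).
Proof.
apply: (cmeasurable_comp measurable_hpsi3 (g := fun z : R * R => (lambda, z))).
exact: pair1_measurable.
Qed.

Lemma bs_hpsi lambda q : bounded_support (B * (2 * N)) N (fun p => hpsi lambda p q).
Proof.
split=> [|p|p h].
- apply: (cmeasurable_comp (measurable_hpsi2 lambda) (g := fun p : R => (p, q))).
  exact: pair2_measurable.
- exact: ft_bound N0' (bs_slice p q).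
rewrite /hpsi /ft -[RHS](cintegral0 leb); apply: eq_cintegral => t.
by rewrite (bx_p bphi) ?mul0r.
Qed.

Lemma hpsi_q lambda p q : ~ (- N <= q <= N) -> hpsi lambda p q = 0.
Proof.
move=> h; rewrite /hpsi /ft -[RHS](cintegral0 leb); apply: eq_cintegral => t.
by rewrite (bx_q bphi) ?mul0r.
Qed.

Lemma measurable_hker lambda : cmeasurable setT (fun z : R * R => hker lambda z.1 z.2).
Proof.
apply: (@measurable_cintegral R _ _ _ _ leb (fun y : (R * R) * R =>
  hpsi lambda y.2 y.1.2 * cis (2 * pi * (lambda * (y.1.1 + y.1.2 / 2)) * y.2))).
apply: cmeasurableM.
  apply: (cmeasurable_comp (measurable_hpsi2 lambda) (g := fun y : (R * R) * R => (y.2, y.1.2))).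
  apply: measurable_fun_pair; first exact: measurable_snd.
  exact: measurable_hq.
apply: measurable_cis; apply: measurable_funM; last exact: measurable_snd.
apply: measurable_funM => //; apply: measurable_funM => //.
apply: measurable_funD; first exact: measurable_hp.
by apply: measurable_funM => //; exact: measurable_hq.
Qed.

Lemma bs_hker lambda s : bounded_support (B * (2 * N) * (2 * N)) N (hker lambda s).
Proof.
split=> [|q|q h].
- apply: (cmeasurable_comp (measurable_hker lambda) (g := fun q : R => (s, q))).
  exact: pair1_measurable.
- exact: ft_bound N0' (bs_hpsi lambda q).
rewrite /hker /ft -[RHS](cintegral0 leb); apply: eq_cintegral => t.
by rewrite hpsi_q ?mul0r.
Qed.

Lemma measurable_hker_sqmod lambda :
  measurable_fun setT (fun z : R * R => (sqmod (hker lambda z.1 z.2))%:E).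
Proof. exact/measurable_EFinP/measurable_sqmod/measurable_hker. Qed.

(** For fixed [q], the kernel is a line transform evaluated at lambda s + lambda q / 2. The affine
    substitution in [s] costs exactly [|lambda|]: this is the weight in the Plancherel formula. *)
Lemma integral_hker lambda : lambda != 0 ->
  (`|lambda|%:E * \int[leb]_s \int[leb]_q (sqmod (hker lambda s q))%:E =
   \int[leb2]_z (sqmod (hpsi lambda z.1 z.2))%:E)%E.
Proof.
move=> l0; have mk := measurable_hker_sqmod lambda.
have k0 (z : R * R) : (0 <= (sqmod (hker lambda z.1 z.2))%:E)%E by rewrite lee_fin sqmod_ge0.
have sw : (\int[leb]_s \int[leb]_q (sqmod (hker lambda s q))%:E =
    \int[leb]_q \int[leb]_s (sqmod (hker lambda s q))%:E)%E.
  exact: (@fubini_tonelli _ _ _ _ _ leb leb _ mk k0).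
rewrite sw.
pose G (q : R) : \bar R := (\int[leb]_s (sqmod (hker lambda s q))%:E)%E.
have mG : @measurable_fun _ _ (measurableTypeR R) _ setT G.
  exact: (@measurable_fun_fubini_tonelli_G _ _ _ _ _ leb _ mk k0).
have G0 q : (0 <= G q)%E by apply: integral_ge0 => s _; rewrite lee_fin sqmod_ge0.
transitivity (\int[leb]_q (`|lambda|%:E * G q))%E.
  by rewrite [RHS](@ge0_integralZl _ (measurableTypeR R) R leb setT measurableT G).
rewrite leb2_tonelli; first last.
- by move=> z; rewrite lee_fin sqmod_ge0.
- by apply/measurable_EFinP/measurable_sqmod; exact: measurable_hpsi2.
apply: eq_integral => q _ /=.
have bs := bs_hpsi lambda q.
have BN0 : 0 <= B * (2 * N) by rewrite !mulr_ge0.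
rewrite -(plancherel_line BN0 N0 bs).
pose S (x : R) : \bar R := (sqmod (ft (fun p => hpsi lambda p q) x))%:E.
have mS : measurable_fun setT S.
  by apply/measurable_EFinP/measurable_sqmod/measurable_ft; case: bs.
have S0 x : (0 <= S x)%E by rewrite lee_fin sqmod_ge0.
have GE : G q = (\int[leb]_s S (lambda * s + lambda * (q / 2))%R)%E.
  by apply: eq_integral => s _; rewrite /S /hker mulrDr.
rewrite GE; exact: (ge0_integral_affine (lambda * (q / 2)) l0 mS S0).
Qed.

Lemma integral_hpsi_fin lambda :
  (\int[leb2]_z (sqmod (hpsi lambda z.1 z.2))%:E < +oo)%E.
Proof.
have mc : measurable_fun setT (EFin \o chi N).
  by apply/measurable_EFinP; exact: measurable_chi.
have c0 x : (0 <= (EFin \o chi N) x)%E by rewrite lee_fin chi_ge0.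
pose C := (B * (2 * N)) ^+ 2.
apply: (@le_lt_trans _ _ (\int[leb2]_z (C%:E * ((chi N z.1)%:E * (chi N z.2)%:E)))%E).
  apply: ge0_le_integral => //.
  - by move=> z _; rewrite lee_fin sqmod_ge0.
  - by apply/measurable_EFinP/measurable_sqmod; exact: measurable_hpsi2.
  - apply: emeasurable_funM => //; apply: emeasurable_funM.
      exact: (measurableT_comp mc measurable_fst).
    exact: (measurableT_comp mc measurable_snd).
  move=> [p q] _; rewrite -!EFinM lee_fin /=.
  have [h|h] := pselect (- N <= q <= N); last first.
    by rewrite hpsi_q // sqmod0 !mulr_ge0 ?sqr_ge0 ?chi_ge0.
  have [h'|h'] := pselect (- N <= p <= N); last first.
    by rewrite (bs_supp (bs_hpsi lambda q)) // sqmod0 !mulr_ge0 ?sqr_ge0 ?chi_ge0.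
  by rewrite !chi1 // !mulr1; exact: (bs_bound (bs_hpsi lambda q)).
rewrite ge0_integralZl ?lee_fin ?sqr_ge0 //; first last.
- by move=> z _; rewrite -EFinM lee_fin mulr_ge0 ?chi_ge0.
- apply: emeasurable_funM; [exact: (measurableT_comp mc measurable_fst)|
    exact: (measurableT_comp mc measurable_snd)].
have := tonelli_prod leb leb mc mc c0 c0; rewrite !integral_chi //= => E.
rewrite (_ : (\int[leb2]_z _)%E = ((2 * N)%:E * (2 * N)%:E)%E); last by rewrite -E.
by rewrite -!EFinM ltry.
Qed.

Lemma measurable_hpsi_sqnorm : measurable_fun setT
  (fun lambda => \int[leb2]_z (sqmod (hpsi lambda z.1 z.2))%:E)%E.
Proof.
apply: (@measurable_fun_fubini_tonelli_F _ _ _ _ _ leb2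
  (fun z : R * (R * R) => (sqmod (hpsi z.1 z.2.1 z.2.2))%:E)).
  exact/measurable_EFinP/measurable_sqmod/measurable_hpsi3.
by move=> z; rewrite lee_fin sqmod_ge0.
Qed.

(** For fixed p and q this is the Plancherel formula on the line, in the central variable; Tonelli
    does the rest. *)
Lemma integral_hpsi_sqnorm :
  (\int[leb]_lambda \int[leb2]_z (sqmod (hpsi lambda z.1 z.2))%:E =
   \int[haar]_x (sqmod (phi x))%:E)%E.
Proof.
have m3 : measurable_fun setT (fun z : R * (R * R) => (sqmod (hpsi z.1 z.2.1 z.2.2))%:E).
  exact/measurable_EFinP/measurable_sqmod/measurable_hpsi3.
have p3 (z : R * (R * R)) : (0 <= (sqmod (hpsi z.1 z.2.1 z.2.2))%:E)%E.
  by rewrite lee_fin sqmod_ge0.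
have := @fubini_tonelli _ _ _ _ _ leb leb2 _ m3 p3 => /= ->.
rewrite haar_tonelli; first last.
- by move=> x; rewrite lee_fin sqmod_ge0.
- by apply/measurable_EFinP/measurable_sqmod; exact: (bx_meas bphi).
apply: eq_integral => -[p q] _ /=.
exact: (plancherel_line B0 N0 (bs_slice p q)).
Qed.

End BoxTransform.

(** * The operator with this kernel is the weak integral of the representation *)

Section BoxOperator.
Context {R : realType}.
Local Notation leb := (@lebesgue_measure R).
Context (B N : R) (B0 : 0 <= B) (N0 : 0 < N) (phi : heis R -> R[i]).
Hypothesis bphi : box B N phi.
Context (lambda : R) (l0 : lambda != 0).
Implicit Types (u v : L2real R).

Let pL := prehilb_L2 leb.
Let N0' : 0 <= N := ltW N0.
Let mkl := @measurable_hker R B N phi bphi lambda.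

(** Translated and conjugated so that the integral operator at [s] becomes [inner u (wker s)];
    Hilbert-Schmidt norms are then obtained from Parseval. *)
Definition wker (s : R) : L2real R := fun y => (hker phi lambda s (y - s))^*%C.

Lemma measurable_wker : cmeasurable setT (fun z : R * R => wker z.1 z.2).
Proof.
apply: cmeasurableJ; apply: (cmeasurable_comp mkl (g := fun z : R * R => (z.1, z.2 - z.1))).
by apply: measurable_fun_pair => //; apply: measurable_funB.
Qed.

Lemma sqnorm_wker s : vectors (L2real R) (wker s) /\
  ((sqnorm (wker s))%:E = \int[leb]_q (sqmod (hker phi lambda s q))%:E)%E.
Proof.
have bs := bs_hker N0 bphi lambda s.
have [vh _] := L2_bounded_support N0' bs.
have mw : cmeasurable setT (wker s).
  apply: (cmeasurable_comp measurable_wker (g := fun y : R => (s, y))).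
  exact: pair1_measurable.
have E : (\int[leb]_y (sqmod (wker s y))%:E = \int[leb]_q (sqmod (hker phi lambda s q))%:E)%E.
  have m0 : measurable_fun setT (fun q => (sqmod (hker phi lambda s q))%:E).
    by apply/measurable_EFinP/measurable_sqmod; case: bs.
  rewrite -(ge0_integral_translate (- s) m0); last by move=> x; rewrite lee_fin sqmod_ge0.
  by apply: eq_integral => y _; rewrite /wker sqmodJ.
have vw : vectors (L2real R) (wker s) by split=> //; rewrite E; case: vh.
by split=> //; rewrite -(sqnorm_L2E vw).
Qed.

Let vw s := (sqnorm_wker s).1.

Definition opf u : L2real R := fun s => inner u (wker s).

Lemma opfE u s : vectors (L2real R) u ->
  cint leb (fun q => hker phi lambda s q * u (s + q)) /\
  opf u s = cintegral leb (fun q => hker phi lambda s q * u (s + q)).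
Proof.
move=> vu; have ci := L2_cint vu (vw s).
have E q : u (s + q) * (wker s (s + q))^*%C = hker phi lambda s q * u (s + q).
  by rewrite /wker conjcK addrAC subrr add0r mulrC.
split; last first.
  transitivity (cintegral leb (fun x => u x * (wker s x)^*%C)) => //.
  have := @cintegral_affine R 1 s _ (oner_neq0 _) ci.
  rewrite normr1 rmorph1 mul1r => <-.
  by apply: eq_cintegral => q; rewrite mul1r -E [q + s]addrC.
have bs := bs_hker N0 bphi lambda s.
have [vh _] := L2_bounded_support N0' bs.
have vt : vectors (L2real R) (fun q => (u (s + q))^*%C).
  have mu' : cmeasurable setT (fun q => u (s + q)).
    by apply: (cmeasurable_comp (proj1 vu)); apply: measurable_funD.
  split; first exact: cmeasurableJ.
  have mS : measurable_fun setT (fun q => (sqmod (u q))%:E).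
    by apply/measurable_EFinP/measurable_sqmod; case: vu.
  have := ge0_integral_translate s mS => /(_ (fun x => _)) h.
  under eq_integral do rewrite sqmodJ addrC.
  by rewrite h ?(proj2 vu) // => x; rewrite lee_fin sqmod_ge0.
have := L2_cint vh vt; rewrite (_ : (fun x => _) = fun q => hker phi lambda s q * u (s + q)) //.
by apply/funext => q; rewrite conjcK.
Qed.

Lemma measurable_opf u : vectors (L2real R) u -> cmeasurable setT (opf u).
Proof.
move=> [mu' _]; apply: (@measurable_cintegral R _ _ _ _ leb
  (fun z : R * R => u z.2 * (wker z.1 z.2)^*%C)).
apply: cmeasurableM; first exact: (cmeasurable_comp mu' measurable_snd).
exact/cmeasurableJ/measurable_wker.
Qed.

Lemma integral_wker : (`|lambda|%:E * \int[leb]_s (sqnorm (wker s))%:E =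
  \int[leb2]_z (sqmod (hpsi phi lambda z.1 z.2))%:E)%E.
Proof.
rewrite -(integral_hker B0 N0 bphi l0); congr (_ * _)%E.
by apply: eq_integral => s _; rewrite (sqnorm_wker s).2.
Qed.

Lemma measurable_wker_sqnorm : measurable_fun setT (fun s => (sqnorm (wker s))%:E).
Proof.
rewrite (_ : (fun s => _) = fun s => (\int[leb]_q (sqmod (hker phi lambda s q))%:E)%E).
  apply: (@measurable_fun_fubini_tonelli_F _ _ _ _ _ leb
    (fun z : R * R => (sqmod (hker phi lambda z.1 z.2))%:E)).
    exact: (measurable_hker_sqmod bphi).
  by move=> z; rewrite lee_fin sqmod_ge0.
by apply/funext => s; rewrite (sqnorm_wker s).2.
Qed.

Lemma integral_wker_fin : (\int[leb]_s (sqnorm (wker s))%:E < +oo)%E.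
Proof.
have := integral_hpsi_fin B0 N0 bphi lambda; rewrite -integral_wker.
have : (0 <= \int[leb]_s (sqnorm (wker s))%:E)%E.
  by apply: integral_ge0 => s _; rewrite lee_fin (sqnorm_ge0 pL (vw s)).
(* Were the integral infinite, its product with the nonzero [|lambda|] would be infinite too. *)
case: (\int[leb]_s _)%E => [r _ _|_|//]; first by rewrite ltry.
by rewrite mulry gtr0_sg ?normr_gt0 // mul1e.
Qed.

Lemma vec_opf u : vectors (L2real R) u -> vectors (L2real R) (opf u).
Proof.
move=> vu; have mo := measurable_opf vu; split=> //.
have mw := measurable_wker_sqnorm.
apply: (@le_lt_trans _ _ (\int[leb]_s ((sqnorm u)%:E * (sqnorm (wker s))%:E))%E).
  apply: ge0_le_integral => //.
  - by move=> s _; rewrite lee_fin sqmod_ge0.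
  - exact/measurable_EFinP/measurable_sqmod.
  - exact: emeasurable_funM.
  by move=> s _; rewrite -EFinM lee_fin; exact: (CauchySchwarz pL vu (vw s)).
rewrite ge0_integralZl ?lee_fin ?(sqnorm_ge0 pL) //; last first.
  by move=> s _; rewrite lee_fin (sqnorm_ge0 pL (vw s)).
have := integral_wker_fin; have : (0 <= \int[leb]_s (sqnorm (wker s))%:E)%E.
  by apply: integral_ge0 => s _; rewrite lee_fin (sqnorm_ge0 pL (vw s)).
by case: (\int[leb]_s _)%E => // r _ _; rewrite -EFinM ltry.
Qed.

Definition kerK u (x : heis R) (s : R) : R[i] := phi x * schrodinger (2 * pi * lambda) x u s.

Lemma measurable_kerK u : vectors (L2real R) u ->
  cmeasurable setT (fun z : heis R * R => kerK u z.1 z.2).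
Proof.
move=> [mu' _].
have mp : measurable_fun setT (fun z : heis R * R => z.1.1.1).
  exact: (measurableT_comp measurable_hp measurable_fst).
have mq : measurable_fun setT (fun z : heis R * R => z.1.1.2).
  exact: (measurableT_comp measurable_hq measurable_fst).
have mt : measurable_fun setT (fun z : heis R * R => z.1.2).
  exact: (measurableT_comp measurable_ht measurable_fst).
apply: cmeasurableM; first exact: (cmeasurable_comp (bx_meas bphi) measurable_fst).
rewrite (_ : (fun z : heis R * R => _) = fun z : heis R * R =>
  cis (2 * pi * lambda * z.1.2) *
  cis (2 * pi * lambda * (z.1.1.1 * z.2 + 2^-1 * (z.1.1.1 * z.1.1.2))) * u (z.2 + z.1.1.2));
  last by apply/funext => -[[[p q] t] s].
apply: cmeasurableM; first apply: cmeasurableM.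
- by apply: measurable_cis; apply: measurable_funM.
- apply: measurable_cis; apply: measurable_funM => //; apply: measurable_funD.
    exact: measurable_funM.
  by apply: measurable_funM => //; apply: measurable_funM.
- by apply: (cmeasurable_comp mu'); apply: measurable_funD.
Qed.

Lemma sqmod_kerK u x s :
  sqmod (kerK u x s) <= B ^+ 2 * box1 N x ^+ 2 * sqmod (u (s + x.1.2)).
Proof.
rewrite /kerK; case: x => [[p q] t]; rewrite !sqmodM !sqmod_cis !mul1r /=.
by apply: ler_wpM2r; [exact: sqmod_ge0|exact: (box_bound_box1 (p, q, t) bphi)].
Qed.

(** The dominating function B box1 (1 + |u|^2) relies on |u| <= 1 + |u|^2: the constant is
    integrable on the box, and |u|^2 is integrable in q after translation by [s]. Every [s] is
    covered, not almost every one. *)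
Lemma cint_kerK u s : vectors (L2real R) u -> cint hm (fun x => kerK u x s).
Proof.
move=> vu; have mK := measurable_kerK vu.
have E3 (a b c : R) : (a * b * c) ^+ 2 = a ^+ 2 * b ^+ 2 * c ^+ 2 by rewrite !exprMn.
pose h (x : heis R) := B * box1 N x * (1 + sqmod (u (s + x.1.2))).
have mS : measurable_fun setT (fun y : R => sqmod (u (s + y))).
  by apply: measurable_sqmod; apply: (cmeasurable_comp (proj1 vu)); apply: measurable_funD.
have ch0 (a : R) : 0 <= sqmod (u (s + a)) by exact: sqmod_ge0.
have mh : measurable_fun setT h.
  apply: measurable_funM; first by apply: measurable_funM => //; exact: measurable_box1.
  by apply: measurable_funD => //; exact: (measurableT_comp mS measurable_hq).
apply: (@cint_le _ _ _ hm _ h) => //.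
- by apply: (cmeasurable_comp mK (g := fun x : heis R => (x, s))); exact: pair2_measurable.
- move=> x; apply: le_trans (sqmod_kerK u x s) _; rewrite /h (E3 B).
  apply: ler_wpM2l; first by rewrite mulr_ge0 ?sqr_ge0.
  by have := ch0 x.1.2; move: (sqmod _) => a a0; rewrite expr2; nra.
- by move=> x; apply: mulr_ge0; [exact: mulr_ge0 (box1_ge0 _ _)|exact: addr_ge0].
have mc : measurable_fun setT (EFin \o chi N) by apply/measurable_EFinP; exact: measurable_chi.
have mb : measurable_fun setT (fun y : R => (chi N y * (1 + sqmod (u (s + y))))%:E).
  by apply/measurable_EFinP/measurable_funM; [exact: measurable_chi|exact: measurable_funD].
have c0 x : (0 <= (EFin \o chi N) x)%E by rewrite lee_fin chi_ge0.
have b0 y : (0 <= (chi N y * (1 + sqmod (u (s + y))))%:E)%E.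
  by rewrite lee_fin; apply: mulr_ge0; [exact: chi_ge0|exact: addr_ge0].
have bf : (\int[leb]_y (chi N y * (1 + sqmod (u (s + y))))%:E < +oo)%E.
  apply: (@le_lt_trans _ _ (\int[leb]_y ((chi N y)%:E + (sqmod (u (s + y)))%:E))%E).
    apply: ge0_le_integral => //.
    - by apply: emeasurable_funD => //; exact/measurable_EFinP.
    move=> y _; rewrite -EFinD lee_fin mulrDr mulr1 lerD2l /chi indicE.
    by case: (_ \in _); rewrite ?mul1r ?mul0r.
  rewrite ge0_integralD //; first last.
  - exact/measurable_EFinP.
  - by move=> y _; rewrite lee_fin ch0.
  - by move=> y _; rewrite lee_fin chi_ge0.
  rewrite integral_chi // lte_add_pinfty ?ltry //.
  have mS' : measurable_fun setT (fun q => (sqmod (u q))%:E).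
    by apply/measurable_EFinP/measurable_sqmod; case: vu.
  have := ge0_integral_translate s mS' => h'.
  under eq_integral do rewrite addrC.
  by rewrite h' ?(proj2 vu) // => x; rewrite lee_fin sqmod_ge0.
rewrite (_ : (\int[hm]_x (h x)%:E)%E = (\int[hm]_x (B%:E * ((EFin \o chi N) x.1.1 *
    (chi N x.1.2 * (1 + sqmod (u (s + x.1.2))))%:E * (EFin \o chi N) x.2)))%E); last first.
  by apply: eq_integral => x _; rewrite /h /box1 /= -!EFinM; congr EFin; ring.
rewrite ge0_integralZl //; first last.
- by move=> x _; rewrite !mule_ge0.
- apply: emeasurable_funM; first apply: emeasurable_funM.
  + exact: (measurableT_comp mc measurable_hp).
  + exact: (measurableT_comp mb measurable_hq).
  + exact: (measurableT_comp mc measurable_ht).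
have := haar_prod mc mb mc c0 b0 c0 => E.
rewrite (_ : (\int[hm]_x _)%E = (\int[leb]_x (EFin \o chi N) x *
  \int[leb]_y (chi N y * (1 + sqmod (u (s + y))))%:E * \int[leb]_x (EFin \o chi N) x)%E); last first.
  by rewrite -E.
rewrite !integral_chi //.
have : (0 <= \int[leb]_y (chi N y * (1 + sqmod (u (s + y))))%:E)%E.
  by apply: integral_ge0.
by case: (\int[leb]_y _)%E bf => // r _ _; rewrite -!EFinM ltry.
Qed.

Lemma cintegral_kerK u s : vectors (L2real R) u ->
  cintegral hm (fun x => kerK u x s) = opf u s.
Proof.
move=> vu; have ci := cint_kerK s vu.
rewrite (opfE s vu).2.
pose c p q := cis (2 * pi * lambda * (p * s + 2^-1 * (p * q))) * u (s + q).
have Et z : cintegral leb (fun t => kerK u (z, t) s) = hpsi phi lambda z.1 z.2 * c z.1 z.2.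
  case: z => p q; rewrite /hpsi /ft -cintegralZr; last exact: (cint_ft _ B0 (bs_slice bphi p q)).
  by apply: eq_cintegral => t; rewrite /kerK /= !mulrA.
have [ci2 <-] := cfubini1 ci.
have Et' : (fun z => cintegral leb (fun t => kerK u (z, t) s)) =
    fun z => hpsi phi lambda z.1 z.2 * c z.1 z.2 by apply/funext.
rewrite Et' in ci2 *.
have [_ <-] := cfubini2 ci2.
apply: eq_cintegral => q; rewrite /hker /ft -cintegralZr; last first.
  by apply: cint_ft (bs_hpsi N0 bphi lambda q); rewrite !mulr_ge0.
apply: eq_cintegral => p; by rewrite /c /= mulrA; congr (_ * cis _ * _); field.
Qed.

Definition kerG u v (z : heis R * R) : R[i] := kerK u z.1 z.2 * (v z.2)^*%C.

(** Here |u v| <= |u|^2 + |v|^2. Integration over the line first removes the shift by q, by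
    translation invariance, and the box has finite volume. *)
Lemma cint_kerG u v : vectors (L2real R) u -> vectors (L2real R) v ->
  cint (hm \x leb)%E (kerG u v).
Proof.
move=> vu vv.
have E3 (a b c : R) : (a * b * c) ^+ 2 = a ^+ 2 * b ^+ 2 * c ^+ 2 by rewrite !exprMn.
pose h (z : heis R * R) := B * box1 N z.1 * (sqmod (u (z.2 + z.1.1.2)) + sqmod (v z.2)).
have mq : measurable_fun setT (fun z : heis R * R => z.1.1.2).
  exact: (measurableT_comp measurable_hq measurable_fst).
have mU : measurable_fun setT (fun z : heis R * R => sqmod (u (z.2 + z.1.1.2))).
  by apply: measurable_sqmod; apply: (cmeasurable_comp (proj1 vu)); apply: measurable_funD.
have mV : measurable_fun setT (fun y : R => sqmod (v y)) by apply: measurable_sqmod; case: vv.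
have mV' : measurable_fun setT (fun z : heis R * R => sqmod (v z.2)).
  exact: (measurableT_comp mV measurable_snd).
have mb : measurable_fun setT (fun z : heis R * R => box1 N z.1).
  exact: (measurableT_comp (measurable_box1 N) measurable_fst).
have mh : measurable_fun setT h.
  by apply: measurable_funM; [exact: measurable_funM|exact: measurable_funD].
have h0 z : 0 <= h z.
  by apply: mulr_ge0; [exact: mulr_ge0 (box1_ge0 _ _)|apply: addr_ge0; exact: sqmod_ge0].
apply: (@cint_le _ _ _ (hm \x leb)%E _ h) => //.
- apply: cmeasurableM; first exact: measurable_kerK.
  by apply: cmeasurableJ; apply: (cmeasurable_comp (proj1 vv)).
- move=> z; rewrite /kerG sqmodM sqmodJ.
  apply: (@le_trans _ _ (B ^+ 2 * box1 N z.1 ^+ 2 * sqmod (u (z.2 + z.1.1.2)) * sqmod (v z.2))).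
    by apply: ler_wpM2r; [exact: sqmod_ge0|exact: sqmod_kerK].
  rewrite /h (E3 B) -mulrA; apply: ler_wpM2l; first by rewrite mulr_ge0 ?sqr_ge0.
  have := sqmod_ge0 (u (z.2 + z.1.1.2)); have := sqmod_ge0 (v z.2).
  by move: (sqmod _) (sqmod _) => a b a0 b0; rewrite expr2; nra.
have h0' z : (0 <= (h z)%:E)%E by rewrite lee_fin.
have mhE : measurable_fun setT (EFin \o h) by exact/measurable_EFinP.
have -> : (\int[(hm \x leb)%E]_z (h z)%:E =
    \int[hm]_x \int[leb]_s (h (x, s))%:E)%E by exact: (@fubini_tonelli1 _ _ _ _ _ hm leb _ mhE h0').
pose C := sqnorm u + sqnorm v.
have C0 : 0 <= C by rewrite addr_ge0 // (sqnorm_ge0 pL).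
rewrite (_ : (\int[hm]_x _)%E = (\int[hm]_x ((B * C)%:E * (box1 N x)%:E))%E); last first.
  apply: eq_integral => x _.
  rewrite (_ : (\int[leb]_s _)%E = (\int[leb]_s ((B * box1 N x)%:E *
     ((sqmod (u (s + x.1.2)))%:E + (sqmod (v s))%:E)))%E); last first.
    by apply: eq_integral => s _; rewrite -EFinD -EFinM.
  have mS : measurable_fun setT (fun s => (sqmod (u s))%:E).
    by apply/measurable_EFinP/measurable_sqmod; case: vu.
  have mS' : measurable_fun setT (fun s : R => (sqmod (u (s + x.1.2)))%:E).
    by apply: (measurableT_comp mS); apply: measurable_funD.
  have mVE : measurable_fun setT (fun s => (sqmod (v s))%:E) by exact/measurable_EFinP.
  rewrite ge0_integralZl ?lee_fin ?mulr_ge0 ?box1_ge0 //; first last.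
  - by move=> s _; rewrite -EFinD lee_fin addr_ge0 ?sqmod_ge0.
  - exact: emeasurable_funD.
  rewrite ge0_integralD //; last 2 first.
  - by move=> s _; rewrite lee_fin sqmod_ge0.
  - by move=> s _; rewrite lee_fin sqmod_ge0.
  rewrite (ge0_integral_translate x.1.2 mS) => [|y]; last by rewrite lee_fin sqmod_ge0.
  rewrite (sqnorm_L2E vu) (sqnorm_L2E vv) -EFinD -!EFinM; congr EFin; rewrite /C; ring.
rewrite ge0_integralZl ?lee_fin ?mulr_ge0 //; first last.
- by move=> x _; rewrite lee_fin box1_ge0.
- by apply/measurable_EFinP; exact: measurable_box1.
by rewrite integral_box1 // -EFinM ltry.
Qed.

(** Fubini moves the integral over the line to the outside, and the integral over the group is then
    [opf u s]. *)
Lemma weak_integral_opf u v : vectors (L2real R) u -> vectors (L2real R) v ->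
  cintegral haar (fun x => @inner R (L2real R) (phi x *: schrodinger (2 * pi * lambda) x u) v) =
  inner (opf u) v.
Proof.
move=> vu vv; have ci := cint_kerG vu vv.
have [_ E1] := cfubini1 ci; have [_ E2] := cfubini2 ci.
transitivity (cintegral hm (fun x => cintegral leb (fun s => kerG u v (x, s)))).
  by apply: eq_cintegral => x; apply: eq_cintegral => s.
rewrite E1 -E2; apply: eq_cintegral => s.
by rewrite /kerG /= cintegralZr ?cintegral_kerK //; exact: cint_kerK.
Qed.

End BoxOperator.

Section AlmostEverywhere.
Context {R : realType} d (T : measurableType d) (mu : {measure set T -> \bar R}).
Implicit Types P Q : T -> Prop.

Lemma aeT P : (forall x, P x) -> {ae mu, forall x, P x}.
Proof.
move=> h; exists set0; split; [exact: measurable0|exact: measure0|].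
by move=> x /= /(_ (h x)).
Qed.

Lemma ae_imply P Q : (forall x, P x -> Q x) -> {ae mu, forall x, P x} -> {ae mu, forall x, Q x}.
Proof. by move=> PQ; apply: negligibleS => x /= nQ p; exact/nQ/PQ. Qed.

Lemma ae_and P Q : {ae mu, forall x, P x} -> {ae mu, forall x, Q x} ->
  {ae mu, forall x, P x /\ Q x}.
Proof.
move=> hP hQ; apply: negligibleS (negligibleU hP hQ) => x /= nPQ.
by have [p|np] := pselect (P x); [right=> q; exact: nPQ|left].
Qed.

Lemma ae_all (P_ : nat -> T -> Prop) : (forall n, {ae mu, forall x, P_ n x}) ->
  {ae mu, forall x, forall n, P_ n x}.
Proof.
move=> h; apply: negligibleS (negligible_bigcup h) => x /= /existsNP[n nP].
by exists n.
Qed.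

End AlmostEverywhere.

(** * Measurable fields of Hilbert-Schmidt operators and their norm *)

Section OperatorFields.
Context {R : realType} (e : nat -> L2real R) (eb : orthonormal_basis e).
Local Notation leb := (@lebesgue_measure R).
Implicit Types (u v w : L2real R) (A : HS e) (G : R -> HS e).

Let pL := prehilb_L2 leb.

Lemma vec_basis n : vectors (L2real R) (e n). Proof. by case: eb. Qed.

Lemma basis_parseval w : vectors (L2real R) w ->
  (\esum_(n in setT) (sqmod (inner w (e n)))%:E = (sqnorm w)%:E)%E.
Proof. by case: eb => ve oe ce vw; apply: (parseval pL ve oe); exact: ce. Qed.

Lemma hs_sqnormE A : (forall n, vectors (L2real R) (A (e n))) ->
  hs_sqnorm e A =
  (\esum_(n in setT) \esum_(m in setT) (sqmod (inner (A (e n)) (e m)))%:E)%E.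
Proof. by move=> vA; apply: eq_esum => n _; rewrite basis_parseval. Qed.

Let pHS : prehilb (HS e) := prehilb_HS pL vec_basis.

(** Weakly measurable, with Hilbert-Schmidt values at every frequency rather than almost every one,
    so that combinations of fields need no exceptional set. *)
Record hs_field G : Prop := HSField {
  hf_vec : forall lambda, vectors (HS e) (G lambda);
  hf_meas : forall u v, vectors (L2real R) u -> vectors (L2real R) v ->
    cmeasurable setT (fun lambda => inner (G lambda u) v) }.

Lemma vec_HS_basis A n : vectors (HS e) A -> vectors (L2real R) (A (e n)).
Proof. by move=> [[h _ _] _]; apply/h/vec_basis. Qed.

(** Parseval for each [G lambda (e n)] expresses the norm by countably many matrix coefficients,
    which weak measurability controls. *)
Lemma measurable_hs G : hs_field G -> measurable_fun setT (fun lambda => hs_sqnorm e (G lambda)).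
Proof.
move=> [vG mG].
rewrite (_ : (fun _ => _) = fun lambda => (\esum_(n in setT) \esum_(m in setT)
    (sqmod (inner (G lambda (e n)) (e m)))%:E)%E); last first.
  by apply/funext => x; apply: hs_sqnormE => n; exact: vec_HS_basis.
have cN : countable [set: nat] by exact: countableP.
apply: measurable_esum => // [n x _|n _].
  by apply: esum_ge0 => m _; rewrite lee_fin sqmod_ge0.
apply: measurable_esum => // [m x _|m _]; first by rewrite lee_fin sqmod_ge0.
by apply/measurable_EFinP/measurable_sqmod/mG; exact: vec_basis.
Qed.

Lemma measurable_hf_sqnorm G : hs_field G -> measurable_fun setT (fun lambda => sqnorm (G lambda)).
Proof.
move=> hG; apply/measurable_EFinP; rewrite (_ : _ \o _ = fun lambda => hs_sqnorm e (G lambda)).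
  exact: measurable_hs.
by apply/funext => x /=; rewrite (sqnorm_HSE pL vec_basis) //; exact: hf_vec.
Qed.

Lemma hs_fieldP (c : R -> R[i]) G1 G2 : cmeasurable setT c -> hs_field G1 -> hs_field G2 ->
  hs_field (fun lambda => c lambda *: G1 lambda + G2 lambda).
Proof.
move=> mc [v1 m1] [v2 m2]; split=> [x|u v vu vv]; first exact: (vectorsP pHS).
rewrite (_ : (fun _ => _) = fun x => c x * inner (G1 x u) v + inner (G2 x u) v).
  by apply: cmeasurableD; [apply: cmeasurableM => //; exact: m1|exact: m2].
apply/funext => x; rewrite -(innerP pL) //.
  by case: (v1 x) => -[h _ _] _; exact: h.
by case: (v2 x) => -[h _ _] _; exact: h.
Qed.

Definition fnorm G : \bar R := (\int[leb]_lambda (hs_sqnorm e (G lambda) * `|lambda|%:E))%E.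

End OperatorFields.

Section BoxPlancherel.
Context {R : realType} (e : nat -> L2real R) (eb : orthonormal_basis e).
Local Notation leb := (@lebesgue_measure R).
Context (B N : R) (B0 : 0 <= B) (N0 : 0 < N) (phi : heis R -> R[i]).
Hypothesis bphi : box B N phi.

Let pL := prehilb_L2 leb.

Lemma box_L2 : vectors (L2heis R) phi.
Proof.
split; first exact: bx_meas bphi.
have mb := measurable_box1 N.
apply: (@le_lt_trans _ _ (\int[hm]_x ((B ^+ 2)%:E * (box1 N x)%:E))%E).
  apply: (@ge0_le_integral _ _ _ hm setT) => //.
  - by move=> x _; rewrite lee_fin sqmod_ge0.
  - exact/measurable_EFinP/measurable_sqmod/(bx_meas bphi).
  - by apply: emeasurable_funM => //; exact/measurable_EFinP.
  move=> x _; rewrite -EFinM lee_fin; apply: le_trans (box_bound_box1 x bphi) _.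
  by apply: ler_wpM2l; rewrite ?sqr_ge0 // /box1 !exprMn !chi_sqr.
rewrite ge0_integralZl ?lee_fin ?sqr_ge0 //; first last.
- by move=> x _; rewrite lee_fin box1_ge0.
- exact/measurable_EFinP.
by rewrite integral_box1 ?ltW // -EFinM ltry.
Qed.

Lemma box_cintegrable : cintegrable haar phi.
Proof.
split; first exact: bx_meas bphi.
have mb := measurable_box1 N.
apply: (@le_lt_trans _ _ (\int[hm]_x (B%:E * (box1 N x)%:E))%E).
  apply: (@ge0_le_integral _ _ _ hm setT) => //.
  - apply/measurable_EFinP; have ms : measurable_fun setT (@Num.sqrt R).
      by apply: continuous_measurable_fun; exact: sqrt_continuous.
    exact: (measurableT_comp ms (measurable_sqmod (bx_meas bphi))).
  - by apply: emeasurable_funM => //; exact/measurable_EFinP.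
  move=> x _; rewrite -EFinM lee_fin.
  have b0 : 0 <= B * box1 N x by exact: mulr_ge0 (box1_ge0 _ _).
  rewrite -(ger0_norm b0) -sqrtr_sqr ler_wsqrtr // exprMn.
  exact: (box_bound_box1 x bphi).
rewrite ge0_integralZl ?lee_fin //; first last.
- by move=> x _; rewrite lee_fin box1_ge0.
- exact/measurable_EFinP.
by rewrite integral_box1 ?ltW // -EFinM ltry.
Qed.

(** Parseval is used twice. [A (e n)] and the integral operator at [e n] have the same coefficients,
    so the norm is a sum over n of integrals of |<e n, wker s>|^2; summed under the integral, these
    give the squared norm of [wker s]. *)
Lemma hs_box (lambda : R) (A : HS e) : lambda != 0 ->
  weak_integral haar (fun x u => phi x *: schrodinger (2 * pi * lambda) x u) A ->
  (hs_sqnorm e A * `|lambda|%:E = \int[leb2]_z (sqmod (hpsi phi lambda z.1 z.2))%:E)%E.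
Proof.
move=> l0 [[vA _ _] iA]; rewrite -(integral_wker B0 N0 bphi l0) muleC; congr (_ * _)%E.
have ve := vec_basis eb.
have vw s := (sqnorm_wker N0 bphi lambda s).1.
have cN : countable [set: nat] by exact: countableP.
transitivity (\esum_(n in setT) \int[leb]_s (sqmod (opf phi lambda (e n) s))%:E)%E.
  apply: eq_esum => n _; have vo := vec_opf B0 N0 bphi l0 (ve n).
  rewrite (sqnorm_L2E vo) -!(basis_parseval eb) //; last exact/vA.
  by apply: eq_esum => m _; rewrite iA // (weak_integral_opf B0 N0 bphi).
rewrite -integral_esum //; first last.
- by move=> n _; apply/measurable_EFinP/measurable_sqmod; exact: (measurable_opf bphi _ (ve n)).
- by move=> n x _; rewrite lee_fin sqmod_ge0.
apply: eq_integral => s _; rewrite -(basis_parseval eb) //; apply: eq_esum => n _.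
by rewrite (innerC pL (ve n) (vw s)) sqmodJ.
Qed.

Lemma fnorm_box (G : R -> HS e) : hs_field G ->
  {ae leb, forall lambda : R, lambda != 0 -> weak_integral haar
     (fun x u => phi x *: schrodinger (2 * pi * lambda) x u) (G lambda)} ->
  fnorm G = (\int[haar]_x (sqmod (phi x))%:E)%E.
Proof.
move=> hG aeG; rewrite -(integral_hpsi_sqnorm B0 N0 bphi).
apply: ae_eq_integral => //.
- by apply: emeasurable_funM; [exact: (measurable_hs eb)|apply/measurable_EFinP; exact: normr_measurable].
- exact: (measurable_hpsi_sqnorm bphi).
have a0 : {ae leb, forall lambda : R, lambda != 0}.
  exists [set 0]; split => //; first exact: lebesgue_measure_set1.
  by move=> x /= /negP; rewrite negbK => /eqP.
by apply: ae_imply (ae_and aeG a0) => x [hx x0] _; apply: hs_box => //; exact: hx.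
Qed.

End BoxPlancherel.

(** With the first factor close to 1, squared norms can be passed to a limit without square
    roots. *)
Lemma sqnormD_eps (R : realType) (H : hspace R) (pH : prehilb H) (u v : H) (eps : R) :
  vectors H u -> vectors H v -> 0 < eps ->
  sqnorm (u + v) <= (1 + eps) * sqnorm u + (1 + eps^-1) * sqnorm v.
Proof.
move=> vu vv e0; have := CauchySchwarz pH vu vv; have := sqr_Re_le (inner u v).
rewrite sqnormD //; have := sqnorm_ge0 pH vu; have := sqnorm_ge0 pH vv.
move: (sqnorm u) (sqnorm v) (complex.Re _) (sqmod _) => a b r m b0 a0 rm ma.
(* AM-GM: [2 r <= eps a + b / eps] because [r^2 <= a b]. *)
suff : 2 * r <= eps * a + eps^-1 * b by move=> h; nra.
have s0 : 0 <= eps * a + eps^-1 * b by rewrite addr_ge0 // mulr_ge0 // ?invr_ge0 ltW.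
have [r0|r0] := leP r 0; first by apply: le_trans s0; lra.
rewrite -(@ler_pXn2r _ 2) ?nnegrE ?mulr_ge0 ?(ltW r0) //.
have E : eps * eps^-1 = 1 by rewrite divff ?gt_eqF.
apply: (@le_trans _ _ (4 * (a * b))); first by rewrite exprMn -natrX; lra.
have -> : (eps * a + eps^-1 * b) ^+ 2 =
    4 * (a * b) * (eps * eps^-1) + (eps * a - eps^-1 * b) ^+ 2 by ring.
by rewrite E mulr1 lerDl sqr_ge0.
Qed.

Section Defects.
Context {R : realType} (H : hspace R) (pH : prehilb H).
Implicit Types p q y z : H.

Lemma sqnorm_comb_le (a : R[i]) x1 x2 y1 y2 :
  vectors H x1 -> vectors H x2 -> vectors H y1 -> vectors H y2 ->
  sqnorm (a *: y1 + y2 - (a *: x1 + x2)) <=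
  2 * sqmod a * sqnorm (y1 - x1) + 2 * sqnorm (y2 - x2).
Proof.
move=> vx1 vx2 vy1 vy2; have v1 := vectorsB pH vy1 vx1; have v2 := vectorsB pH vy2 vx2.
rewrite opprD addrACA -scalerBr -mulrA -(sqnormZ pH a v1) -mulrDr.
exact: (sqnormD_le pH (vectorsZ pH a v1) v2).
Qed.

(** Meant for an identity q = y between approximants, known up to a null vector: when q tends to p
    and y to z, the difference p - z becomes null. *)
Lemma sqnorm_defect p q y z : vectors H p -> vectors H q -> vectors H y -> vectors H z ->
  sqnorm (q - y) = 0 -> sqnorm (p - z) <= 2 * sqnorm (q - p) + 2 * sqnorm (y - z).
Proof.
move=> vp vq vy vz h; have v1 := vectorsB pH vq vp; have v2 := vectorsB pH vy vz.
have vw := vectorsB pH vp vz.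
have E : p - z - (y - z - (q - p)) = q - y.
  by rewrite opprB addrCA opprB [p - z + _]addrA subrK addrA subrK.
rewrite -E in h; rewrite (sqnorm_congr pH vw (vectorsB pH v2 v1) h).
by rewrite -mulrDr [sqnorm (q - p) + _]addrC -(sqnormN pH v1) (sqnormD_le pH) //; exact: vectorsN.
Qed.

End Defects.

(** * Approximation by box functions, and limits of fields *)

Section Truncation.
Context {R : realType}.
Implicit Types phi : L2heis R.

Definition trunc (n : nat) phi : L2heis R := fun x =>
  (if (sqmod (phi x) <= n.+1%:R ^+ 2) && (box1 n.+1%:R x == 1) then 1 else 0)%:C%C * phi x.

Lemma trunc_box n phi : cmeasurable setT phi -> box n.+1%:R n.+1%:R (trunc n phi).
Proof.
move=> mphi.
have out x : box1 n.+1%:R x != 1 -> trunc n phi x = 0.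
  by move=> /negPf h; rewrite /trunc h andbF mul0r.
split=> [|x|x h|x h|x h].
- apply: cmeasurableM => //; apply: cmeasurable_real; apply: measurable_fun_ifT => //.
  apply: measurable_and.
    by apply: measurable_fun_ler => //; exact: measurable_sqmod.
  by apply: measurable_fun_eqr => //; exact: measurable_box1.
- rewrite /trunc; case: ifP => [/andP[h _]|_]; first by rewrite mul1r.
  by rewrite mul0r sqmod0 sqr_ge0.
- by apply: out; rewrite /box1 chi0 // !mul0r eq_sym oner_eq0.
- by apply: out; rewrite /box1 [X in _ * X * _]chi0 // mulr0 mul0r eq_sym oner_eq0.
- by apply: out; rewrite /box1 [X in _ * X]chi0 // mulr0 eq_sym oner_eq0.
Qed.

Lemma trunc_eventually phi x : \forall n \near \oo, trunc n phi x = phi x.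
Proof.
pose M := `|x.1.1| + `|x.1.2| + `|x.2| + sqmod (phi x).
have p1 := normr_ge0 x.1.1; have p2 := normr_ge0 x.1.2; have p3 := normr_ge0 x.2.
have p4 := sqmod_ge0 (phi x).
have M0 : 0 <= M by rewrite /M; lra.
have [k kM] : exists k : nat, M < k%:R by exists (Num.bound M); exact: archi_boundP.
near=> n; have nM : M <= n.+1%:R.
  apply: le_trans (ltW kM) _; rewrite ler_nat; apply: leqW; near: n; exact: nbhs_infty_ge.
have n1 : 1 <= n.+1%:R :> R by rewrite ler1n.
rewrite /trunc (_ : sqmod _ <= _ = true); last first.
  apply/idP; apply: (@le_trans _ _ n.+1%:R); first by apply: le_trans nM; rewrite /M; lra.
  by rewrite expr2 ler_peMr.
have hx (y : R) : `|y| <= M -> - n.+1%:R <= y <= n.+1%:R.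
  by move=> h; rewrite -ler_norml; exact: le_trans nM.
rewrite /box1 !chi1 ?mulr1 ?eqxx ?mul1r //; apply: hx; rewrite /M; lra.
Unshelve. all: by end_near. Qed.

Lemma trunc_cvg phi : vectors (L2heis R) phi ->
  sqnorm (trunc n phi - phi) @[n --> \oo] --> (0 : R).
Proof.
move=> vphi; have [mphi _] := vphi.
have le n x : sqmod (trunc n phi x - phi x) <= sqmod (phi x).
  rewrite /trunc; case: ifP => _; first by rewrite mul1r subrr sqmod0 sqmod_ge0.
  by rewrite mul0r sub0r sqmodN.
apply: (@L2_dominated _ _ _ haar _ _ (fun x => sqmod (phi x))) => //.
- move=> n; have := trunc_box n mphi; exact: box_L2.
- exact: L2_sqmod.
move=> x; apply: cvg_near_cst; near=> n.
by rewrite (_ : trunc n phi x = phi x) ?subrr ?sqmod0 //; near: n; exact: trunc_eventually.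
Unshelve. all: by end_near. Qed.

End Truncation.

Lemma ae_le_integral_comb d (T : measurableType d) (R : realType)
    (mu : {measure set T -> \bar R}) (a b : R) (f f1 f2 : T -> R) :
  0 <= a -> 0 <= b ->
  (forall x, 0 <= f x) -> (forall x, 0 <= f1 x) -> (forall x, 0 <= f2 x) ->
  measurable_fun setT f -> measurable_fun setT f1 -> measurable_fun setT f2 ->
  {ae mu, forall x, f x <= a * f1 x + b * f2 x} ->
  (\int[mu]_x (f x)%:E <= a%:E * \int[mu]_x (f1 x)%:E + b%:E * \int[mu]_x (f2 x)%:E)%E.
Proof.
move=> a0 b0 p p1 p2 /measurable_EFinP m /measurable_EFinP m1 /measurable_EFinP m2 ae.
rewrite -!ge0_integralZl //; try by move=> x _; rewrite lee_fin.
rewrite -ge0_integralD //; first last.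
- exact: emeasurable_funM.
- by move=> x _; rewrite -EFinM lee_fin mulr_ge0.
- exact: emeasurable_funM.
- by move=> x _; rewrite -EFinM lee_fin mulr_ge0.
apply: ae_ge0_le_integral => //.
- by move=> x _; rewrite lee_fin.
- by move=> x _; rewrite -!EFinM -EFinD lee_fin addr_ge0 // mulr_ge0.
- by apply: emeasurable_funD; exact: emeasurable_funM.
by apply: ae_imply ae => x hx _; rewrite -!EFinM -EFinD lee_fin.
Qed.

Section FieldNorm.
Context {R : realType} (e : nat -> L2real R) (eb : orthonormal_basis e).
Local Notation leb := (@lebesgue_measure R).
Implicit Types (G : R -> HS e).
Local Notation field := (@hs_field R e).

Let pL := prehilb_L2 leb.
Let pHS : prehilb (HS e) := prehilb_HS pL (vec_basis eb).

Lemma hs_fieldD G1 G2 : field G1 -> field G2 -> field (fun l => G1 l + G2 l).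
Proof.
move=> h1 h2; have := hs_fieldP eb (cmeasurable_cst _ 1) h1 h2.
by under eq_fun do rewrite scale1r.
Qed.

Lemma hs_fieldZ (c : R -> R[i]) G : cmeasurable setT c -> field G -> field (fun l => c l *: G l).
Proof.
move=> mc h; have h0 : field (fun=> 0).
  split=> [l|u v vu vv]; first exact: vectors0 pHS.
  by rewrite (_ : (fun=> _) = fun=> 0) //; apply/funext => l; exact: inner0l pL _ vv.
have := hs_fieldP eb mc h h0.
by under eq_fun do rewrite addr0.
Qed.

Lemma hs_fieldB G1 G2 : field G1 -> field G2 -> field (fun l => G1 l - G2 l).
Proof.
move=> h1 h2; have := hs_fieldD h1 (hs_fieldZ (cmeasurable_cst _ (-1)) h2).
by under eq_fun do rewrite scaleN1r.
Qed.

Definition fdens G (l : R) : R := sqnorm (G l) * `|l|.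

Lemma fdens_ge0 G : field G -> forall l, 0 <= fdens G l.
Proof. by move=> h l; rewrite mulr_ge0 // (sqnorm_ge0 pHS) //; exact: hf_vec. Qed.

Lemma measurable_fdens G : field G -> measurable_fun setT (fdens G).
Proof.
by move=> h; apply: measurable_funM; [exact: measurable_hf_sqnorm eb _ h|exact: normr_measurable].
Qed.

Lemma fnormE G : field G -> fnorm G = (\int[leb]_l (fdens G l)%:E)%E.
Proof.
move=> h; apply: eq_integral => l _.
by rewrite (sqnorm_HSE pL (vec_basis eb)) //; exact: hf_vec.
Qed.

Lemma fnorm_ge0 G : field G -> (0 <= fnorm G)%E.
Proof. by move=> h; rewrite fnormE //; apply: integral_ge0 => l _; rewrite lee_fin fdens_ge0. Qed.

Lemma fnorm_le (a b : R) G G1 G2 : 0 <= a -> 0 <= b -> field G -> field G1 -> field G2 ->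
  {ae leb, forall l, sqnorm (G l) <= a * sqnorm (G1 l) + b * sqnorm (G2 l)} ->
  (fnorm G <= a%:E * fnorm G1 + b%:E * fnorm G2)%E.
Proof.
move=> a0 b0 h h1 h2 ae; rewrite !fnormE //.
refine (@ae_le_integral_comb _ (measurableTypeR R) R leb a b (fdens G) (fdens G1) (fdens G2)
  a0 b0 (fdens_ge0 h) (fdens_ge0 h1) (fdens_ge0 h2) (measurable_fdens h)
  (measurable_fdens h1) (measurable_fdens h2) _).
apply: ae_imply ae => l hl; rewrite /fdens !mulrA -mulrDl; exact: ler_wpM2r.
Qed.

Lemma ae_neq0 : {ae leb, forall l : R, l != 0}.
Proof.
exists [set 0]; split => //; first exact: lebesgue_measure_set1.
by move=> x /= /negP; rewrite negbK => /eqP.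
Qed.

(** The weight [|l|] vanishes only at 0, so it can be divided out almost everywhere. *)
Lemma fnorm_eq0 G : field G -> (fnorm G <= 0)%E -> {ae leb, forall l, sqnorm (G l) = 0}.
Proof.
move=> h f0; have /measurable_EFinP m := measurable_fdens h.
have /(ae_eq_integral_abs leb measurableT m) ae :
    (\int[leb]_l `|(fdens G l)%:E| = 0)%E.
  rewrite (_ : (\int[leb]_l _)%E = fnorm G); first by apply/eqP; rewrite eq_le f0 fnorm_ge0.
  rewrite fnormE //; apply: eq_integral => l _; rewrite gee0_abs //.
  by rewrite lee_fin fdens_ge0.
apply: ae_imply (ae_and ae ae_neq0) => l [/(_ I) [] /eqP + l0].
by rewrite mulf_eq0 normr_eq0 (negPf l0) orbF => /eqP.
Qed.

Lemma fnorm_squeeze (a b : R) (G_ G1_ G2_ : nat -> R -> HS e) : 0 <= a -> 0 <= b ->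
  (forall n, field (G_ n)) -> (forall n, field (G1_ n)) -> (forall n, field (G2_ n)) ->
  (forall n, {ae leb, forall l,
     sqnorm (G_ n l) <= a * sqnorm (G1_ n l) + b * sqnorm (G2_ n l)}) ->
  fnorm (G1_ n) @[n --> \oo] --> 0%E -> fnorm (G2_ n) @[n --> \oo] --> 0%E ->
  fnorm (G_ n) @[n --> \oo] --> 0%E.
Proof.
move=> a0 b0 h h1 h2 ae c1 c2.
have c : (a%:E * fnorm (G1_ n) + b%:E * fnorm (G2_ n))%E @[n --> \oo] --> 0%E.
  rewrite -[X in _ --> X]adde0; apply: cvgeD => //.
    by have := cvgeZl (y := a%:E) isT c1; rewrite mule0.
  by have := cvgeZl (y := b%:E) isT c2; rewrite mule0.
refine (squeeze_cvge (f := fun=> 0%E) _ (cvg_cst _) c).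
by apply: nearW => n; rewrite fnorm_ge0 //=; exact: fnorm_le.
Qed.

(** [G] is fixed while its bounds tend to 0. Linearity and equivariance of the transform are both
    obtained in this form, with [G] the defect of the identity. *)
Lemma fnorm_limit0 (a b : R) G (G1_ G2_ : nat -> R -> HS e) : 0 <= a -> 0 <= b ->
  field G -> (forall n, field (G1_ n)) -> (forall n, field (G2_ n)) ->
  (forall n, {ae leb, forall l, sqnorm (G l) <= a * sqnorm (G1_ n l) + b * sqnorm (G2_ n l)}) ->
  fnorm (G1_ n) @[n --> \oo] --> 0%E -> fnorm (G2_ n) @[n --> \oo] --> 0%E ->
  {ae leb, forall l, sqnorm (G l) = 0}.
Proof.
move=> a0 b0 h h1 h2 ae c1 c2; apply: fnorm_eq0 => //.
have := @fnorm_squeeze a b (fun=> G) _ _ a0 b0 (fun=> h) h1 h2 ae c1 c2.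
by move=> /(cvg_unique _ (cvg_cst (fnorm G))) ->.
Qed.

End FieldNorm.

(** * Left invariance, and the transform of general square-integrable functions *)

Section HaarInvariance.
Context {R : realType}.
Local Notation leb := (@lebesgue_measure R).
Implicit Types (g : heis R) (phi : L2heis R).

Lemma measurable_hmul g : measurable_fun setT (fun x : heis R => hmul g x).
Proof.
have mp := @measurable_hp R; have mq := @measurable_hq R; have mt := @measurable_ht R.
case: g => [[p0 q0] t0].
rewrite (_ : (fun x => _) = fun x : heis R => (p0 + x.1.1, q0 + x.1.2,
   t0 + x.2 + 2^-1 * (p0 * x.1.2 - q0 * x.1.1))); last by apply/funext => -[[p q] t].
apply: measurable_fun_pair; first by apply: measurable_fun_pair; apply: measurable_funD.
apply: measurable_funD; first exact: measurable_funD.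
by apply: measurable_funM => //; apply: measurable_funB; apply: measurable_funM.
Qed.

(** Left multiplication translates p and q and shears t by an amount depending on p and q. With t
    integrated first, the shear is a translation of the line. *)
Lemma ge0_integral_hmul g (f : heis R -> \bar R) : measurable_fun setT f ->
  (forall x, 0 <= f x)%E -> (\int[haar]_x f (hmul g x) = \int[haar]_x f x)%E.
Proof.
move=> mf f0; have mg := measurable_hmul g.
rewrite haar_tonelli //; last exact: (measurableT_comp mf mg).
rewrite [RHS](haar_tonelli mf f0).
case: g mg => [[p0 q0] t0] mg.
have mI : measurable_fun setT (fun z : R * R => \int[leb]_t f (z, t))%E.
  exact: measurable_fun_fubini_tonelli_F.
have I0 (z : R * R) : (0 <= \int[leb]_t f (z, t))%E by exact: integral_ge0.
transitivity (\int[leb2]_z \int[leb]_t f ((p0 + z.1, q0 + z.2)%R, t))%E.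
  apply: eq_integral => -[p q] _.
  have mfz : measurable_fun setT (fun t => f ((p0 + p, q0 + q)%R, t)).
    exact: (measurable_section1 (p0 + p, q0 + q)%R mf).
  rewrite -(ge0_integral_translate (t0 + 2^-1 * (p0 * q - q0 * p)) mfz) //.
  apply: eq_integral => t _; congr (f (_, _)); rewrite /=; ring.
rewrite leb2_tonelli //; last first.
  have m2 : measurable_fun setT (fun z : R * R => (p0 + z.1, q0 + z.2)).
    by apply: measurable_fun_pair; apply: measurable_funD.
  exact: (measurableT_comp mI m2).
rewrite [RHS](leb2_tonelli mI I0).
have mJ : measurable_fun setT (fun q : R => \int[leb]_p \int[leb]_t f ((p, q), t))%E.
  exact: (@measurable_fun_fubini_tonelli_G _ _ _ _ _ leb _ mI I0).
rewrite -(ge0_integral_translate q0 mJ); last by move=> q; exact: integral_ge0.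
apply: eq_integral => q _.
have mz : measurable_fun setT (fun p => \int[leb]_t f ((p, q + q0)%R, t))%E.
  exact: (measurable_section2 (q + q0)%R mI).
rewrite -(ge0_integral_translate p0 mz (fun p => I0 (p, (q + q0)%R))).
by apply: eq_integral => p _ /=; rewrite addrC [(q + q0)%R]addrC.
Qed.

Lemma translate_L2 g phi : vectors (L2heis R) phi ->
  vectors (L2heis R) (translate g phi) /\ sqnorm (translate g phi) = sqnorm phi.
Proof.
move=> vphi; have [mphi fphi] := vphi.
have m : cmeasurable setT (translate g phi) by apply: cmeasurable_comp (measurable_hmul _).
have E : (\int[haar]_x (sqmod (translate g phi x))%:E = \int[haar]_x (sqmod (phi x))%:E)%E.
  apply: (ge0_integral_hmul (hinv g) (f := fun x => (sqmod (phi x))%:E)).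
    exact/measurable_EFinP/measurable_sqmod.
  by move=> x; rewrite lee_fin sqmod_ge0.
have v : vectors (L2heis R) (translate g phi) by split=> //; rewrite E.
by split=> //; apply: EFin_inj; rewrite -(sqnorm_L2E v) -(sqnorm_L2E vphi).
Qed.

Lemma translate_center (c : R) phi p q t :
  translate (0, 0, c) phi (p, q, t) = phi (p, q, t - c).
Proof.
by rewrite /translate /= !oppr0 !add0r !mul0r subrr mulr0 addr0 addrC.
Qed.

End HaarInvariance.

Section Transform.
Context {R : realType} (e : nat -> L2real R) (eb : orthonormal_basis e).
Context (F : L2heis R -> R -> HS e) (FF : fourier_transform F).
Local Notation leb := (@lebesgue_measure R).
Implicit Types (phi : L2heis R).

Let pL := prehilb_L2 leb.
Let pHS : prehilb (HS e) := prehilb_HS pL (vec_basis eb).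

(* The value of [F phi] at 0 plays no role and is not constrained. *)
Definition hat phi (l : R) : HS e := if l == 0 then 0 else F phi l.

(** At frequency 0 the weight under the square root is 0, so the fibres do not see the value chosen
    there. *)
Lemma fiber_hat sigma phi : fiber F sigma phi = fiber hat sigma phi.
Proof.
apply/funext => j; rewrite /fiber /hat; case: eqP => // ->.
by rewrite normr0 sqrtr0 !scale0r.
Qed.

Lemma hat_field phi : vectors (L2heis R) phi -> hs_field (hat phi).
Proof.
move=> vphi; split=> [l|u v vu vv].
  rewrite /hat; case: eqVneq => [_|l0]; first exact: vectors0 pHS.
  exact: (fourier_HS FF).
have [m1 m2] := fourier_measurable FF vphi vu vv.
have m0 (h : R -> R) : @measurable_fun _ _ (measurableTypeR R) _ [set~ (0 : R)] h ->
    @measurable_fun _ _ (measurableTypeR R) _ setT (fun l : R => if l == 0 then 0 else h l).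
  move=> mh; have mC : measurable ([set~ 0] : set (measurableTypeR R)) by exact: measurableC.
  have := (measurable_restrictT h mC).1 mh; rewrite (_ : h \_ _ = fun l => if l == 0 then 0 else h l) //.
  apply/funext => l; rewrite patchE; case: eqVneq => [->|/eqP l0]; first by rewrite memNset //= => /(_ erefl).
  by rewrite mem_set.
have z l : inner ((0 : HS e) l) v = 0 by exact: (inner0l pL vv).
split.
- rewrite (_ : (fun _ => _) = fun l => if l == 0 then 0 else complex.Re (inner (F phi l u) v)).
    exact: m0.
  by apply/funext => l; rewrite /hat; case: eqP => // _; rewrite z.
- rewrite (_ : (fun _ => _) = fun l => if l == 0 then 0 else complex.Im (inner (F phi l u) v)).
    exact: m0.
  by apply/funext => l; rewrite /hat; case: eqP => // _; rewrite z.
Qed.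

Lemma hat_weak phi : vectors (L2heis R) phi -> cintegrable haar phi ->
  {ae leb, forall l, l != 0 -> weak_integral haar
     (fun x u => phi x *: schrodinger (2 * pi * l) x u) (hat phi l)}.
Proof.
move=> vphi iphi; apply: ae_imply (fourier_integral FF vphi iphi) => l h l0.
by rewrite /hat (negPf l0); exact: h.
Qed.

Lemma fnorm_setC0 (K G : R -> HS e) : (forall l, l != 0 -> K l = G l) ->
  (\int[leb]_(l in [set~ (0%R : R)]) (hs_sqnorm e (K l) * `|l|%:E) = fnorm G)%E.
Proof.
move=> KG; rewrite integral_mkcond; apply: eq_integral => l _; rewrite patchE.
case: ifPn => [/set_mem /= /eqP l0|]; first by rewrite KG.
by rewrite notin_setE /= => /contrapT ->; rewrite normr0 mule0.
Qed.

Lemma hat_fin phi : vectors (L2heis R) phi -> (fnorm (hat phi) < +oo)%E.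
Proof.
move=> vphi; rewrite -(@fnorm_setC0 (F phi)); first exact: (fourier_square_integrable FF).
by move=> l l0; rewrite /hat (negPf l0).
Qed.

Lemma hat_continuous (phi_ : nat -> L2heis R) phi :
  (forall n, vectors (L2heis R) (phi_ n)) -> vectors (L2heis R) phi ->
  sqnorm (phi_ n - phi) @[n --> \oo] --> (0 : R) ->
  fnorm (fun l => hat (phi_ n) l - hat phi l) @[n --> \oo] --> 0%E.
Proof.
move=> v_ v c.
have E : (fun n => fnorm (fun l => hat (phi_ n) l - hat phi l)) =
    fun n => (\int[leb]_(l in [set~ (0%R : R)])
      (hs_sqnorm e (F (phi_ n) l - F phi l)%R * `|l|%:E))%E.
  apply/funext => n; apply/esym/fnorm_setC0 => l /negPf l0.
  by rewrite /hat l0.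
rewrite E; exact: (fourier_continuous FF v_ v c).
Qed.

End Transform.

Section BoxAlgebra.
Context {R : realType}.
Local Notation leb := (@lebesgue_measure R).
Implicit Types (phi psi : L2heis R) (u v : L2real R).

Lemma box_comb (B N : R) (a : R[i]) phi psi : box B N phi -> box B N psi ->
  exists2 B', 0 <= B' & box B' N (a *: phi + psi).
Proof.
move=> [m1 b1 p1 q1 t1] [m2 b2 p2 q2 t2].
exists (Num.sqrt (2 * (sqmod a * B ^+ 2 + B ^+ 2))); first exact: sqrtr_ge0.
have z x : phi x = 0 -> psi x = 0 -> (a *: phi + psi) x = 0.
  by move=> h h'; rewrite -[LHS]/(a * phi x + psi x) h h' mulr0 addr0.
split=> [|x|x h|x h|x h].
- apply: (@cmeasurableD _ _ _ (fun x => a * phi x) psi) => //.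
  by apply: cmeasurableM => //; exact: cmeasurable_cst.
- rewrite sqr_sqrtr; last by rewrite mulr_ge0 // addr_ge0 ?sqr_ge0 // mulr_ge0 ?sqmod_ge0 ?sqr_ge0.
  apply: le_trans (sqmodD_le _ _) _; rewrite ler_pM2l // lerD // sqmodM.
  by apply: ler_wpM2l; rewrite ?sqmod_ge0.
- by apply: z; [exact: p1|exact: p2].
- by apply: z; [exact: q1|exact: q2].
- by apply: z; [exact: t1|exact: t2].
Qed.

(** As one absolutely convergent integral over the product of the group and the line, the weak
    integral is visibly linear in [phi]. *)
Lemma weak_integral_kerG (B N : R) phi (l : R) u v : 0 <= B -> 0 < N -> box B N phi ->
  vectors (L2real R) u -> vectors (L2real R) v ->
  cint (hm \x leb)%E (kerG phi l u v) /\
  cintegral haar (fun x => @inner R (L2real R) (phi x *: schrodinger (2 * pi * l) x u) v) =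
  cintegral (hm \x leb)%E (kerG phi l u v).
Proof.
move=> B0 N0 bphi vu vv; have ci := cint_kerG B0 N0 bphi l vu vv; split=> //.
have [_ <-] := cfubini1 ci.
by apply: eq_cintegral => x; apply: eq_cintegral => s.
Qed.

Lemma box_translate (B N c : R) phi : 0 < N -> box B N phi ->
  box B (N + `|c|) (translate (0, 0, c) phi).
Proof.
move=> N0 [m b p q t]; have c0 := normr_ge0 c.
have [c1 c2] : - `|c| <= c /\ c <= `|c|.
  by have := lexx `|c|; rewrite ler_norml => /andP.
split=> [|x|[[x y] z] h|[[x y] z] h|[[x y] z] h].
- exact: (cmeasurable_comp m (measurable_hmul _)).
- exact: b.
- rewrite translate_center p //= => /andP[h1 h2]; apply: h; apply/andP; split=> /=; lra.
- rewrite translate_center q //= => /andP[h1 h2]; apply: h; apply/andP; split=> /=; lra.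
- rewrite translate_center t //= => /andP[h1 h2]; apply: h; apply/andP; split=> /=; lra.
Qed.

(** The shift of t multiplies [hpsi] by a character that involves neither p nor q, hence comes out
    of the later integrals. *)
Lemma opf_translate (B N c : R) phi (l : R) u s : 0 <= B -> 0 < N -> box B N phi ->
  vectors (L2real R) u ->
  opf (translate (0, 0, c) phi) l u s = cis (2 * pi * l * c) * opf phi l u s.
Proof.
move=> B0 N0 bphi vu.
have N0' : 0 < N + `|c| by rewrite ltr_wpDr.
have bt := box_translate c N0 bphi.
have E1 p q : hpsi (translate (0, 0, c) phi) l p q = hpsi phi l p q * cis (2 * pi * l * c).
  have ci := cint_ft l B0 (bs_slice bt p q).
  rewrite /hpsi /ft -cintegralZr; last exact: (cint_ft l B0 (bs_slice bphi p q)).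
  have := @cintegral_affine R 1 c _ (oner_neq0 _) ci; rewrite normr1 rmorph1 mul1r => <-.
  by apply: eq_cintegral => t; rewrite translate_center mul1r addrK -[RHS]mulrA -cisD mulrDr.
have E2 q : hker (translate (0, 0, c) phi) l s q = hker phi l s q * cis (2 * pi * l * c).
  rewrite /hker /ft -cintegralZr; last first.
    by apply: cint_ft (bs_hpsi N0 bphi l q); rewrite !mulr_ge0 // ltW.
  by apply: eq_cintegral => p; rewrite E1 mulrAC.
have [ci E3] := opfE N0 bphi l s vu; have [_ ->] := opfE N0' bt l s vu.
rewrite E3 mulrC -(cintegralZr (cis (2 * pi * l * c)) ci).
by apply: eq_cintegral => q; rewrite E2 mulrAC.
Qed.

End BoxAlgebra.

Lemma le_of_chained_approx (R : realType) (x y : R) : 0 <= x -> 0 <= y ->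
  (forall eps, 0 < eps -> eps <= 1 -> exists m : R,
    x <= (1 + eps) * m + 2 * eps /\ m <= (1 + eps) * y + 2 * eps) -> x <= y.
Proof.
move=> x0 y0 h; apply/ler_addgt0Pr => d d0.
(* Chaining the two bounds costs at most t (3 y + 6) for t <= 1, since 2 t + t^2 <= 3 t and 4 t + 2
   t^2 <= 6 t. *)
have K0 : 0 < 3 * y + 6 by lra.
pose eps := Num.min 1 (d / (3 * y + 6)).
have e0 : 0 < eps by rewrite lt_min ltr01 divr_gt0.
have e1 : eps <= 1 by rewrite ge_min lexx.
have e2 : eps * (3 * y + 6) <= d by rewrite -ler_pdivlMr // ge_min lexx orbT.
have [m [h1 h2]] := h _ e0 e1; move: (eps) e0 e1 e2 h1 h2 => t t0 t1 t2 h1 h2.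
apply: le_trans h1 _.
have : (1 + t) * m <= (1 + t) * ((1 + t) * y + 2 * t) by apply: ler_wpM2l => //; lra.
by nra.
Qed.

Section TransformProperties.
Context {R : realType} (e : nat -> L2real R) (eb : orthonormal_basis e).
Context (F : L2heis R -> R -> HS e) (FF : fourier_transform F).
Local Notation leb := (@lebesgue_measure R).
Local Notation hat := (hat F).
Implicit Types (phi psi : L2heis R).

Let pL := prehilb_L2 leb.
Let pH := prehilb_L2 (@haar R).
Let pHS : prehilb (HS e) := prehilb_HS pL (vec_basis eb).
Let hF phi := @hat_field R e eb F FF phi.

Lemma hs_null (A : HS e) : vectors (HS e) A ->
  (forall u v, vectors (L2real R) u -> vectors (L2real R) v -> inner (A u) v = 0) ->
  sqnorm A = 0.
Proof.
move=> vA h; apply: EFin_inj; rewrite -(sqnorm_HSE pL (vec_basis eb) vA).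
rewrite hs_sqnormE //; last by move=> n; exact: (vec_HS_basis eb).
by rewrite esum1 // => n _; rewrite esum1 // => m _; rewrite h ?sqmod0 //; exact: vec_basis.
Qed.

Lemma trunc_L2 n phi : vectors (L2heis R) phi -> vectors (L2heis R) (trunc n phi).
Proof. by move=> [m _]; exact: (box_L2 (ltr0Sn R n) (trunc_box n m)). Qed.

Lemma hat_trunc phi : vectors (L2heis R) phi ->
  fnorm (fun l => hat (trunc n phi) l - hat phi l) @[n --> \oo] --> 0%E.
Proof.
by move=> v; apply: (hat_continuous FF) => // [n|]; [exact: trunc_L2|exact: trunc_cvg].
Qed.

Lemma hat_weak_box (B N : R) phi : 0 <= B -> 0 < N -> box B N phi ->
  {ae leb, forall l, l != 0 /\ forall u v, vectors (L2real R) u -> vectors (L2real R) v ->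
    inner (hat phi l u) v =
    cintegral haar (fun x => @inner R (L2real R) (phi x *: schrodinger (2 * pi * l) x u) v)}.
Proof.
move=> B0 N0 b; have vb := box_L2 N0 b; have ib := box_cintegrable B0 N0 b.
apply: ae_imply (ae_and (hat_weak FF vb ib) (@ae_neq0 R)) => l [h l0]; split=> // u v vu vv.
by case: (h l0) => _ ->.
Qed.

Lemma vec_hat phi l u : vectors (L2heis R) phi -> vectors (L2real R) u ->
  vectors (L2real R) (hat phi l u).
Proof. by move=> v vu; case: (hf_vec (hF v) l) => -[h _ _] _; exact: h. Qed.

Lemma hat_comb_box (B N : R) (a : R[i]) phi psi : 0 <= B -> 0 < N ->
  box B N phi -> box B N psi ->
  {ae leb, forall l, sqnorm (a *: hat phi l + hat psi l - hat (a *: phi + psi) l) = 0}.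
Proof.
move=> B0 N0 b1 b2; have [B' B0' b3] := box_comb a b1 b2.
have v1 := box_L2 N0 b1; have v2 := box_L2 N0 b2; have v3 := box_L2 N0 b3.
have := ae_and (hat_weak_box B0 N0 b1) (ae_and (hat_weak_box B0 N0 b2) (hat_weak_box B0' N0 b3)).
apply: ae_imply => l [[_ h1] [[_ h2] [_ h3]]]; apply: hs_null => [|u v vu vv].
  have q1 := hf_vec (hF v1) l; have q2 := hf_vec (hF v2) l; have q3 := hf_vec (hF v3) l.
  exact: (vectorsB pHS (vectorsP pHS a q1 q2) q3).
have w1 := vec_hat l v1 vu; have w2 := vec_hat l v2 vu; have w3 := vec_hat l v3 vu.
transitivity (inner (a *: hat phi l u + hat psi l u - hat (a *: phi + psi) l u) v) => //.
rewrite (innerBl pL) //; last exact: (vectorsP pL).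
rewrite (innerP pL) // h1 // h2 // h3 //.
have [c1 ->] := weak_integral_kerG l B0 N0 b1 vu vv.
have [c2 ->] := weak_integral_kerG l B0 N0 b2 vu vv.
have [c3 ->] := weak_integral_kerG l B0' N0 b3 vu vv.
rewrite -cintegralZD //; apply/eqP; rewrite subr_eq0; apply/eqP/eq_cintegral => z.
by rewrite /kerG /kerK -[(a *: phi + psi) _]/(a * phi z.1 + psi z.1) !mulrDl !mulrA.
Qed.

Lemma hat_translate_box (B N c : R) phi : 0 <= B -> 0 < N -> box B N phi ->
  {ae leb, forall l, sqnorm (cis (2 * pi * l * c) *: hat phi l - hat (translate (0, 0, c) phi) l) = 0}.
Proof.
move=> B0 N0 b1; have b2 := box_translate c N0 b1.
have N0' : 0 < N + `|c| by rewrite ltr_wpDr.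
have v1 := box_L2 N0 b1; have v2 := box_L2 N0' b2.
have := ae_and (hat_weak_box B0 N0 b1) (hat_weak_box B0 N0' b2).
apply: ae_imply => l [[l0 h1] [_ h2]]; apply: hs_null => [|u v vu vv].
  have q1 := hf_vec (hF v1) l; have q2 := hf_vec (hF v2) l.
  exact: (vectorsB pHS (vectorsZ pHS _ q1) q2).
have w1 := vec_hat l v1 vu; have w2 := vec_hat l v2 vu.
transitivity (inner (cis (2 * pi * l * c) *: hat phi l u - hat (translate (0, 0, c) phi) l u) v) => //.
rewrite (innerBl pL) //; last exact: (vectorsZ pL).
rewrite (innerZl pL) // h1 // h2 //.
rewrite (weak_integral_opf B0 N0 b1) // (weak_integral_opf B0 N0' b2) //.
have vo := vec_opf B0 N0 b1 l0 vu.
rewrite -(innerZl pL) //.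
have -> : opf (translate (0, 0, c) phi) l u = cis (2 * pi * l * c) *: opf phi l u.
  by apply/funext => s; exact: (opf_translate c l s B0 N0 b1 vu).
by rewrite subrr.
Qed.

(** The identity holds for box functions, where the transform is a weak integral, and passes to the
    limit by continuity. The combination is approximated by the combination of truncations, since
    truncation itself is not linear. *)
Lemma hat_comb (a : R[i]) phi psi : vectors (L2heis R) phi -> vectors (L2heis R) psi ->
  {ae leb, forall l, sqnorm (a *: hat phi l + hat psi l - hat (a *: phi + psi) l) = 0}.
Proof.
move=> v1 v2; have v3 := vectorsP pH a v1 v2.
pose phi_ n := trunc n phi; pose psi_ n := trunc n psi.
have w1 n : vectors (L2heis R) (phi_ n) := trunc_L2 n v1.
have w2 n : vectors (L2heis R) (psi_ n) := trunc_L2 n v2.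
have w3 n : vectors (L2heis R) (a *: phi_ n + psi_ n) by exact: (vectorsP pH).
pose xc := fun l => a *: (hat phi l : HS e) + hat psi l.
pose yc n := fun l => a *: (hat (phi_ n) l : HS e) + hat (psi_ n) l.
pose d1 n := fun l => hat (phi_ n) l - hat phi l.
pose d2 n := fun l => hat (psi_ n) l - hat psi l.
pose d3 n := fun l => hat (a *: phi_ n + psi_ n) l - hat (a *: phi + psi) l.
have mc := cmeasurable_cst (Real_sort__canonical__measurable_structure_Measurable R) a.
have fx : hs_field xc := hs_fieldP eb mc (hF v1) (hF v2).
have fy n : hs_field (yc n) := hs_fieldP eb mc (hF (w1 n)) (hF (w2 n)).
have fG : hs_field (fun l => xc l - hat (a *: phi + psi) l) := hs_fieldB eb fx (hF v3).
have f12 n : hs_field (fun l => yc n l - xc l) := hs_fieldB eb (fy n) fx.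
have f1 n : hs_field (d1 n) := hs_fieldB eb (hF (w1 n)) (hF v1).
have f2 n : hs_field (d2 n) := hs_fieldB eb (hF (w2 n)) (hF v2).
have f3 n : hs_field (d3 n) := hs_fieldB eb (hF (w3 n)) (hF v3).
have a0 : 0 <= 2 * sqmod a by rewrite mulr_ge0 ?sqmod_ge0.
have c12 : fnorm (fun l => yc n l - xc l) @[n --> \oo] --> 0%E.
  apply: (fnorm_squeeze eb a0 (ler0n R 2) f12 f1 f2 _ (hat_trunc v1) (hat_trunc v2)) => n.
  apply: aeT => l.
  exact: (sqnorm_comb_le pHS a (hf_vec (hF v1) l) (hf_vec (hF v2) l)
    (hf_vec (hF (w1 n)) l) (hf_vec (hF (w2 n)) l)).
have c3 : fnorm (d3 n) @[n --> \oo] --> 0%E.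
  apply: (hat_continuous FF w3 v3).
  apply: (@squeeze_cvgr _ _ _ _ (fun=> 0)
    (fun n => 2 * sqmod a * sqnorm (phi_ n - phi) + 2 * sqnorm (psi_ n - psi))).
  - apply: nearW => n; rewrite (sqnorm_ge0 pH (vectorsB pH (w3 n) v3)) /=.
    exact: (sqnorm_comb_le pH a v1 v2 (w1 n) (w2 n)).
  - exact: cvg_cst.
  rewrite [X in _ --> X](_ : 0 = 2 * sqmod a * 0 + 2 * 0); last by rewrite !mulr0 addr0.
  by apply: cvgD; apply: cvgMr; exact: trunc_cvg.
have key n : {ae leb, forall l, sqnorm (xc l - hat (a *: phi + psi) l) <=
    2 * sqnorm (yc n l - xc l) + 2 * sqnorm (d3 n l)}.
  have := hat_comb_box a (ler0n R n.+1) (ltr0Sn R n) (trunc_box n (proj1 v1)) (trunc_box n (proj1 v2)).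
  apply: ae_imply => l h.
  exact: (sqnorm_defect pHS (hf_vec fx l) (hf_vec (fy n) l) (hf_vec (hF (w3 n)) l)
    (hf_vec (hF v3) l) h).
exact: (fnorm_limit0 eb (ler0n R 2) (ler0n R 2) fG f12 f3 key c12 c3).
Qed.

Lemma hat_translate (c : R) phi : vectors (L2heis R) phi ->
  {ae leb, forall l, sqnorm (cis (2 * pi * l * c) *: hat phi l - hat (translate (0, 0, c) phi) l) = 0}.
Proof.
move=> v1; have v2 := (translate_L2 (0, 0, c) v1).1.
pose phi_ n := trunc n phi.
have w1 n : vectors (L2heis R) (phi_ n) := trunc_L2 n v1.
have w2 n := (translate_L2 (0, 0, c) (w1 n)).1.
have mc : cmeasurable setT (fun l : R => cis (2 * pi * l * c)).
  by apply: measurable_cis; apply: measurable_funM => //; exact: measurable_funM.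
pose x := fun l => cis (2 * pi * l * c) *: (hat phi l : HS e).
pose y n := fun l => cis (2 * pi * l * c) *: (hat (phi_ n) l : HS e).
pose d1 n := fun l => hat (phi_ n) l - hat phi l.
pose d2 n := fun l => hat (translate (0, 0, c) (phi_ n)) l - hat (translate (0, 0, c) phi) l.
have fx : hs_field x := hs_fieldZ eb mc (hF v1).
have fy n : hs_field (y n) := hs_fieldZ eb mc (hF (w1 n)).
have fG : hs_field (fun l => x l - hat (translate (0, 0, c) phi) l) := hs_fieldB eb fx (hF v2).
have f1 n : hs_field (d1 n) := hs_fieldB eb (hF (w1 n)) (hF v1).
have f2 n : hs_field (d2 n) := hs_fieldB eb (hF (w2 n)) (hF v2).
have c2 : fnorm (d2 n) @[n --> \oo] --> 0%E.
  apply: (hat_continuous FF w2 v2).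
  rewrite (_ : (fun n => _) = fun n => sqnorm (phi_ n - phi)); first exact: trunc_cvg.
  by apply/funext => n; exact: (translate_L2 (0, 0, c) (vectorsB pH (w1 n) v1)).2.
have key n : {ae leb, forall l, sqnorm (x l - hat (translate (0, 0, c) phi) l) <=
    2 * sqnorm (d1 n l) + 2 * sqnorm (d2 n l)}.
  have := hat_translate_box c (ler0n R n.+1) (ltr0Sn R n) (trunc_box n (proj1 v1)).
  apply: ae_imply => l h.
  have -> : sqnorm (d1 n l) = sqnorm (y n l - x l).
    by rewrite /y /x -scalerBr (sqnormZ pHS _ (hf_vec (f1 n) l)) sqmod_cis mul1r.
  exact: (sqnorm_defect pHS (hf_vec fx l) (hf_vec (fy n) l) (hf_vec (hF (w2 n)) l)
    (hf_vec (hF v2) l) h).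
exact: (fnorm_limit0 eb (ler0n R 2) (ler0n R 2) fG f1 f2 key (hat_trunc v1) c2).
Qed.

(** The squared norms of [phi] and of its transform are both compared with that of a truncation,
    from above and from below; the comparison becomes exact as eps tends to 0. *)
Lemma plancherel phi : vectors (L2heis R) phi -> fnorm (hat phi) = (sqnorm phi)%:E.
Proof.
move=> v; have vn n := trunc_L2 n v.
have E n : fnorm (hat (trunc n phi)) = (sqnorm (trunc n phi))%:E.
  have b := trunc_box n (proj1 v).
  rewrite (fnorm_box eb (ler0n R n.+1) (ltr0Sn R n) b (hF (vn n))); last first.
    exact: (hat_weak FF (vn n) (box_cintegrable (ler0n R n.+1) (ltr0Sn R n) b)).
  exact: (sqnorm_L2E (vn n)).
have d := hat_trunc v; have sc := trunc_cvg v.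
have dfield n : hs_field (fun l => hat (trunc n phi) l - hat phi l) := hs_fieldB eb (hF (vn n)) (hF v).
have : fnorm (hat phi) \is a fin_num.
  by rewrite ge0_fin_numE; [exact: (hat_fin FF v)|exact: (fnorm_ge0 eb (hF v))].
move=> /fineK E1; rewrite -E1; congr EFin.
set r := fine _ in E1 *; set s := sqnorm phi.
have s0 : 0 <= s := sqnorm_ge0 pH v.
have r0 : 0 <= r by rewrite -lee_fin E1 (fnorm_ge0 eb (hF v)).
suff key eps : 0 < eps -> eps <= 1 -> exists m : R,
    [/\ r <= (1 + eps) * m + 2 * eps, m <= (1 + eps) * r + 2 * eps,
        s <= (1 + eps) * m + 2 * eps & m <= (1 + eps) * s + 2 * eps].
  by apply/eqP; rewrite eq_le; apply/andP; split; apply: le_of_chained_approx => // eps e0 e1;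
    have [m [h1 h2 h3 h4]] := key _ e0 e1; exists m.
move=> e0 e1.
have e2 : 0 < eps ^+ 2 by rewrite exprn_gt0.
have [dfin dcvg] := (fine_cvgP _ _).1 d.
have [n [n1 n2 n3]] : exists n, [/\ fnorm (fun l => hat (trunc n phi) l - hat phi l) \is a fin_num,
    fine (fnorm (fun l => hat (trunc n phi) l - hat phi l)) < eps ^+ 2 &
    sqnorm (trunc n phi - phi) < eps ^+ 2].
  have H1 := cvgr_lt _ dcvg _ e2; have H2 := cvgr_lt _ sc _ e2.
  by have [n _ hn] := filterI dfin (filterI (H1 _) (H2 _)); exists n; case: (hn n (leqnn n)) => ? [].
(* The truncation error was taken below eps^2 in order to absorb the factor 1 + 1 / eps. *)
have c2 : (1 + eps^-1) * eps ^+ 2 <= 2 * eps.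
  by rewrite mulrDl mul1r expr2 mulrA mulVf ?gt_eqF // mul1r; nra.
exists (sqnorm (trunc n phi)).
move: n2; rewrite -lte_fin fineK // => n2.
have i0 : 0 <= 1 + eps^-1 by rewrite addr_ge0 // invr_ge0 ltW.
have i1 : 0 <= 1 + eps by rewrite addr_ge0 // ltW.
have cD : ((1 + eps^-1)%:E * fnorm (fun l => hat (trunc n phi) l - hat phi l)%R <= (2 * eps)%:E)%E.
  apply: (@le_trans _ _ ((1 + eps^-1)%:E * (eps ^+ 2)%:E)%E); last by rewrite -EFinM lee_fin.
  by apply: lee_wpmul2l; [rewrite lee_fin|exact: ltW].
have cT : (1 + eps^-1) * sqnorm (trunc n phi - phi) <= 2 * eps.
  by apply: le_trans c2; apply: ler_wpM2l => //; exact: ltW.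
have w1 := hf_vec (hF v); have w2 := hf_vec (hF (vn n)).
split.
- rewrite -lee_fin E1 EFinD EFinM -E; apply: le_trans (leeD (lexx _) cD).
  apply: (fnorm_le eb i1 i0 (hF v) (hF (vn n)) (dfield n)); apply: aeT => l.
  have wd := vectorsB pHS (w2 l) (w1 l).
  rewrite -(sqnormN pHS wd) -[hat phi l](subKr (hat (trunc n phi) l)).
  have := sqnormD_eps pHS (w2 l) (vectorsN pHS wd) e0.
  by rewrite subKr.
- rewrite -lee_fin -E EFinD EFinM E1; apply: le_trans (leeD (lexx _) cD).
  apply: (fnorm_le eb i1 i0 (hF (vn n)) (hF v) (dfield n)); apply: aeT => l.
  have wd := vectorsB pHS (w2 l) (w1 l).
  by have := sqnormD_eps pHS (w1 l) wd e0; rewrite addrC subrK.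
- apply: (@le_trans _ _ ((1 + eps) * sqnorm (trunc n phi) + (1 + eps^-1) * sqnorm (trunc n phi - phi))).
    have wd := vectorsB pH (vn n) v.
    have := sqnormD_eps pH (vn n) (vectorsN pH wd) e0.
    by rewrite (sqnormN pH wd) subKr.
  by rewrite lerD2l.
- apply: (@le_trans _ _ ((1 + eps) * s + (1 + eps^-1) * sqnorm (trunc n phi - phi))).
    have wd := vectorsB pH (vn n) v.
    by have := sqnormD_eps pH v wd e0; rewrite addrC subrK.
  by rewrite lerD2l.
Qed.

End TransformProperties.

(* An isometry of [H] into the direct integral over [0, 1] of copies of [K], equivariant
   for an action of the integers on [H] by characters of the circle. *)
Record fiberization (R : realType) (H K : hspace R) (T : R -> H -> K)
    (tr : int -> H -> H) : Prop := Fiberization {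
  fz_H : prehilb H;
  fz_K : prehilb K;
  fz_tr : forall l u, vectors H u -> vectors H (tr l u);
  fz_meas : forall u v, vectors H u -> vectors H v ->
    cmeasurable setT (fun s => inner (T s u) (T s v));
  fz_vec : forall u, vectors H u ->
    {ae (@lebesgue_measure R), forall s, `[0%R, 1%R]%classic s -> vectors K (T s u)};
  fz_iso : forall u, vectors H u ->
    (\int[@lebesgue_measure R]_(s in `[0%R, 1%R]) (sqnorm (T s u))%:E = (sqnorm u)%:E)%E;
  fz_comb : forall a u v, vectors H u -> vectors H v ->
    {ae (@lebesgue_measure R), forall s, `[0%R, 1%R]%classic s ->
       sqnorm (a *: T s u + T s v - T s (a *: u + v)) = 0};
  fz_char : forall l u, vectors H u ->
    {ae (@lebesgue_measure R), forall s, `[0%R, 1%R]%classic s ->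
       sqnorm (cis (2 * pi * s * l%:~R) *: T s u - T s (tr l u)) = 0} }.

(** * Measurability of sums, and null sets under integer shifts *)

Section MeasurableSums.
Context {R : realType} d (T : measurableType d) (J : choiceType).
Hypothesis cJ : countable [set: J].

Lemma measurable_rsum (a : J -> T -> R) : (forall j, measurable_fun setT (a j)) ->
  measurable_fun setT (fun x => rsum (fun j => a j x)).
Proof.
move=> ma.
have mp : measurable_fun setT (fun x => fine (\esum_(j in setT) (Num.max (a j x) 0)%:E)%E).
  apply: (measurableT_comp (fine_measurable measurableT)).
  apply: measurable_esum => // [j x _|j _]; first by rewrite lee_fin le_max lexx orbT.
  by apply/measurable_EFinP; apply: measurable_maxr.
have mn : measurable_fun setT (fun x => fine (\esum_(j in setT) (Num.max (- a j x) 0)%:E)%E).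
  apply: (measurableT_comp (fine_measurable measurableT)).
  apply: measurable_esum => // [j x _|j _]; first by rewrite lee_fin le_max lexx orbT.
  by apply/measurable_EFinP; apply: measurable_maxr => //; exact: measurableT_comp.
exact: measurable_funB mp mn.
Qed.

Lemma measurable_csum (z : J -> T -> R[i]) : (forall j, cmeasurable setT (z j)) ->
  cmeasurable setT (fun x => csum (fun j => z j x)).
Proof. by move=> mz; split; apply: measurable_rsum => j; case: (mz j). Qed.

End MeasurableSums.

Section IntegerShifts.
Context {R : realType}.
Local Notation leb := (@lebesgue_measure R).

Lemma ae_translate (P : R -> Prop) (c : R) : {ae leb, forall x, P x} -> {ae leb, forall x, P (x + c)}.
Proof.
move=> [N [mN N0 PN]]; have mS : measurable ((fun x : R => x + c) @^-1` N).
  rewrite -[X in measurable X]setTI; apply: (measurable_funD _ _ measurableT mN).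
    exact: measurable_id.
  exact: measurable_cst.
exists ((fun x => x + c) @^-1` N); split=> // [|x /= h]; last exact: PN.
have m1 : measurable_fun setT (fun x : R => (\1_N x)%:E : \bar R).
  by apply/measurable_EFinP; exact: measurable_indic.
have p x : (0 <= (\1_N x)%:E :> \bar R)%E by rewrite lee_fin.
transitivity (\int[leb]_x (\1_((fun x : R => (x + c)%R) @^-1` N) x)%:E)%E.
  by rewrite integral_indic // setIT.
transitivity (\int[leb]_x (\1_N (x + c)%R)%:E)%E; first by apply: eq_integral.
by rewrite (ge0_integral_translate c m1 p) integral_indic // setIT.
Qed.

(** Countably many translates of a null set form a null set; what holds at almost every frequency
    thus holds at all points s + j for almost every s. *)
Lemma ae_shift_int (P : R -> Prop) : {ae leb, forall x, P x} ->
  {ae leb, forall x, forall j : int, P (x + j%:~R)}.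
Proof.
move=> hP; have h n : {ae leb, forall x, if choice.unpickle n is Some j then P (x + (j : int)%:~R) else True}.
  by case: choice.unpickle => [j|]; [exact: ae_translate|exact: aeT].
apply: ae_imply (ae_all h) => x hx j; have := hx (choice.pickle j).
by rewrite choice.pickleK.
Qed.

End IntegerShifts.

(** * The fibre map of the Fourier transform is a fiberization *)

Section Fiberization.
Context {R : realType} (e : nat -> L2real R) (eb : orthonormal_basis e).
Context (F : L2heis R -> R -> HS e) (FF : fourier_transform F).
Local Notation leb := (@lebesgue_measure R).
Local Notation U := (`[0%R, 1%R]%classic : set R).
Local Notation K := (ell2 int (HS e)).
Local Notation T := (fiber (hat F)).
Implicit Types (phi psi : L2heis R) (G : R -> HS e) (s : R).

Let pL := prehilb_L2 leb.
Let pHS : prehilb (HS e) := prehilb_HS pL (vec_basis eb).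
Let pK : prehilb K := prehilb_ell2 pHS int.
Let hF phi := @hat_field R e eb F FF phi.

Lemma measurable_hf_inner G1 G2 : hs_field G1 -> hs_field G2 ->
  cmeasurable setT (fun l => inner (G1 l) (G2 l)).
Proof.
move=> h1 h2; have m1 := measurable_hf_sqnorm eb h1; have m2 := measurable_hf_sqnorm eb h2.
have part (c : R[i]) : measurable_fun setT
    (fun l => (sqnorm (G1 l + c *: G2 l) - sqnorm (G1 l) - sqnorm (G2 l)) / 2).
  have h3 := hs_fieldD eb h1 (hs_fieldZ eb (cmeasurable_cst _ c) h2).
  have m3 := measurable_hf_sqnorm eb h3.
  apply: measurable_funM; last exact: measurable_cst.
  exact: measurable_funB (measurable_funB m3 m1) m2.
split.
- have := part 1; congr (measurable_fun _ _); apply/funext => l.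
  by rewrite scale1r (ReinnerE pHS (hf_vec h1 l) (hf_vec h2 l)).
- have := part 'i%C; congr (measurable_fun _ _); apply/funext => l.
  by rewrite (IminnerE pHS (hf_vec h1 l) (hf_vec h2 l)).
Qed.

Lemma fiber_inner_term phi psi s j : vectors (L2heis R) phi -> vectors (L2heis R) psi ->
  inner (T s phi j) (T s psi j) =
  (`|s + j%:~R|)%:C%C * inner (hat F phi (s + j%:~R)) (hat F psi (s + j%:~R)).
Proof.
move=> v1 v2; have w1 := hf_vec (hF v1) (s + j%:~R); have w2 := hf_vec (hF v2) (s + j%:~R).
rewrite /fiber (innerZl pHS _ w1 (vectorsZ pHS _ w2)) (innerZr pHS _ w2 w1) mulrA.
by rewrite sqmodJE sqmod_real sqr_sqrtr.
Qed.

Lemma measurable_fiber_inner phi psi : vectors (L2heis R) phi -> vectors (L2heis R) psi ->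
  cmeasurable setT (fun s => inner (T s phi) (T s psi)).
Proof.
move=> v1 v2; apply: (@measurable_csum _ _ _ _ (@countable_int _)
  (fun j s => inner (T s phi j) (T s psi j))) => j.
have ms : measurable_fun setT (fun s : R => s + j%:~R).
  by apply: measurable_funD; [exact: measurable_id|exact: measurable_cst].
have m := cmeasurableM (cmeasurable_real (@normr_measurable R setT)) (measurable_hf_inner (hF v1) (hF v2)).
have := cmeasurable_comp m ms; congr cmeasurable; apply/funext => s.
by rewrite fiber_inner_term.
Qed.

Lemma fiber_sqnorm_term phi s j : vectors (L2heis R) phi ->
  vectors (HS e) (T s phi j) /\ sqnorm (T s phi j) = fdens (hat F phi) (s + j%:~R).
Proof.
move=> v; have w := hf_vec (hF v) (s + j%:~R); split; first exact: (vectorsZ pHS).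
by rewrite (sqnormZ pHS _ w) sqmod_real sqr_sqrtr // mulrC.
Qed.

(** Extended-valued, because it precedes the knowledge that the fibre is square summable: on a
    divergent sequence [sqnorm] would be 0 through [fine]. *)
Definition fibsq phi s : \bar R := (\esum_(j in [set: int]) (fdens (hat F phi) (s + j%:~R))%:E)%E.

Lemma measurable_fibsq phi : vectors (L2heis R) phi -> measurable_fun setT (fibsq phi).
Proof.
move=> v; apply: measurable_esum => [|j x _|j _]; first exact: countable_int.
  by rewrite lee_fin (fdens_ge0 eb (hF v)).
apply/measurable_EFinP; apply: (measurableT_comp (measurable_fdens eb (hF v))).
by apply: measurable_funD; [exact: measurable_id|exact: measurable_cst].
Qed.

Lemma integral_fibsq phi : vectors (L2heis R) phi ->
  (\int[leb]_(s in U) fibsq phi s = (sqnorm phi)%:E)%E.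
Proof.
move=> v; rewrite -(plancherel eb FF v) (fnormE eb (hF v)).
rewrite (@integral_unfold01 R (EFin \o fdens (hat F phi))) //.
  by apply/measurable_EFinP; exact: (measurable_fdens eb (hF v)).
by move=> x; rewrite lee_fin (fdens_ge0 eb (hF v)).
Qed.

Lemma fibsq_fin phi : vectors (L2heis R) phi ->
  {ae leb, forall s, U s -> fibsq phi s \is a fin_num}.
Proof.
move=> v; apply: integrable_ae => //; apply/integrableP; split.
  exact: measurable_funTS (measurable_fibsq v).
have E : (\int[leb]_(s in U) `|fibsq phi s| = (sqnorm phi)%:E)%E.
  rewrite -(integral_fibsq v); apply: eq_integral => s _; rewrite gee0_abs // esum_ge0 // => j _.
  by rewrite lee_fin (fdens_ge0 eb (hF v)).
have := ltry (sqnorm phi); rewrite -E; exact: id.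
Qed.

Lemma fiber_vec phi s : vectors (L2heis R) phi -> fibsq phi s \is a fin_num ->
  vectors K (T s phi) /\ fibsq phi s = (sqnorm (T s phi))%:E.
Proof.
move=> v f.
have E : (\esum_(j in [set: int]) (sqnorm (T s phi j))%:E)%E = fibsq phi s.
  by apply: eq_esum => j _; rewrite (fiber_sqnorm_term s j v).2.
have vT : vectors K (T s phi).
  split=> [j|]; first exact: (fiber_sqnorm_term s j v).1.
  by rewrite E ltey_eq f.
by split=> //; rewrite -(sqnorm_ell2E pHS vT).
Qed.

Lemma fiber_isometry phi : vectors (L2heis R) phi ->
  (\int[leb]_(s in U) (sqnorm (T s phi))%:E = (sqnorm phi)%:E)%E.
Proof.
move=> v; rewrite -(integral_fibsq v); apply: ae_eq_integral.
- exact: measurable_itv.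
- apply/measurable_EFinP/measurable_funTS; exact: (measurable_fiber_inner v v).1.
- exact: measurable_funTS (measurable_fibsq v).
by apply: ae_imply (fibsq_fin v) => s h Us; rewrite (fiber_vec v (h Us)).2.
Qed.

Lemma ell2_null (A : K) : vectors K A -> (forall j, sqnorm (A j) = 0) -> sqnorm A = 0.
Proof.
move=> vA h; apply: EFin_inj; rewrite -(sqnorm_ell2E pHS vA).
by rewrite esum1 // => j _; rewrite h.
Qed.

Lemma fiber_ae phi : vectors (L2heis R) phi -> {ae leb, forall s, U s -> vectors K (T s phi)}.
Proof. by move=> v; apply: ae_imply (fibsq_fin v) => s h Us; exact: (fiber_vec v (h Us)).1. Qed.

Lemma fiber_comb (a : R[i]) phi psi : vectors (L2heis R) phi -> vectors (L2heis R) psi ->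
  {ae leb, forall s, U s -> sqnorm (a *: T s phi + T s psi - T s (a *: phi + psi)) = 0}.
Proof.
move=> v1 v2; have v3 := vectorsP (prehilb_L2 (@haar R)) a v1 v2.
have := ae_shift_int (hat_comb eb FF a v1 v2).
move=> /(ae_and (ae_and (fiber_ae v1) (ae_and (fiber_ae v2) (fiber_ae v3)))).
apply: ae_imply => s [[h1 [h2 h3]] h] Us.
have w1 := h1 Us; have w2 := h2 Us; have w3 := h3 Us.
apply: ell2_null; first exact: (vectorsB pK (vectorsP pK a w1 w2) w3).
move=> j; have x1 := hf_vec (hF v1) (s + j%:~R); have x2 := hf_vec (hF v2) (s + j%:~R).
have x3 := hf_vec (hF v3) (s + j%:~R).
pose c : R[i] := (Num.sqrt `|s + j%:~R|)%:C%C.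
have -> : (a *: T s phi + T s psi - T s (a *: phi + psi)) j =
    c *: (a *: hat F phi (s + j%:~R) + hat F psi (s + j%:~R) - hat F (a *: phi + psi) (s + j%:~R)).
  rewrite scalerBr scalerDr !scalerA [c * a]mulrC -!scalerA; reflexivity.
by rewrite (sqnormZ pHS _ (vectorsB pHS (vectorsP pHS a x1 x2) x3)) h mulr0.
Qed.

Lemma fiber_translate (l : int) phi : vectors (L2heis R) phi ->
  {ae leb, forall s, U s ->
    sqnorm (cis (2 * pi * s * l%:~R) *: T s phi - T s (translate (0, 0, l%:~R) phi)) = 0}.
Proof.
move=> v1; have v2 := (translate_L2 (0, 0, l%:~R) v1).1.
have := ae_shift_int (hat_translate eb FF l%:~R v1).
move=> /(ae_and (ae_and (fiber_ae v1) (fiber_ae v2))).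
apply: ae_imply => s [[h1 h2] h] Us; have w1 := h1 Us; have w2 := h2 Us.
apply: ell2_null; first exact: (vectorsB pK (vectorsZ pK _ w1) w2).
move=> j; have x1 := hf_vec (hF v1) (s + j%:~R); have x2 := hf_vec (hF v2) (s + j%:~R).
(* The character takes one value on all points s + j of a fibre because j l is an integer. *)
have E : cis (2 * pi * s * l%:~R) = cis (2 * pi * (s + j%:~R) * l%:~R) :> R[i].
  have -> : 2 * pi * (s + j%:~R) * l%:~R = 2 * pi * s * l%:~R + 2 * pi * (j * l)%:~R :> R.
    by rewrite intrM; ring.
  by rewrite cisD cis_2pi_int mulr1.
pose c : R[i] := (Num.sqrt `|s + j%:~R|)%:C%C; pose d : R[i] := cis (2 * pi * s * l%:~R).
have -> : (d *: T s phi - T s (translate (0, 0, l%:~R) phi)) j =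
    c *: (d *: hat F phi (s + j%:~R) - hat F (translate (0, 0, l%:~R) phi) (s + j%:~R)).
  rewrite scalerBr !scalerA [c * d]mulrC -!scalerA; reflexivity.
rewrite (sqnormZ pHS _ (vectorsB pHS (vectorsZ pHS d x1) x2)) /d E h mulr0; reflexivity.
Qed.

Lemma fiberization_fourier :
  fiberization T (fun l : int => translate (0, 0, l%:~R)).
Proof.
split.
- exact: prehilb_L2.
- exact: pK.
- by move=> l u vu; exact: (translate_L2 _ vu).1.
- exact: measurable_fiber_inner.
- exact: fiber_ae.
- exact: fiber_isometry.
- exact: fiber_comb.
- exact: fiber_translate.
Qed.

End Fiberization.

(** * Transfer of frame bounds from the fibres *)

Section FiberizationTheory.
Context {R : realType} (H K : hspace R) (T : R -> H -> K) (tr : int -> H -> H).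
Hypothesis fz : fiberization T tr.
Local Notation leb := (@lebesgue_measure R).
Local Notation U := (`[0%R, 1%R]%classic : set R).
Implicit Types (u v w : H) (s : R).

Let pH := fz_H fz.
Let pK := fz_K fz.
Let mU : measurable (U : set (measurableTypeR R)) := measurable_itv _.

Lemma Rintegral_ae (f g : R -> R) : measurable_fun setT f -> measurable_fun setT g ->
  {ae leb, forall s, U s -> f s = g s} -> \int[leb]_(s in U) f s = \int[leb]_(s in U) g s.
Proof.
move=> mf mg ae; congr fine; apply: ae_eq_integral => //.
- exact/measurable_EFinP/measurable_funTS.
- exact/measurable_EFinP/measurable_funTS.
by apply: ae_imply ae => s h Us; rewrite h.
Qed.

Lemma measurable_fz_sqnorm u : vectors H u -> measurable_fun setT (fun s => sqnorm (T s u)).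
Proof. by move=> vu; exact: (fz_meas fz vu vu).1. Qed.

(** The absolute value makes the integrand nonnegative everywhere: on the exceptional set [T s u]
    need not be a vector, and the sign of [sqnorm] is then not guaranteed. *)
Lemma integral_fz_abs u : vectors H u ->
  (\int[leb]_(s in U) `|sqnorm (T s u)|%:E = (sqnorm u)%:E)%E.
Proof.
move=> vu; rewrite -(fz_iso fz vu); have m := measurable_fz_sqnorm vu.
apply: ae_eq_integral => //.
- exact/measurable_EFinP/measurable_funTS/measurableT_comp.
- exact/measurable_EFinP/measurable_funTS.
by apply: ae_imply (fz_vec fz vu) => s h Us; rewrite ger0_norm ?(sqnorm_ge0 pK (h Us)).
Qed.

Lemma integrable_fz u : vectors H u -> leb.-integrable U (EFin \o (fun s => sqnorm (T s u))).
Proof.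
move=> vu; apply/integrableP; split.
  by apply/measurable_EFinP/measurable_funTS; exact: measurable_fz_sqnorm vu.
have := ltry (sqnorm u); rewrite -(integral_fz_abs vu); exact: id.
Qed.

Lemma fz_comb_sqnorm (a : R[i]) u v : vectors H u -> vectors H v ->
  {ae leb, forall s, U s -> [/\ vectors K (T s u), vectors K (T s v),
     vectors K (T s (a *: u + v)) & sqnorm (a *: T s u + T s v - T s (a *: u + v)) = 0]}.
Proof.
move=> vu vv; have vw := vectorsP pH a vu vv.
apply: ae_imply (ae_and (ae_and (fz_vec fz vu) (fz_vec fz vv))
  (ae_and (fz_vec fz vw) (fz_comb fz a vu vv))) => s [[h1 h2] [h3 h4]] Us.
by split; [exact: h1|exact: h2|exact: h3|exact: h4].
Qed.

(** Formed with the image of the combination, so that its integral follows from the isometry; almost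
    everywhere it is the polarized expression in [K]. *)
Definition fz_polar (c : R[i]) u v s : R :=
  (sqnorm (T s (c *: v + u)) - sqnorm (T s u) - sqnorm (T s v)) / 2.

Lemma measurable_fz_polar c u v : vectors H u -> vectors H v ->
  measurable_fun setT (fz_polar c u v).
Proof.
move=> vu vv; have vw := vectorsP pH c vv vu.
have m1 := measurable_fz_sqnorm vu; have m2 := measurable_fz_sqnorm vv.
have m3 := measurable_fz_sqnorm vw.
by apply: measurable_funM => //; exact: measurable_funB (measurable_funB m3 m1) m2.
Qed.

Lemma integral_fz_polar c u v : vectors H u -> vectors H v ->
  \int[leb]_(s in U) fz_polar c u v s = (sqnorm (u + c *: v) - sqnorm u - sqnorm v) / 2.
Proof.
move=> vu vv; have vw := vectorsP pH c vv vu.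
have i1 := integrable_fz vu; have i2 := integrable_fz vv; have i3 := integrable_fz vw.
have i4 : leb.-integrable U (EFin \o (fun s => sqnorm (T s (c *: v + u)) - sqnorm (T s u))).
  exact: integrableB i3 i1.
have i5 : leb.-integrable U (EFin \o (fun s => sqnorm (T s (c *: v + u)) - sqnorm (T s u) - sqnorm (T s v))).
  exact: integrableB i4 i2.
rewrite (RintegralZr _ mU i5) (RintegralB mU i4 i2) (RintegralB mU i3 i1).
have E w : vectors H w -> \int[leb]_(s in U) sqnorm (T s w) = sqnorm w.
  by move=> vw'; rewrite /Rintegral (fz_iso fz vw').
by rewrite !E // [c *: v + u]addrC.
Qed.

Lemma fz_polarE c u v : vectors H u -> vectors H v ->
  {ae leb, forall s, U s -> [/\ vectors K (T s u), vectors K (T s v) &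
     fz_polar c u v s = (sqnorm (T s u + c *: T s v) - sqnorm (T s u) - sqnorm (T s v)) / 2]}.
Proof.
move=> vu vv; apply: ae_imply (fz_comb_sqnorm c vv vu) => s h Us.
have [h1 h2 h3 h4] := h Us; split=> //; rewrite /fz_polar.
by rewrite -(sqnorm_congr pK (vectorsP pK c h1 h2) h3 h4) [c *: _ + _]addrC.
Qed.

Lemma fz_inner u v : vectors H u -> vectors H v ->
  inner u v = Complex (\int[leb]_(s in U) complex.Re (inner (T s u) (T s v)))
                      (\int[leb]_(s in U) complex.Im (inner (T s u) (T s v))).
Proof.
move=> vu vv; have [mr mi] := fz_meas fz vu vv; apply: complex_eqP => /=.
- rewrite (ReinnerE pH vu vv) -[v in u + v]scale1r -(integral_fz_polar 1 vu vv).
  apply: Rintegral_ae => //; first exact: measurable_fz_polar.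
  apply: ae_imply (fz_polarE 1 vu vv) => s h Us; have [h1 h2 ->] := h Us.
  by rewrite scale1r (ReinnerE pK h1 h2).
- rewrite (IminnerE pH vu vv) -(integral_fz_polar 'i%C vu vv).
  apply: Rintegral_ae => //; first exact: measurable_fz_polar.
  apply: ae_imply (fz_polarE 'i%C vu vv) => s h Us; have [h1 h2 ->] := h Us.
  by rewrite (IminnerE pK h1 h2).
Qed.

Definition fz_gram u v : L2real R := cut (fun s => inner (T s u) (T s v)).

(** The integers act on fibres by characters, so the inner products of [u] with all translates of
    [v] are Fourier coefficients of one function on [0, 1]. *)
Lemma fz_coef u v l : vectors H u -> vectors H v ->
  inner u (tr l v) = @inner R (L2real R) (fz_gram u v) (trig l).
Proof.
move=> vu vv; have vt := fz_tr fz l vv; rewrite (fz_inner vu vt) inner_cut.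
have mc : cmeasurable setT (fun s : R => (cis (2 * pi * l%:~R * s))^*%C).
  by apply: cmeasurableJ; apply: measurable_cis; exact: measurable_funM.
have [mr mi] := cmeasurableM (fz_meas fz vu vv) mc; have [mr' mi'] := fz_meas fz vu vt.
have ae : {ae leb, forall s, U s -> inner (T s u) (T s (tr l v)) =
    inner (T s u) (T s v) * (cis (2 * pi * l%:~R * s))^*%C}.
  apply: ae_imply (ae_and (ae_and (fz_vec fz vu) (fz_vec fz vv))
    (ae_and (fz_vec fz vt) (fz_char fz l vv))) => s [[h1 h2] [h3 h4]] Us.
  have w1 := h1 Us; have w2 := h2 Us; have w3 := h3 Us.
  have w4 := vectorsZ pK (cis (2 * pi * s * l%:~R)) w2.
  rewrite (innerC pK w3 w1) -(inner_congr pK w4 w3 w1 (h4 Us)).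
  by rewrite -(innerC pK w4 w1) (innerZr pK _ w2 w1) mulrC [2 * pi * s * _]mulrAC.
by congr Complex; apply: Rintegral_ae => //; apply: ae_imply ae => s h Us; rewrite h.
Qed.

Lemma integral_fz_gram u v : (\int[leb]_s (sqmod (fz_gram u v s))%:E =
  \int[leb]_(s in U) (sqmod (inner (T s u) (T s v)))%:E)%E.
Proof.
rewrite [RHS]integral_mkcond; apply: eq_integral => s _; rewrite patchE.
case: ifPn => [/set_mem Us|/negP Us]; first by rewrite /fz_gram cutE.
by rewrite /fz_gram cut0 ?sqmod0 // => /mem_set.
Qed.

(** An inner product of fibres is in general only integrable in [s]. The pointwise bound, to be
    supplied by the upper frame inequality, dominates its square by a multiple of |T s u|^2, which
    the isometry makes integrable. *)
Lemma vec_fz_gram (B : R) u v : vectors H u -> vectors H v -> 0 <= B ->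
  {ae leb, forall s, U s -> sqmod (inner (T s u) (T s v)) <= B * sqnorm (T s u)} ->
  vectors (L2real R) (fz_gram u v).
Proof.
move=> vu vv B0 ae; have m := fz_meas fz vu vv; split; first exact: cmeasurable_cut.
rewrite integral_fz_gram.
have mn := measurable_fz_sqnorm vu.
apply: (@le_lt_trans _ _ (\int[leb]_(s in U) (B * `|sqnorm (T s u)|)%:E)%E).
  apply: ae_ge0_le_integral => //.
  - by move=> s _; rewrite lee_fin sqmod_ge0.
  - exact/measurable_EFinP/measurable_funTS/measurable_sqmod.
  - by move=> s _; rewrite lee_fin mulr_ge0.
  - apply/measurable_EFinP/measurable_funTS/measurable_funM => //.
    exact: measurableT_comp.
  apply: ae_imply ae => s h Us; rewrite lee_fin; apply: le_trans (h Us) _.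
  by apply: ler_wpM2l => //; exact: ler_norm.
under eq_integral => s _ do rewrite EFinM.
rewrite ge0_integralZl ?lee_fin //.
- by rewrite (integral_fz_abs vu) -EFinM ltry.
- exact/measurable_EFinP/measurable_funTS/measurableT_comp.
Qed.

Lemma fz_parseval u v : vectors H u -> vectors H v -> vectors (L2real R) (fz_gram u v) ->
  (\esum_(l in [set: int]) (sqmod (inner u (tr l v)))%:E =
   \int[leb]_(s in U) (sqmod (inner (T s u) (T s v)))%:E)%E.
Proof.
move=> vu vv vg; rewrite -integral_fz_gram (sqnorm_L2E vg).
rewrite -(parseval_trig vg); last by move=> s Us; exact: cut0.
by apply: eq_esum => l _; rewrite fz_coef.
Qed.

Lemma closed_span_congr (J : Type) (I : set J) (f : J -> K) x y :
  (forall j, I j -> vectors K (f j)) -> closed_span I f x -> vectors K y ->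
  sqnorm (y - x) = 0 -> closed_span I f y.
Proof.
move=> vf cx vy h; apply: (closed_span_lim pK vf vy) => eps e0.
by exists x => //; rewrite h.
Qed.

Lemma fz_null u : vectors H u -> sqnorm u = 0 ->
  {ae leb, forall s, U s -> vectors K (T s u) /\ sqnorm (T s u) = 0}.
Proof.
move=> vu u0; have m := measurable_fz_sqnorm vu.
have mE : measurable_fun U (fun s => (sqnorm (T s u))%:E).
  exact/measurable_EFinP/measurable_funTS.
have /(ae_eq_integral_abs leb mU mE) ae : (\int[leb]_(s in U) `|(sqnorm (T s u))%:E| = 0)%E.
  by rewrite (integral_fz_abs vu) u0.
apply: ae_imply (ae_and ae (fz_vec fz vu)) => s [h1 h2] Us; split; first exact: h2.
by case: (h1 Us).
Qed.

Section ClosedSpans.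
Context (J J' : Type) (I : set J) (I' : set J') (f : J -> H) (g : J' -> H).
Hypothesis vf : forall j, I j -> vectors H (f j).
Hypothesis gf : forall j', I' j' -> exists j l, I j /\ g j' = tr l (f j).
Hypothesis vTf : {ae leb, forall s, U s -> forall j, I j -> vectors K (T s (f j))}.

(** Up to a null vector, the fibre of a translate of [f j] is a unimodular multiple of [T s (f j)],
    so it lies in the same span. A finite combination adds only finitely many exceptional sets. *)
Lemma fz_span w : in_span I' g w ->
  vectors H w /\ {ae leb, forall s, U s -> closed_span I (fun j => T s (f j)) (T s w)}.
Proof.
move=> [n [i [c [Ii ->]]]].
pose P w := vectors H w /\
  {ae leb, forall s, U s -> closed_span I (fun j => T s (f j)) (T s w)}.
change (P (\sum_(k < n) c k *: g (i k))).
apply: big_rec => [|k w' _ [vw aw]].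
  split; first exact: vectors0 pH.
  apply: ae_imply (ae_and vTf (fz_null (vectors0 pH) (sqnorm0 pH))) => s [h1 h2] Us.
  have [w1 w2] := h2 Us; exact: (closed_span_null _ _ w1 w2).
have [j [l [Ij E]]] := gf (Ii k); have vt := fz_tr fz l (vf Ij).
rewrite E; split; first exact: (vectorsP pH).
apply: ae_imply (ae_and (ae_and vTf aw) (ae_and (ae_and (fz_char fz l (vf Ij)) (fz_vec fz vt))
  (fz_comb_sqnorm (c k) vt vw))) => s [[h1 h2] [[h3 h3'] h4]] Us.
have hv := h1 Us; have [w1 w2 w3 w4] := h4 Us.
have c1 : closed_span I (fun j => T s (f j)) (T s (tr l (f j))).
  have cj := closed_spanZ pK hv (cis (2 * pi * s * l%:~R)) (closed_span_mem pK hv Ij).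
  apply: (closed_span_congr hv cj w1).
  by rewrite (sqnormBC pK w1) ?h3 //; exact: (vectorsZ pK _ (hv _ Ij)).
have c2 := closed_span_comb pK hv (c k) c1 (h2 Us).
apply: (closed_span_congr hv c2 w3).
by rewrite (sqnormBC pK w3 (vectorsP pK (c k) w1 w2)).
Qed.

(* Approximants [x n] of [u] in the span with [|u - x n|^2 < 2^-(n+1)] have summable
   fibre errors for almost every [s]. *)
Lemma fz_closed_span u : closed_span I' g u ->
  {ae leb, forall s, U s -> closed_span I (fun j => T s (f j)) (T s u)}.
Proof.
move=> [vu hu].
have /choice [x hx] : forall n : nat, exists x, in_span I' g x /\ sqnorm (u - x) < 1 / (2 ^ n.+1)%:R.
  move=> n; have e0 : 0 < 1 / (2 ^ n.+1)%:R :> R by rewrite divr_gt0 // ltr0n expn_gt0.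
  by have [x sx ux] := hu _ e0; exists x.
have sx n := fz_span (hx n).1; have vx n := (sx n).1.
pose w n := -1 *: x n + u.
have vw n : vectors H (w n) := vectorsP pH (-1) (vx n) vu.
have ws n : sqnorm (w n) < 1 / (2 ^ n.+1)%:R.
  by have := (hx n).2; rewrite /w scaleN1r addrC.
pose h n s := `|sqnorm (T s (w n))|%:E.
have mh n : measurable_fun U (h n).
  apply/measurable_EFinP/measurable_funTS/measurableT_comp => //.
  exact: measurable_fz_sqnorm.
have h0 n s : U s -> (0 <= h n s)%E by rewrite lee_fin.
have mS : measurable_fun U (fun s => \sum_(n <oo) h n s)%E.
  apply: ge0_emeasurable_sum => [n s Us _|n _]; [exact: h0|exact: mh].
have S0 s : (0 <= \sum_(n <oo) h n s)%E by apply: nneseries_ge0 => n _ _; rewrite lee_fin.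
have fin : (\int[leb]_(s in U) \sum_(n <oo) h n s < +oo)%E.
  rewrite (integral_nneseries leb mU mh h0).
  apply: (@le_lt_trans _ _ (\sum_(n <oo) (1 / (2 ^ n.+1)%:R)%:E)%E).
    apply: lee_nneseries => [n _ _|n _]; first by apply: integral_ge0 => s Us; exact: h0.
    by rewrite (integral_fz_abs (vw n)) lee_fin ltW.
  by apply: le_lt_trans (epsilon_trick0 xpredT ler01) _; rewrite ltry.
have ifin : leb.-integrable U (fun s => \sum_(n <oo) h n s)%E.
  apply/integrableP; split=> //.
  have E : (\int[leb]_(s in U) `|\sum_(n <oo) h n s| = \int[leb]_(s in U) \sum_(n <oo) h n s)%E.
    by apply: eq_integral => s _; rewrite gee0_abs.
  by move: fin; rewrite -E.
have A1 := ae_all (fun n => (sx n).2).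
have A2 := ae_all (fun n => fz_comb_sqnorm (-1) (vx n) vu).
apply: ae_imply (ae_and (ae_and vTf (integrable_ae mU ifin)) (ae_and A1 A2)) => s [[h1 h2] [h3 h4]] Us.
have hv := h1 Us; have [_ vTu _ _] := h4 0%N Us.
apply: (closed_span_lim pK hv vTu) => eps e0.
have bound k : \sum_(i < k) `|sqnorm (T s (w i))| <= fine (\sum_(n <oo) h n s)%E.
  rewrite -lee_fin fineK ?h2 // -sumEFin -(big_mkord xpredT (fun i => h i s)).
  by apply: nneseries_lim_ge => n _ _; rewrite lee_fin.
have [n hn] := @exists_small R (fun n => `|sqnorm (T s (w n))|) _ _ bound e0; exists (T s (x n)); first exact: h3.
have [w1 w2 w3 w4] := h4 n Us.
move: w4; rewrite scaleN1r [- _ + _]addrC => w4.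
rewrite (sqnorm_congr pK (vectorsB pK w2 w1) w3 w4).
exact: le_lt_trans (ler_norm _) hn.
Qed.

End ClosedSpans.

End FiberizationTheory.

(** * Sums along a map with finite fibres, and facts on null sets *)

Section CountableSums.
Context {R : realType}.

Lemma esum_ge_term (J : choiceType) (I : set J) (a : J -> \bar R) j :
  I j -> (0 <= a j)%E -> (a j <= \esum_(i in I) a i)%E.
Proof.
move=> Ij a0; apply: esum_ge; exists [set j].
  by split; [exact: finite_set1|move=> _ ->].
by rewrite fsbig_set1.
Qed.

Lemma esum_cst_le (J : choiceType) (I : set J) (c : R) (M : nat) : 0 <= c ->
  (forall s : seq J, uniq s -> (forall j, j \in s -> I j) -> (size s <= M)%N) ->
  (\esum_(j in I) c%:E <= M%:R%:E * c%:E)%E.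
Proof.
move=> c0 h; apply: ge_ereal_sup => _ [X [fX XI] <-].
rewrite fsbig_finite //= sumEFin big_const_seq count_predT iter_addr_0 -EFinM lee_fin.
rewrite -[c *+ _]mulr_natl; apply: ler_wpM2r => //; rewrite ler_nat; apply: h; first exact: fset_uniq.
by move=> j; rewrite in_fset_set // => /set_mem /XI.
Qed.

(** The sum over [D], grouped by the value of [g], counts each [h y] at least once and at most [M]
    times. *)
Lemma esum_fibers (X Y : choiceType) (D : set X) (E : set Y) (g : X -> Y) (h : Y -> R) (M : nat) :
  (forall y, 0 <= h y) -> (forall x, D x -> E (g x)) ->
  (forall y, E y -> exists2 x, D x & g x = y) ->
  (forall y s, E y -> uniq s -> (forall x, x \in s -> D x /\ g x = y) -> (size s <= M)%N) ->
  (\esum_(y in E) (h y)%:E <= \esum_(x in D) (h (g x))%:E)%E /\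
  (\esum_(x in D) (h (g x))%:E <= M%:R%:E * \esum_(y in E) (h y)%:E)%E.
Proof.
move=> h0 gD gE hM; pose fib y := D `&` [set x | g x = y].
have -> : (\esum_(x in D) (h (g x))%:E = \esum_(y in E) \esum_(x in fib y) (h y)%:E)%E.
  rewrite esum_esum; last by move=> y x _ _; rewrite lee_fin.
  rewrite (reindex_esum (E `*`` fib) D snd).
    by apply: eq_esum => -[y x] [_ [_ /= <-]].
  split.
  - by move=> [y x] [_ []].
  - by move=> [y x] [y' x'] /set_mem [_ [_ /= <-]] /set_mem [_ [_ /= <-]] ->.
  - by move=> x Dx; exists (g x, x) => //; split=> //=; exact: gD.
split.
  apply: le_esum => y Ey; have [x Dx gx] := gE _ Ey.
  have fx : fib y x by [].
  by apply: (@esum_ge_term _ (fib y) (fun=> (h y)%:E) x) => //; rewrite lee_fin.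
pose h' y := if y \in E then h y else 0.
have hE : (\esum_(y in E) (h y)%:E = \esum_(y in setT) (h' y)%:E)%E.
  by rewrite esum_mkcond; apply: eq_esum => y _; rewrite /h'; case: ifP.
have h'0 y : 0 <= h' y by rewrite /h'; case: ifP.
rewrite hE -esumZ // [leLHS]esum_mkcond; apply: le_esum => y _; rewrite /h' EFinM.
case: ifPn => [/set_mem Ey|_]; last by rewrite mule0.
by apply: esum_cst_le => // s us sf; apply: (hM y).
Qed.

End CountableSums.

(** [0, 1] is not null. This extracts facts that do not depend on the fibre, such as the positivity
    of the lower bound. *)
Lemma ae_exists (R : realType) (P : R -> Prop) :
  {ae (@lebesgue_measure R), forall s, `[0%R, 1%R]%classic s -> P s} ->
  exists2 s, `[0%R, 1%R]%classic s & P s.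
Proof.
move=> ae; apply: contrapT => no.
have ng : (@lebesgue_measure R).-negligible (`[0%R, 1%R]%classic : set R).
  by apply: negligibleS ae => s Us /(_ Us) Ps; apply: no; exists s.
have mU : measurable (`[0%R, 1%R]%classic : set (measurableTypeR R)) by exact: measurable_itv.
have := @measure_negligible _ (measurableTypeR R) R (@lebesgue_measure R) _ mU ng.
by move=> E; have := @lebesgue_U R; rewrite E => /esym/eqP; rewrite onee_eq0.
Qed.

Lemma ae_all_seq d (T : measurableType d) (R : realType) (mu : {measure set T -> \bar R})
    (J : eqType) (X : seq J) (P : J -> T -> Prop) :
  (forall j, j \in X -> {ae mu, forall x, P j x}) ->
  {ae mu, forall x, forall j, j \in X -> P j x}.
Proof.
elim: X => [|j X IH] h; first exact: aeT.
have h1 := h j (mem_head _ _).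
have h2 := IH (fun i iX => h i (@mem_behead _ (j :: X) i iX)).
by apply: ae_imply (ae_and h1 h2) => x [p1 p2] i; rewrite inE => /orP[/eqP->//|]; exact: p2.
Qed.

(** * Integration of the frame inequalities, and the bound on multiplicities *)

Section FrameTransfer.
Context {R : realType} (H K : hspace R) (T : R -> H -> K) (tr : int -> H -> H).
Hypothesis fz : fiberization T tr.
Local Notation leb := (@lebesgue_measure R).
Local Notation U := (`[0%R, 1%R]%classic : set R).
Context (J : choiceType) (I : set J) (cI : countable I) (f : J -> H).
Hypothesis vf : forall j, I j -> vectors H (f j).
Context (A B : R).
Hypothesis frames : {ae leb, forall s, U s -> span_frame_bounds I (fun j => T s (f j)) A B}.
Implicit Types (u w : H) (s : R).

Let pK := fz_K fz.
Let mU : measurable (U : set (measurableTypeR R)) := measurable_itv _.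

Lemma frame_bounds_pos : 0 < A /\ A <= B.
Proof. by have [s _ []] := ae_exists frames. Qed.

Let vTf : {ae leb, forall s, U s -> forall j, I j -> vectors K (T s (f j))}.
Proof. by apply: ae_imply frames => s h Us; case: (h Us). Qed.

Lemma integral_fz_scale (c : R) u : vectors H u -> 0 <= c ->
  (\int[leb]_(s in U) (c * `|sqnorm (T s u)|)%:E = (c * sqnorm u)%:E)%E.
Proof.
move=> vu c0; under eq_integral => s _ do rewrite EFinM.
rewrite ge0_integralZl ?lee_fin //.
- by rewrite (integral_fz_abs fz vu) -EFinM.
- by apply/measurable_EFinP/measurable_funTS/measurableT_comp => //; exact: (measurable_fz_sqnorm fz).
Qed.

(** On almost every fibre the inequalities apply to [T s u], which lies in the fibre span. Their
    middle term integrates to the double sum, by Parseval in [l] for each [j]. *)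
Lemma fz_frame (J' : Type) (I' : set J') (g : J' -> H) u :
  (forall j', I' j' -> exists j l, I j /\ g j' = tr l (f j)) -> closed_span I' g u ->
  ((A * sqnorm u)%:E <=
     \esum_(j in I) \esum_(l in [set: int]) (sqmod (inner u (tr l (f j))))%:E)%E /\
  (\esum_(j in I) \esum_(l in [set: int]) (sqmod (inner u (tr l (f j))))%:E <=
     (B * sqnorm u)%:E)%E.
Proof.
move=> gf cu; have vu := cu.1; have [A0 AB] := frame_bounds_pos.
have B0 : 0 <= B by rewrite (le_trans (ltW A0)).
have ae : {ae leb, forall s, U s -> [/\ 0 <= sqnorm (T s u),
    ((A * sqnorm (T s u))%:E <= \esum_(j in I) (sqmod (inner (T s u) (T s (f j))))%:E)%E &
    (\esum_(j in I) (sqmod (inner (T s u) (T s (f j))))%:E <= (B * sqnorm (T s u))%:E)%E]}.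
  apply: ae_imply (ae_and frames (fz_closed_span fz vf gf vTf cu)) => s [h1 h2] Us.
  have [_ _ _ /(_ _ (h2 Us)) []] := h1 Us; split=> //.
  by apply: (sqnorm_ge0 pK); case: (h2 Us).
have m j : I j -> measurable_fun U (fun s => (sqmod (inner (T s u) (T s (f j))))%:E).
  by move=> Ij; apply/measurable_EFinP/measurable_funTS/measurable_sqmod; exact: (fz_meas fz vu (vf Ij)).
have -> : (\esum_(j in I) \esum_(l in [set: int]) (sqmod (inner u (tr l (f j))))%:E =
    \int[leb]_(s in U) \esum_(j in I) (sqmod (inner (T s u) (T s (f j))))%:E)%E.
  rewrite integral_esum //; last by move=> j s _; rewrite lee_fin sqmod_ge0.
  apply: eq_esum => j Ij; apply: (fz_parseval fz vu (vf Ij)).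
  (* A single term is at most the whole fibre sum, hence at most [B * sqnorm (T s u)]. *)
  apply: (vec_fz_gram fz vu (vf Ij) B0); apply: ae_imply ae => s h Us.
  have [_ _ h3] := h Us; rewrite -lee_fin; apply: le_trans h3.
  by apply: (@esum_ge_term R J I (fun j => (sqmod (inner (T s u) (T s (f j))))%:E)); rewrite ?lee_fin ?sqmod_ge0.
have mS : measurable_fun U (fun s => \esum_(j in I) (sqmod (inner (T s u) (T s (f j))))%:E)%E.
  by apply: measurable_esum => // j s _; rewrite lee_fin sqmod_ge0.
have S0 s : (0 <= \esum_(j in I) (sqmod (inner (T s u) (T s (f j))))%:E)%E.
  by apply: esum_ge0 => j _; rewrite lee_fin sqmod_ge0.
have mc (c : R) : measurable_fun U (fun s => (c * `|sqnorm (T s u)|)%:E).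
  apply/measurable_EFinP/measurable_funTS/measurable_funM => //.
  by apply: measurableT_comp => //; exact: (measurable_fz_sqnorm fz).
split.
- rewrite -(integral_fz_scale vu (ltW A0)); apply: ae_ge0_le_integral => //.
  + by move=> s _; rewrite lee_fin mulr_ge0 // ltW.
  + exact: mc.
  + by apply: ae_imply ae => s h Us; have [n0 h2 _] := h Us; rewrite ger0_norm.
- rewrite -(integral_fz_scale vu B0); apply: ae_ge0_le_integral => //.
  + by move=> s _; rewrite lee_fin mulr_ge0.
  + exact: mc.
  + by apply: ae_imply ae => s h Us; have [n0 _ h3] := h Us; rewrite ger0_norm.
Qed.

(* If [T s w] is nonzero, the vectors [T s (f j)], [j] in [X], are unimodular multiples of it,
   and the upper frame bound applied to one of them limits their number. *)
Lemma multiplicity_bound (X : seq J) w : uniq X -> vectors H w ->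
  (forall j, j \in X -> I j /\ exists l, f j = tr l w) ->
  (size X)%:R * sqnorm w <= B.
Proof.
move=> uX vw hX; have [A0 AB] := frame_bounds_pos.
have B0 : 0 <= B by rewrite (le_trans (ltW A0)).
have ae1 : {ae leb, forall s, forall j, j \in X -> U s ->
    exists c, sqmod c = 1 /\ sqnorm (c *: T s w - T s (f j)) = 0}.
  apply: ae_all_seq => j jX; have [_ [l ->]] := hX _ jX.
  apply: ae_imply (fz_char fz l vw) => s h Us; exists (cis (2 * pi * s * l%:~R)).
  by rewrite sqmod_cis; split=> //; exact: h.
have ae : {ae leb, forall s, U s -> (size X)%:R * `|sqnorm (T s w)| <= B}.
  apply: ae_imply (ae_and ae1 (ae_and frames (fz_vec fz vw))) => s [h1 [h2 h3]] Us.
  have [_ _ vT up] := h2 Us; have vy := h3 Us; have y0 := sqnorm_ge0 pK vy.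
  rewrite ger0_norm //.
  have [->|[j0 j0X]] : X = [::] \/ exists j0, j0 \in X.
  - by case: (X) => [|j0 X']; [left|right; exists j0; exact: mem_head].
  - by rewrite mul0r.
  have [yz|yn] := eqVneq (sqnorm (T s w)) 0; first by rewrite yz mulr0.
  have y1 : 0 < sqnorm (T s w) by rewrite lt_neqAle eq_sym yn.
  have norms j : j \in X -> sqmod (inner (T s (f j0)) (T s (f j))) = sqnorm (T s w) ^+ 2.
    move=> jX; have [c [c1 cE]] := h1 _ jX Us; have [c0 [c01 c0E]] := h1 _ j0X Us.
    have v1 := vT _ (hX _ jX).1; have v0 := vT _ (hX _ j0X).1.
    rewrite -(inner_congr2 pK (vectorsZ pK c0 vy) v0 (vectorsZ pK c vy) v1 c0E cE).
    rewrite (innerZl pK _ vy (vectorsZ pK c vy)) (innerZr pK _ vy vy) !sqmodM sqmodJ c1 c01 !mul1r.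
    by rewrite (inner_self pK vy) /sqmod /= expr0n addr0.
  have [_ ub] := up _ (closed_span_mem pK vT (hX _ j0X).1).
  have n0 : sqnorm (T s (f j0)) = sqnorm (T s w).
    have [c0 [c01 c0E]] := h1 _ j0X Us.
    rewrite -(sqnorm_congr pK (vectorsZ pK c0 vy) (vT _ (hX _ j0X).1) c0E).
    by rewrite (sqnormZ pK _ vy) c01 mul1r.
  (* Each of the terms indexed by [X] in the frame sum of [T s (f j0)] equals |T s w|^4, while the
     upper bound is B |T s w|^2. *)
  have : (((size X)%:R * sqnorm (T s w) ^+ 2)%:E <= (B * sqnorm (T s w))%:E)%E.
    rewrite -[in leRHS]n0; apply: le_trans ub; apply: esum_ge.
    exists [set` X]; first by split; [exact: finite_seq|move=> j /= jX; exact: (hX _ jX).1].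
    rewrite -fsbig_seq // (eq_big_seq (fun=> (sqnorm (T s w) ^+ 2)%:E)); last first.
      by move=> j jX; rewrite norms.
    by rewrite sumEFin big_const_seq count_predT iter_addr_0 mulr_natl.
  by rewrite lee_fin expr2 mulrA ler_pM2r.
have m : measurable_fun U (fun s => ((size X)%:R * `|sqnorm (T s w)|)%:E).
  apply/measurable_EFinP/measurable_funTS/measurable_funM => //.
  by apply: measurableT_comp => //; exact: (measurable_fz_sqnorm fz).
(* The fibre bound by [B] is integrated over an interval of length 1, and the isometry gives back
   the norm of [w]. *)
rewrite -lee_fin -(integral_fz_scale vw (ler0n R (size X))).
rewrite -[leRHS](integral_cst01 B%:E); exact: ae_ge0_le_integral.
Qed.

End FrameTransfer.

(** A point is coded by some [k] for which no other point of [S] is within 2 / (k + 1) in all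
    coordinates, and by rationals within 1 / (k + 1) of its coordinates. Two points with the same
    code are within 2 / (k + 1), hence equal. *)
Lemma discrete_countable (R : realType) (S : set (heis R)) : discrete_set S -> countable S.
Proof.
move=> dS.
pose near_center (k : nat) (c : rat) (x : R) := `|x - ratr c| < k.+1%:R^-1.
have ex (k : nat) (x : R) : exists c, near_center k c x.
  have k0 : 0 < k.+1%:R^-1 :> R by rewrite invr_gt0.
  rewrite /near_center; move: (k.+1%:R^-1) k0 => r r0.
  have [|c] := @rat_in_itvoo R (x - r) (x + r); first by lra.
  rewrite in_itv /= => /andP[c1 c2]; exists c; rewrite ltr_norml.
  by apply/andP; split; lra.
pose good (x : heis R) (d : rat * rat * rat * nat) :=
  [/\ near_center d.2 d.1.1.1 x.1.1, near_center d.2 d.1.1.2 x.1.2, near_center d.2 d.1.2 x.2 &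
   forall y, S y -> `|x.1.1 - y.1.1| < 2 * d.2.+1%:R^-1 -> `|x.1.2 - y.1.2| < 2 * d.2.+1%:R^-1 ->
     `|x.2 - y.2| < 2 * d.2.+1%:R^-1 -> y = x].
have /choice [D hD] : forall x, exists d, S x -> good x d.
  move=> x; have [Sx|nS] := pselect (S x); last by exists (0, 0, 0, 0%N).
  have [_ [V nV VS]] := dS _ Sx.
  have /nbhs_ballP [eps /= e0 ballV] := nV.
  have [k hk] : exists k : nat, 2 * k.+1%:R^-1 < eps.
    exists (Num.bound (2 / eps)); rewrite ltr_pdivrMr // mulrC -ltr_pdivrMr //.
    apply: lt_le_trans (archi_boundP _) _; first by rewrite divr_ge0 ?ltW.
    by rewrite ler_nat.
  have [c1 h1] := ex k x.1.1; have [c2 h2] := ex k x.1.2; have [c3 h3] := ex k x.2.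
  exists (c1, c2, c3, k) => _; split=> // y Sy y1 y2 y3.
  have : (V `&` S) y.
    split=> //; apply: ballV; split; first split.
    - exact: lt_trans y1 hk.
    - exact: lt_trans y2 hk.
    - exact: lt_trans y3 hk.
  by rewrite VS.
apply/countable_injP; exists (choice.pickle \o D) => x y /set_mem Sx /set_mem Sy.
move=> /(pcan_inj choice.pickleK) E.
have [x1 x2 x3 hx] := hD _ Sx; have [y1 y2 y3 _] := hD _ Sy; rewrite -E in y1 y2 y3.
have tri (a b c r : R) : `|a - c| < r -> `|b - c| < r -> `|a - b| < 2 * r.
  by rewrite !ltr_norml => /andP[? ?] /andP[? ?]; apply/andP; split; lra.
by apply/esym/hx => //; [exact: tri x1 y1|exact: tri x2 y2|exact: tri x3 y3].
Qed.

(** The closed span contains only null vectors, so all three terms of the frame inequality are 0 and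
    any positive bounds do. *)
Lemma null_span_frame (R : realType) (H : hspace R) (pH : prehilb H) (J : choiceType)
    (I : set J) (f : J -> H) : (forall j, I j -> vectors H (f j)) ->
  (forall j, I j -> sqnorm (f j) = 0) -> span_frame I f.
Proof.
move=> vf f0; exists 1, 1; split=> // u [vu cu].
have span0 s : in_span I f s -> vectors H s /\ sqnorm s = 0.
  move=> [n [i [c [Ii ->]]]]; pose P w := vectors H w /\ sqnorm w = 0.
  change (P (\sum_(k < n) c k *: f (i k))).
  apply: big_rec => [|k w _ [vw w0]]; first by split; [exact: vectors0 pH|exact: sqnorm0 pH].
  have vk := vf _ (Ii k); split; first exact: vectorsP pH _ _ _ vk vw.
  apply: (sqnorm_null_add pH (vectorsZ pH _ vk) vw) => //.
  by rewrite (sqnormZ pH _ vk) f0 // mulr0.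
have u0 : sqnorm u = 0.
  apply/eqP; rewrite eq_le (sqnorm_ge0 pH vu) andbT; apply/ler_addgt0Pr => eps e0.
  have [s /span0 [vs s0] us] := cu _ e0; rewrite add0r.
  rewrite -(sqnorm_congr pH (vectorsB pH vu vs) vu) ?ltW //.
  by rewrite addrAC subrr sub0r (sqnormN pH vs).
rewrite esum1 ?u0 ?mulr0 // => j Ij.
by rewrite (inner_nullr pH vu (vf _ Ij) (f0 _ Ij)) sqmod0.
Qed.

(** * Translations by the centre, and the passage to [Gamma] *)

Section CenterTranslates.
Context {R : realType}.
Implicit Types (k : heis R) (phi : L2heis R).

(** (0, 0, c) is central, so its translation may be applied last, which is how the integers act in
    the fiberization. *)
Lemma translate_hmul_center k (c : R) phi :
  translate (hmul k (0, 0, c)) phi = translate (0, 0, c) (translate k phi).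
Proof.
apply/funext => -[[p q] t]; case: k => [[p0 q0] t0]; rewrite /translate /=.
by congr (phi (_, _, _)); ring.
Qed.

Lemma hmul_center_inj k (c c' : R) : hmul k (0, 0, c) = hmul k (0, 0, c') -> c = c'.
Proof. by case: k => [[p q] t] [] /addIr /addrI. Qed.

Lemma translate_centerN (c : R) phi : translate (0, 0, - c) (translate (0, 0, c) phi) = phi.
Proof.
apply/funext => -[[p q] t]; rewrite !translate_center; congr (phi (_, _, _)); ring.
Qed.

End CenterTranslates.

Theorem theorem2p9 (R : realType)
    (e : nat -> L2real R) (e_basis : orthonormal_basis e)
    (F : L2heis R -> R -> HS e) (F_fourier : fourier_transform F)
    (Gamma1 Gamma : set (heis R)) (V : set (L2heis R))
    (Gamma1_discrete : discrete_set Gamma1)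
    (Gamma_discrete : discrete_set Gamma)
    (GammaE : Gamma = [set hmul x z | x in Gamma1 & z in integer_center R])
    (V_countable : countable V) (V_L2 : V `<=` vectors (L2heis R)) :
  (exists A B : R,
     {ae (@lebesgue_measure R), forall sigma : R, sigma \in `[0, 1] ->
        span_frame_bounds (Gamma1 `*` V)
          (fun kphi => fiber F sigma (translate kphi.1 kphi.2)) A B}) ->
  span_frame (Gamma `*` V)
    (fun gphi : heis R * L2heis R => translate gphi.1 gphi.2).
Proof.
move=> [A [B frames]].
have pH := prehilb_L2 (@haar R).
have fz := fiberization_fourier e_basis F_fourier.
pose I := Gamma1 `*` V; pose f (j : heis R * L2heis R) := translate j.1 j.2.
have vf j : I j -> vectors (L2heis R) (f j) by move=> [_ /V_L2 v]; exact: (translate_L2 _ v).1.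
have cI : countable I by apply: countableX => //; exact: discrete_countable.
(* The fibres are rewritten with [hat], for which the fiberization is available. *)
have frames' : {ae (@lebesgue_measure R), forall s, `[0%R, 1%R]%classic s ->
    span_frame_bounds I (fun j => fiber (hat F) s (f j)) A B}.
  apply: ae_imply frames => s h Us; have := h Us.
  by under eq_fun do rewrite fiber_hat.
have [A0 AB] := frame_bounds_pos frames'; have B0 : 0 < B by exact: lt_le_trans AB.
have vg j : (Gamma `*` V) j -> vectors (L2heis R) (translate j.1 j.2).
  by move=> [_ /V_L2 v]; exact: (translate_L2 _ v).1.
(* If all of [V] is null, the frame bounds say nothing about multiplicities, but then the whole
   family is null. *)
have [[phi0 Vphi0 n0]|null] := pselect (exists2 phi0, V phi0 & sqnorm phi0 != 0); last first.
  apply: (null_span_frame pH) => // j [_ Vj]; rewrite (translate_L2 _ (V_L2 _ Vj)).2.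
  by apply: contrapT => /eqP n0; apply: null; exists j.2.
have v0 := V_L2 _ Vphi0.
have p0 : 0 < sqnorm phi0 by rewrite lt_neqAle eq_sym n0 (sqnorm_ge0 pH v0).
pose M := Num.bound (B / sqnorm phi0).
have BM : B / sqnorm phi0 < M%:R by apply: archi_boundP; rewrite divr_ge0 ?ltW.
have M0 : 0 < M%:R :> R by apply: le_lt_trans BM; rewrite divr_ge0 ?ltW.
have M1 : 1 <= M%:R :> R by rewrite ler1n -(ltr0n R).
pose g (x : (heis R * L2heis R) * int) := (hmul x.1.1 (0, 0, x.2%:~R), x.1.2).
pose D := I `*`` (fun=> [set: int]).
have Dg x : D x -> (Gamma `*` V) (g x).
  move=> [[G1 V1] _]; split=> //=; rewrite GammaE; exists x.1.1 => //.
  by exists (0, 0, x.2%:~R) => //; exists x.2.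
have gD y : (Gamma `*` V) y -> exists2 x, D x & g x = y.
  move=> [+ Vy]; rewrite GammaE => -[k G1k [_ [l _ <-] E]].
  by exists ((k, y.2), l) => //; rewrite /g /= E -surjective_pairing.
(* The function [y.2] may be null, so [phi0] takes its place: for all k that occur over y, the
   vectors L_k phi0 are central translates of the single non-null vector L_(y.1) phi0, and
   [multiplicity_bound] counts them. *)
have fibers y s : (Gamma `*` V) y -> uniq s -> (forall x, x \in s -> D x /\ g x = y) ->
    (size s <= M)%N.
  move=> _ us hs; pose c (x : (heis R * L2heis R) * int) := (x.1.1, phi0).
  (* Over a fixed y the element k determines the integer l by cancellation, and the function is y.2;
     hence no pair is lost when only k is kept. *)
  have uc : uniq [seq c x | x <- s].
    rewrite map_inj_in_uniq // => -[[k1 f1] l1] [[k2 f2] l2] x1 x2 [kk].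
    have [_ E1] := hs _ x1; have [_ E2] := hs _ x2; move: E1; rewrite -E2 /g /= kk => -[E ->].
    by have /eqP := hmul_center_inj E; rewrite eqr_int => /eqP ->.
  have := multiplicity_bound fz frames' uc (translate_L2 y.1 v0).1.
  rewrite (translate_L2 _ v0).2 size_map -ler_pdivlMr // => le.
  rewrite -(ler_nat R); apply: le_trans (ltW BM); apply: le => j /mapP[x xs ->].
  have [[[G1 _] _] gx] := hs _ xs; split=> //; exists (- x.2).
  by rewrite -gx /f /c /g /= translate_hmul_center intrN translate_centerN.
(* Each element of the family is counted at least once, so [B] survives; it is counted at most M
   times, so the lower bound is divided by M. *)
exists (A / M%:R), B; split=> [||//|u cu].
- exact: divr_gt0.
- by apply: le_trans AB; rewrite ler_pdivrMr // ler_peMr // ltW.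
have gf j' : (Gamma `*` V) j' -> exists j l, I j /\ translate j'.1 j'.2 = translate (0, 0, l%:~R) (f j).
  move=> /gD [x [Ix _] <-]; exists x.1, x.2; split=> //.
  by rewrite /g /f /= translate_hmul_center.
have [lo up] := fz_frame fz cI vf frames' gf cu.
pose h (y : heis R * L2heis R) := sqmod (inner u (translate y.1 y.2)).
have E : (\esum_(j in I) \esum_(l in [set: int]) (sqmod (inner u (translate (0, 0, l%:~R) (f j))))%:E =
    \esum_(x in D) (h (g x))%:E)%E.
  rewrite esum_esum; last by move=> j l _ _; rewrite lee_fin sqmod_ge0.
  by apply: eq_esum => x _; rewrite /h /g /f /= translate_hmul_center.
have h0 y : 0 <= h y by exact: sqmod_ge0.
have [le1 le2] := esum_fibers h0 Dg gD fibers.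
rewrite E in lo up; split; last exact: le_trans le1 up.
have S0 : (0 <= \esum_(y in Gamma `*` V) (h y)%:E)%E by apply: esum_ge0 => y _; rewrite lee_fin.
have := le_trans lo le2.
case: (\esum_(y in _) _)%E S0 => [r|_|//]; last by rewrite leey.
by move=> _; rewrite -EFinM !lee_fin mulrAC ler_pdivrMr // [r * _]mulrC.
Qed.
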